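(* For every integer $\gamma>1$, $$\mathfrak{hms}_{1,\gamma}=\Big\{c=(c_n)_{n\in\mathbb N}\in\ell^\infty(\mathbb N):\ \lim_{N\to\infty}\frac1N\sum_{n=0}^Nc_n^2\ \text{ exists}\Big\}.$$ In particular, the inclusion $\mathfrak{hms}_{1,\gamma}\subseteq\ell^\infty(\mathbb N)$ is strict and the set $\mathfrak{hms}_{1,\gamma}$ does not depend on $\gamma$.
   Context: $P$ is the Szegő projection on $L^2(S^1)$: the orthogonal projection with $Pz^l=z^l$ for $l\ge0$ and $Pz^l=0$ for $l<0$. For $\alpha\in(0,1)$, an integer $\gamma>1$ and $c\in\ell^\infty(\mathbb N)$, the generalized Weierstrass function is $$W_{\alpha,\gamma,c}(e^{i\theta})=2\sum_{n=0}^\infty\gamma^{-\alpha n}c_n\cos(\gamma^n\theta)\in C^\alpha(S^1),$$ acting on $L^2(S^1)$ by multiplication. Define $$\mathfrak{hms}_{1,\gamma}:=\{c\in\ell^\infty(\mathbb N):\ [P,W_{1/2,\gamma,c}]^2\in\mathcal L^{1,\infty}(L^2(S^1))\text{ is measurable}\}.$$ Here $\mathcal L^{1,\infty}(\mathcal H)$ is the ideal of compact operators whose decreasing singular values satisfy $\mu_k(T)=O((1+k)^{-1})$. A singular state is a state $\omega$ on $\ell^\infty(\mathbb N)$ vanishing on $c_0(\mathbb N)$, with $\lim_{N\to\omega}x_N:=\omega(x)$; the Dixmier trace $\operatorname{tr}_\omega$ on $\mathcal L^{1,\infty}(\mathcal H)$ is the linear extension of $G\mapsto\lim_{N\to\omega}\frac1{\log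 N}\sum_{k=0}^N\mu_k(G)$, $G\ge0$. An operator $G\in\mathcal L^{1,\infty}(\mathcal H)$ is measurable if $\operatorname{tr}_\omega(G)$ is the same for all singular states $\omega$. *)

(* Defs.v *)
From HB Require Import structures.
From mathcomp Require Import all_boot all_order all_algebra.
From mathcomp Require Import generic_quotient.
From mathcomp Require Import complex.
From mathcomp Require Import all_classical all_reals all_analysis.
Set Implicit Arguments.
Unset Strict Implicit.
Unset Printing Implicit Defensive.
Import Order.TTheory GRing.Theory Num.Theory.
Import numFieldNormedType.Exports.

Local Open Scope classical_set_scope.
Local Open Scope ring_scope.
Local Open Scope complex_scope.

(** * The complex Hilbert space L^2(S^1)

    S^1 is parametrized by t |-> e^(it), t in [0, 2 pi[, so that functions on
    S^1 are R[i]-valued functions of t, and arc length is Lebesgue measure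
    restricted to [0, 2 pi[. The functions are defined on all of R, but their
    values outside [0, 2 pi[ do not matter: L2S1 is a quotient by almost
    everywhere equality for the restricted measure. *)

Definition circle_measure (R : realType) :
    {measure set (measurableTypeR R) -> \bar R} :=
  mrestr (@lebesgue_measure R) (measurable_itv `[(0 : R), pi *+ 2[).

(* Since |f|^2 = (Re f)^2 + (Im f)^2, these are the square-integrable f. *)
Definition L2fun (R : realType) : {pred measurableTypeR R -> R[i]} :=
  [pred f | (@complex.Re R \o f \in Lfun (circle_measure R) 2%:E) &&
            (@complex.Im R \o f \in Lfun (circle_measure R) 2%:E)].

Section L2S1.
Context (R : realType).
Local Notation mu := (circle_measure R).

Let in_ext (V : Type) (A : {pred measurableTypeR R -> V})
  (f g : measurableTypeR R -> V) : f \in A -> f =1 g -> g \in A.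
Proof. by move=> fA /funext <-. Qed.

Lemma L2fun_linear (a : R[i]) (f g : measurableTypeR R -> R[i]) :
  f \in @L2fun R -> g \in @L2fun R -> (fun t => a * f t + g t) \in @L2fun R.
Proof.
have [_ L] := Lfun_submod_closed mu (lee1n 2).
move=> /andP[f1 f2] /andP[g1 g2]; case: a => a b.
apply/andP; split.
- apply: in_ext (L a _ _ f1 (L (- b) _ _ f2 g1)) _ => t.
  rewrite !fctE/=; case: (f t) (g t) => ? ? [? ?] /=.
  by rewrite /GRing.scale/= mulNr addrA.
- apply: in_ext (L a _ _ f2 (L b _ _ f1 g2)) _ => t.
  rewrite !fctE/=; case: (f t) (g t) => ? ? [? ?] /=.
  by rewrite /GRing.scale/= addrA.
Qed.

Lemma L2fun0 : (0 : measurableTypeR R -> R[i]) \in @L2fun R.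
Proof.
have [L0 _] := Lfun_submod_closed mu (lee1n 2).
by apply/andP; split; exact: in_ext L0 _.
Qed.

Lemma L2fun_zmod_closed : zmod_closed (@L2fun R).
Proof.
split=> [|f g fL gL]; first exact: L2fun0.
apply: in_ext (L2fun_linear (-1) gL fL) _ => t.
by rewrite mulN1r addrC.
Qed.

HB.instance Definition _ := GRing.isZmodClosed.Build _ (@L2fun R)
  L2fun_zmod_closed.

Record L2rep := L2Rep {
  L2rep_fun :> measurableTypeR R -> R[i];
  L2repP : L2rep_fun \in @L2fun R }.

HB.instance Definition _ := [isSub for L2rep_fun].
HB.instance Definition _ := [Choice of L2rep by <:].
HB.instance Definition _ := [SubChoice_isSubZmodule of L2rep by <:].


Definition L2eq (f g : L2rep) : bool := `[< {ae mu, forall t, f t = g t} >].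

Lemma L2eq_refl : reflexive L2eq.
Proof. by move=> f; apply/asboolP; apply: aeW. Qed.

Lemma L2eq_sym : symmetric L2eq.
Proof.
by move=> f g; apply/asboolP/asboolP; apply: filterS => t ->.
Qed.

Lemma L2eq_trans : transitive L2eq.
Proof.
move=> g f h /asboolP fg /asboolP gh; apply/asboolP.
by apply: filterS2 fg gh => t ->.
Qed.

Canonical L2eq_equiv := EquivRel L2eq L2eq_refl L2eq_sym L2eq_trans.

Local Open Scope quotient_scope.

Definition L2S1 : Type := {eq_quot L2eq}.
HB.instance Definition _ := Choice.on L2S1.
HB.instance Definition _ := EqQuotient.on L2S1.

Lemma L2eqP (f g : L2rep) :
  {ae mu, forall t, f t = g t} <-> \pi_L2S1 f = \pi_L2S1 g.
Proof.
split=> [fg|/eqquotP/asboolP//]; exact/eqquotP/asboolP.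
Qed.

Lemma L2_reprK (f : L2rep) : {ae mu, forall t, repr (\pi_L2S1 f) t = f t}.
Proof. by apply/L2eqP; rewrite reprK. Qed.

Definition L2add (u v : L2S1) : L2S1 := \pi_L2S1 (repr u + repr v).
Definition L2opp (u : L2S1) : L2S1 := \pi_L2S1 (- repr u).
Definition L2zero : L2S1 := \pi_L2S1 0.

Lemma L2scale_subproof (a : R[i]) (f : L2rep) :
  (fun t => a * f t) \in @L2fun R.
Proof.
by apply: in_ext (L2fun_linear a (L2repP f) L2fun0) _ => t; rewrite addr0.
Qed.

Definition L2scale (a : R[i]) (u : L2S1) : L2S1 :=
  \pi_L2S1 (L2Rep (L2scale_subproof a (repr u))).

Lemma L2add_pi (f g : L2rep) : L2add (\pi_L2S1 f) (\pi_L2S1 g) = \pi_L2S1 (f + g).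
Proof.
apply/L2eqP; apply: filterS2 (L2_reprK f) (L2_reprK g) => t /= ft gt.
by rewrite !fctE ft gt.
Qed.

Lemma L2opp_pi (f : L2rep) : L2opp (\pi_L2S1 f) = \pi_L2S1 (- f).
Proof.
by apply/L2eqP; apply: filterS (L2_reprK f) => t /= ft; rewrite !fctE ft.
Qed.

Lemma L2scale_pi a (f : L2rep) :
  L2scale a (\pi_L2S1 f) = \pi_L2S1 (L2Rep (L2scale_subproof a f)).
Proof. by apply/L2eqP; apply: filterS (L2_reprK f) => t /= ->. Qed.

Lemma L2addA : associative L2add.
Proof.
move=> u v w; rewrite -[u]reprK -[v]reprK -[w]reprK.
move: (repr u) (repr v) (repr w) => f g h.
by rewrite (L2add_pi g h) (L2add_pi f g) (L2add_pi f) (L2add_pi _ h) addrA.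
Qed.

Lemma L2addC : commutative L2add.
Proof. by move=> u v; rewrite /L2add addrC. Qed.

Lemma L2add0 : left_id L2zero L2add.
Proof.
by move=> u; rewrite -[u]reprK (L2add_pi 0 (repr u)) add0r.
Qed.

Lemma L2addN : left_inverse L2zero L2opp L2add.
Proof.
move=> u; rewrite -[u]reprK; move: (repr u) => f.
by rewrite (L2opp_pi f) (L2add_pi _ f) addNr.
Qed.

HB.instance Definition _ :=
  GRing.isZmodule.Build L2S1 L2addA L2addC L2add0 L2addN.

Lemma L2scaleA a b u : L2scale a (L2scale b u) = L2scale (a * b) u.
Proof.
rewrite -[u]reprK; move: (repr u) => f.
rewrite (L2scale_pi b f) (L2scale_pi a) (L2scale_pi _ f); congr (\pi_L2S1 _).
by apply/val_inj/funext => t /=; rewrite mulrA.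
Qed.

Lemma L2scale1 : left_id 1 L2scale.
Proof.
move=> u; rewrite -[u]reprK; move: (repr u) => f.
rewrite (L2scale_pi 1 f); congr (\pi_L2S1 _).
by apply/val_inj/funext => t /=; rewrite mul1r.
Qed.

Lemma L2scaleDr : right_distributive L2scale L2add.
Proof.
move=> a u v; rewrite -[u]reprK -[v]reprK; move: (repr u) (repr v) => f g.
rewrite (L2add_pi f g) (L2scale_pi a f) (L2scale_pi a g) (L2scale_pi a).
rewrite (L2add_pi (L2Rep _) (L2Rep _)); congr (\pi_L2S1 _).
by apply/val_inj/funext => t /=; rewrite !fctE mulrDr.
Qed.

Lemma L2scaleDl u a b : L2scale (a + b) u = L2add (L2scale a u) (L2scale b u).
Proof.
rewrite -[u]reprK; move: (repr u) => f.
rewrite (L2scale_pi a f) (L2scale_pi b f) (L2scale_pi _ f).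
rewrite (L2add_pi (L2Rep _) (L2Rep _)); congr (\pi_L2S1 _).
by apply/val_inj/funext => t /=; rewrite !fctE mulrDl.
Qed.

HB.instance Definition _ := GRing.Zmodule_isLmodule.Build R[i] L2S1
  L2scaleA L2scale1 L2scaleDr L2scaleDl.

End L2S1.

(* The class of a square-integrable f; the junk value 0 for other f. *)
Definition L2class (R : realType) (f : R -> R[i]) : L2S1 R :=
  (\pi_(L2S1 R) (insubd (0 : L2rep R) f))%qT.

Definition L2inner (R : realType) (u v : L2S1 R) : R[i] :=
  let h t := (repr u : L2rep R) t * conjc ((repr v : L2rep R) t) in
  (\int[circle_measure R]_t complex.Re (h t)) +i*
  (\int[circle_measure R]_t complex.Im (h t)).

Definition L2mul (R : realType) (w : R -> R[i]) (u : L2S1 R) : L2S1 R :=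
  L2class (fun t => w t * (repr u : L2rep R) t).

(* The function z^l, as z = e^(it). *)
Definition zpow (R : realType) (l : int) : L2S1 R :=
  L2class (fun t : R => cos (l%:~R * t) +i* sin (l%:~R * t)).

(* The second and third clauses say that P is an orthogonal projection. As the
   z^l span a dense subspace, there is exactly one such P. *)
Definition is_szego (R : realType) (P : L2S1 R -> L2S1 R) : Prop :=
  [/\ linear P, (forall u, P (P u) = P u),
      (forall u v, L2inner (P u) v = L2inner u (P v)) &
      forall l : int, P (zpow R l) = if 0 <= l then zpow R l else 0].

Definition commutator (R : realType) (P : L2S1 R -> L2S1 R) (w : R -> R[i])
    (u : L2S1 R) : L2S1 R :=
  P (L2mul w u) - L2mul w (P u).

(** * Operators, singular values and Dixmier traces

    [ip] is the inner product of the Hilbert space [H], linear on the left. *)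

Section Operators.
Context (R : realType) (H : lmodType R[i]) (ip : H -> H -> R[i]).

Definition hnorm (x : H) : R := Num.sqrt (complex.Re (ip x x)).

Definition compact_operator (T : H -> H) : Prop :=
  linear T /\
  forall x : nat -> H, (forall n, hnorm (x n) <= 1) ->
    exists2 phi : nat -> nat, {homo phi : m n / (m < n)%N} &
      exists y : H, (fun n => hnorm (T (x (phi n)) - y)) @ \oo --> (0 : R).

Definition lin_indep k (e : 'I_k -> H) : Prop :=
  forall a : 'I_k -> R[i], \sum_i a i *: e i = 0 -> forall i, a i = 0.

(* [x] is in the eigenspace of |T| = (T^* T)^(1/2) for the eigenvalue [t >= 0],
   that is, T^* T x = t^2 x; this equation is paired with every [y], using
   <T^* T x, y> = <T x, T y>. *)
Definition abs_eigen (T : H -> H) (t : R) (x : H) : Prop :=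
  0 <= t /\ forall y, ip (T x) (T y) = (t ^+ 2)%:C * ip x y.

(* mu_k(T), for T compact: the eigenvalue number k (from 0) of |T|, in
   decreasing order and with multiplicity. It is the largest s such that |T| has
   k + 1 linearly independent eigenvectors with eigenvalues >= s. *)
Definition singular_value (T : H -> H) (k : nat) : R :=
  sup [set s : R | 0 <= s /\
    exists (e : 'I_k.+1 -> H) (t : 'I_k.+1 -> R),
      lin_indep e /\ forall i, s <= t i /\ abs_eigen T (t i) (e i)].

(* The ideal L^(1,oo). *)
Definition weakL1 : set (H -> H) :=
  [set T | compact_operator T /\
    exists M : R, forall k, singular_value T k <= M / (1 + k)%:R].

Definition positive_operator (T : H -> H) : Prop :=
  forall x, 0 <= ip (T x) x.

End Operators.

Definition linfty (R : realType) : set (nat -> R[i]) :=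
  [set c | exists M : R[i], forall n, `|c n| <= M].

Definition null_seq (R : realType) : set (nat -> R[i]) :=
  [set c | (c : nat -> R[i]^o) @ \oo --> (0 : R[i]^o)].

Arguments linfty R : clear implicits.
Arguments null_seq R : clear implicits.

(* A functional on l^oo is a function on all sequences, of which only the values
   on bounded sequences are constrained or used. *)
Definition singular_state (R : realType) (omega : (nat -> R[i]) -> R[i]) :
    Prop :=
  [/\ forall a x y, linfty R x -> linfty R y ->
        omega (fun n => a * x n + y n) = a * omega x + omega y,
      forall x, linfty R x -> (forall n, 0 <= x n) -> 0 <= omega x,
      omega (fun=> 1) = 1 &
      forall x, null_seq R x -> omega x = 0].

Section Dixmier.
Context (R : realType) (H : lmodType R[i]) (ip : H -> H -> R[i]).
Implicit Types (omega : (nat -> R[i]) -> R[i]) (G : H -> H).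

(* The terms N = 0, 1 are 0 because ln 0 = ln 1 = 0 and 0^-1 = 0; a singular
   state ignores them. *)
Definition log_mean G (N : nat) : R[i] :=
  ((ln N%:R)^-1 * \sum_(0 <= k < N.+1) singular_value ip G k)%:C.

Definition pos_weakL1 : set (H -> H) :=
  [set A | weakL1 ip A /\ positive_operator ip A].

(* The linear extension of G |-> omega (log_mean G) from the positive cone: [z]
   is its value on G = (A1 - A2) + i (A3 - A4), with all Aj positive in
   L^(1,oo). Every G in L^(1,oo) has such decompositions, and they all give the
   same [z], as omega (log_mean _) is additive on the positive cone. *)
Definition is_dixmier_value omega G (z : R[i]) : Prop :=
  exists A1 A2 A3 A4 : H -> H,
    [/\ [/\ pos_weakL1 A1, pos_weakL1 A2, pos_weakL1 A3 & pos_weakL1 A4],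
        forall x, G x = (A1 x - A2 x) + 'i%C *: (A3 x - A4 x) &
        z = (omega (log_mean A1) - omega (log_mean A2))
            + 'i%C * (omega (log_mean A3) - omega (log_mean A4))].

Definition dixmier_trace omega G : R[i] :=
  xget 0 [set z | is_dixmier_value omega G z].

Definition measurable_operator G : Prop :=
  forall omega omega' : (nat -> R[i]) -> R[i],
    singular_state omega -> singular_state omega' ->
    dixmier_trace omega G = dixmier_trace omega' G.

End Dixmier.

(** * Generalized Weierstrass functions *)

(* R[i]^o is R[i] with the topology of its norm. *)
Definition weierstrass (R : realType) (alpha : R) (gamma : nat)
    (c : nat -> R[i]) (theta : R) : R[i] :=
  2 * limn (series (fun n =>
    (gamma%:R `^ (- (alpha * n%:R)))%:C * c n
      * (cos ((gamma ^ n)%:R * theta))%:C) : nat -> R[i]^o).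

(* Measurable elements of L^(1,oo): the Dixmier traces are defined there only,
   hence the membership clause. *)
Definition hms1 (R : realType) (P : L2S1 R -> L2S1 R) (gamma : nat) :
    set (nat -> R[i]) :=
  [set c | linfty R c /\
    let K := commutator P (weierstrass 2^-1 gamma c) in
    weakL1 (@L2inner R) (K \o K) /\ measurable_operator (@L2inner R) (K \o K)].

(* Main.v *)
Require Import Defs.
From HB Require Import structures.
From mathcomp Require Import all_boot all_order all_algebra.
From mathcomp Require Import generic_quotient.
From mathcomp Require Import complex.
From mathcomp Require Import ring lra zify.
From mathcomp Require Import all_classical all_reals all_analysis.
From mathcomp Require Import measurable_realfun.
Set Implicit Arguments.
Unset Strict Implicit.
Unset Printing Implicit Defensive.
Import Order.TTheory GRing.Theory Num.Theory.
Import numFieldNormedType.Exports.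
Local Open Scope classical_set_scope.
Local Open Scope ring_scope.
Local Open Scope complex_scope.

(* Let K_c = [P, W_c] and let K_N be its part coming from the terms n < N. On
   the basis z^l, the commutator [P, z^m + z^-m] sends z^l to - z^(l-m) for
   0 <= l < m, to z^(l+m) for -m <= l < 0, and to 0 for other l. Hence K_N lives
   on the span of the z^l with -gamma^N <= l < gamma^N, and its squared
   Hilbert-Schmidt norm is 2 sum_(n < N) |c_n|^2, whereas the sup norm of the
   tail of W_c bounds |K_c - K_N|^2 by O(gamma^-N). For real c = r, Ky Fan's
   principle then shows that the first gamma^N singular values of - K_r^2 >= 0
   add up to 2 sum_(n < N) r_n^2 + o(N), so the log mean of - K_r^2 at N is, up
   to a null sequence, 2 / ln gamma times the mean of the r_n^2 at log_gamma N.
   For c = a + i b, put p = (a - b) / sqrt 2 and q = (a + b) / sqrt 2; then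
   K_c^2 = K_a^2 - K_b^2 + i (K_q^2 - K_p^2) and likewise for c_n^2, so
   tr_omega (K_c^2) is - 2 / ln gamma times the omega-limit of the mean of the
   c_n^2 at log_gamma N. All singular states agree on a bounded sequence exactly
   when it converges. *)

(** * Semidefinite forms and inner products *)

(** The exponent 1/2 is critical twice: it gives every term of the series the same Hilbert-Schmidt
    weight, and it makes the tail bound [gamma^-N] inverse to the dimension of the block, so that
    over [O(gamma^N)] orthonormal vectors the tail costs only [O(1)]. Cross terms between [K_N] and
    the tail are absorbed by [|x + y|^2 <= (1 + e) |x|^2 + (1 + 1/e) |y|^2]; for each [e] this
    leaves an error [O(e N)] plus a constant depending on [e], hence the [o(N)]. Beyond the rate
    [O(1/k)], singular values are never estimated singly: their partial sums are extremal values of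
    traces over orthonormal families, which can be tested on the Fourier basis. As singular values
    are defined through eigenvectors, this rests on the spectral theorem for compact positive
    operators. As the Dixmier trace is defined through decompositions, computing it requires that
    two decompositions of one operator give the same number, which is again a matter of Ky Fan's
    principle. For complex [c] the operator [K_c^2] is in general not self-adjoint, so a
    decomposition cannot be avoided. *)

Section ComplexSquare.
Context (R : realType).
Implicit Types (z w : R[i]).

(** The squared modulus as an element of [R]: the norm of [R[i]] takes its values in [R[i]], whereas
    all estimates below are real inequalities between squared norms. *)
Definition nsq z : R := complex.Re z ^+ 2 + complex.Im z ^+ 2.

Lemma mulJ_nsq z : z * conjc z = (nsq z)%:C.
Proof.
by case: z => a b; apply/eqP; rewrite eq_complex /nsq /=; apply/andP; split;
  apply/eqP; ring.
Qed.

Lemma nsqM z w : nsq (z * w) = nsq z * nsq w.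
Proof. by case: z w => a b [c d]; rewrite /nsq /=; ring. Qed.

Lemma nsqJ z : nsq (conjc z) = nsq z.
Proof. by case: z => a b; rewrite /nsq /= sqrrN. Qed.

Lemma nsqN z : nsq (- z) = nsq z.
Proof. by case: z => a b; rewrite /nsq /= !sqrrN. Qed.

Lemma nsqR (r : R) : nsq r%:C = r ^+ 2.
Proof. by rewrite /nsq /= expr0n /= addr0. Qed.

Lemma nsq_ge0 z : 0 <= nsq z.
Proof. by rewrite addr_ge0 ?sqr_ge0. Qed.

Lemma nsq0 : nsq 0 = 0.
Proof. by rewrite /nsq /= expr0n /= addr0. Qed.

Lemma nsq1 : nsq 1 = 1.
Proof. by rewrite /nsq /= expr0n /= addr0 expr1n. Qed.

Lemma nsq_eq0 z : (nsq z == 0) = (z == 0).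
Proof.
by rewrite /nsq paddr_eq0 ?sqr_ge0 // !sqrf_eq0 eq_complex.
Qed.

Lemma nsqD_le z w : nsq (z + w) <= 2 * nsq z + 2 * nsq w.
Proof.
case: z w => a b [c d]; rewrite /nsq /=.
have := sqr_ge0 (a - c); have := sqr_ge0 (b - d); lra.
Qed.

Lemma ReD z w : complex.Re (z + w) = complex.Re z + complex.Re w.
Proof. by case: z w => ? ? []. Qed.

Lemma ImD z w : complex.Im (z + w) = complex.Im z + complex.Im w.
Proof. by case: z w => ? ? []. Qed.

Lemma ReN z : complex.Re (- z) = - complex.Re z.
Proof. by case: z. Qed.

Lemma ImN z : complex.Im (- z) = - complex.Im z.
Proof. by case: z. Qed.

Lemma Re_sum I (r : seq I) (P : pred I) (F : I -> R[i]) :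
  complex.Re (\sum_(i <- r | P i) F i) = \sum_(i <- r | P i) complex.Re (F i).
Proof. exact: (big_morph _ ReD erefl). Qed.

Lemma Im_sum I (r : seq I) (P : pred I) (F : I -> R[i]) :
  complex.Im (\sum_(i <- r | P i) F i) = \sum_(i <- r | P i) complex.Im (F i).
Proof. exact: (big_morph _ ImD erefl). Qed.

Lemma conjc_sum I (r : seq I) (P : pred I) (F : I -> R[i]) :
  conjc (\sum_(i <- r | P i) F i) = \sum_(i <- r | P i) conjc (F i).
Proof. exact: rmorph_sum. Qed.

Lemma conjcM z w : conjc (z * w) = conjc z * conjc w.
Proof. exact: rmorphM. Qed.

Lemma ReZ (r : R) z : complex.Re (r%:C * z) = r * complex.Re z.
Proof. by case: z => a b /=; rewrite mul0r subr0. Qed.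

Lemma complexE2 z : z = (complex.Re z)%:C + 'i * (complex.Im z)%:C.
Proof. by case: z => a b; apply/eqP; rewrite eq_complex /=; apply/andP; split;
  apply/eqP; ring. Qed.

Lemma real_complexD (x y : R) : (x + y)%:C = x%:C + y%:C.
Proof. exact: rmorphD. Qed.

Lemma real_complexM (x y : R) : (x * y)%:C = x%:C * y%:C.
Proof. exact: rmorphM. Qed.

Lemma real_complexB (x y : R) : (x - y)%:C = x%:C - y%:C.
Proof. exact: rmorphB. Qed.

End ComplexSquare.

Section LinearMaps.
Context (K : nzRingType) (U V : lmodType K) (T : U -> V).
Hypothesis linT : linear T.

Lemma lin0 : T 0 = 0.
Proof. by have := linT (-1) 0 0; rewrite scaler0 addr0 scaleN1r addNr. Qed.

Lemma linD x y : T (x + y) = T x + T y.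
Proof. by rewrite -[in LHS](scale1r x) linT scale1r. Qed.

Lemma linZ a x : T (a *: x) = a *: T x.
Proof. by rewrite -[a *: x]addr0 linT lin0 addr0. Qed.

Lemma linN x : T (- x) = - T x.
Proof. by rewrite -scaleN1r linZ scaleN1r. Qed.

Lemma linB x y : T (x - y) = T x - T y.
Proof. by rewrite linD linN. Qed.

Lemma lin_sum I (r : seq I) (P : pred I) (F : I -> U) :
  T (\sum_(i <- r | P i) F i) = \sum_(i <- r | P i) T (F i).
Proof. exact: (big_morph T linD lin0). Qed.

End LinearMaps.

Section Forms.
Context (R : realType) (H : lmodType R[i]).
Implicit Types (f : H -> H -> R[i]) (x y : H).

(** Definiteness is left out so that the same theory, Cauchy-Schwarz included, applies to the inner
    product and to the form [<A x, y>] of a positive operator. *)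
Definition semidef f : Prop :=
  [/\ forall y a u v, f (a *: u + v) y = a * f u y + f v y,
      forall x y, f y x = conjc (f x y) & forall x, 0 <= f x x].

Definition qf f x : R := complex.Re (f x x).

Section Semidef.
Variables (f : H -> H -> R[i]) (fP : semidef f).

Lemma sform_linl y : linear (f^~ y : H -> R[i]^o).
Proof. by case: fP => l _ _ a u v; rewrite l. Qed.

Lemma sformC x y : f y x = conjc (f x y).
Proof. by case: fP. Qed.

Lemma sform_diag x : f x x = (qf f x)%:C.
Proof.
case: fP => _ _ /(_ x); rewrite /qf; case: (f x x) => a b.
by move=> /ger0_Im /= ->.
Qed.

Lemma qf_ge0 x : 0 <= qf f x.
Proof.
case: fP => _ _ /(_ x); rewrite /qf; case: (f x x) => a b.
by rewrite lecE /= => /andP[].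
Qed.

Lemma sformDl x y z : f (x + y) z = f x z + f y z.
Proof. exact: (linD (sform_linl z)). Qed.

Lemma sformZl a x z : f (a *: x) z = a * f x z.
Proof. exact: (linZ (sform_linl z)). Qed.

Lemma sformNl x z : f (- x) z = - f x z.
Proof. exact: (linN (sform_linl z)). Qed.

Lemma sform0l z : f 0 z = 0.
Proof. exact: (lin0 (sform_linl z)). Qed.

Lemma sform_suml I (r : seq I) (P : pred I) (F : I -> H) z :
  f (\sum_(i <- r | P i) F i) z = \sum_(i <- r | P i) f (F i) z.
Proof. exact: (lin_sum (sform_linl z)). Qed.

Lemma sformDr x y z : f z (x + y) = f z x + f z y.
Proof. by rewrite [LHS]sformC sformDl rmorphD /= -!sformC. Qed.

Lemma sformZr a x z : f z (a *: x) = conjc a * f z x.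
Proof. by rewrite [LHS]sformC sformZl rmorphM /= -sformC. Qed.

Lemma sformNr x z : f z (- x) = - f z x.
Proof. by rewrite [LHS]sformC sformNl rmorphN /= -sformC. Qed.

Lemma sform0r z : f z 0 = 0.
Proof. by rewrite [LHS]sformC sform0l rmorph0. Qed.

Lemma sform_sumr I (r : seq I) (P : pred I) (F : I -> H) z :
  f z (\sum_(i <- r | P i) F i) = \sum_(i <- r | P i) f z (F i).
Proof.
by rewrite [LHS]sformC sform_suml rmorph_sum; apply: eq_bigr => i _; rewrite /= -sformC.
Qed.

Lemma qfD x y : qf f (x + y) = qf f x + complex.Re (f x y) *+ 2 + qf f y.
Proof.
rewrite /qf !(sformDl, sformDr) !ReD (sformC x y).
by case: (f x y) => a b /=; ring.
Qed.

Lemma qfZ a x : qf f (a *: x) = nsq a * qf f x.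
Proof. by rewrite /qf sformZl sformZr mulrA mulJ_nsq ReZ. Qed.

Lemma qfN x : qf f (- x) = qf f x.
Proof. by rewrite -scaleN1r qfZ nsqN nsq1 mul1r. Qed.

Lemma qf0 : qf f 0 = 0.
Proof. by rewrite /qf sform0l. Qed.

(** The form is nonnegative at [x - t f(x, y) y] for every real [t]; take [t = 1 / f(y, y)], or [t]
    large when [f(y, y) = 0], which may happen with [y] nonzero. *)
Lemma cauchy_schwarz x y : nsq (f x y) <= qf f x * qf f y.
Proof.
set s := nsq (f x y).
have key (t : R) : 0 <= qf f x - t * s *+ 2 + t ^+ 2 * s * qf f y.
  have := qf_ge0 (x + (- t%:C * f x y) *: y); rewrite qfD qfZ sformZr.
  rewrite nsqM nsqN nsqR -/s.
  suff -> : complex.Re (conjc (- t%:C * f x y) * f x y) = - (t * s).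
    by rewrite mulNrn.
  by rewrite /s /nsq; case: (f x y) => a b /=; ring.
have s0 : 0 <= s := nsq_ge0 _.
have [fy0|fy0] := eqVneq (qf f y) 0; last first.
  have fy : 0 < qf f y by rewrite lt_neqAle eq_sym fy0 qf_ge0.
  have := key (qf f y)^-1; have -> : qf f x - (qf f y)^-1 * s *+ 2 +
    (qf f y)^-1 ^+ 2 * s * qf f y = qf f x - s / qf f y by field.
  by rewrite subr_ge0 ler_pdivrMr.
rewrite fy0 mulr0; rewrite leNgt; apply/negP => sp.
have := key ((qf f x + 1) / s).
rewrite fy0 mulr0 addr0 divfK ?gt_eqF //.
by have := qf_ge0 x; lra.
Qed.

(** Nonnegativity at [e x - y], divided by [e]. A small [e] keeps the coefficient of the main term
    close to 1, and [e = 1] gives the crude factor 2. *)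
Lemma qfD_eps (e : R) x y : 0 < e ->
  qf f (x + y) <= (1 + e) * qf f x + (1 + e^-1) * qf f y.
Proof.
move=> e0; have := qf_ge0 (e%:C *: x - y).
rewrite !qfD qfN qfZ nsqR sformNr ReN sformZl ReZ => h.
rewrite -subr_ge0.
have -> : (1 + e) * qf f x + (1 + e^-1) * qf f y -
  (qf f x + complex.Re (f x y) *+ 2 + qf f y) =
  e^-1 * (e ^+ 2 * qf f x + - (e * complex.Re (f x y)) *+ 2 + qf f y).
  by field; rewrite gt_eqF.
by rewrite mulr_ge0 // invr_ge0 ltW.
Qed.

End Semidef.

Definition inner_product f : Prop := semidef f /\ forall x, f x x = 0 -> x = 0.

End Forms.

Section PreHilbert.
Context (R : realType) (H : lmodType R[i]) (ip : H -> H -> R[i]).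
Hypothesis ipP : inner_product ip.
Local Notation N2 := (qf ip).
Implicit Types (x y z : H) (T A B : H -> H).

Let sd : semidef ip. Proof. by case: ipP. Qed.

Lemma N2_eq0 x : (N2 x == 0) = (x == 0).
Proof.
apply/eqP/eqP => [x0|->]; last exact: qf0.
by case: ipP => _; apply; rewrite (sform_diag sd) x0.
Qed.

Lemma N2_gt0 x : x != 0 -> 0 < N2 x.
Proof. by move=> x0; rewrite lt_neqAle eq_sym N2_eq0 x0 qf_ge0. Qed.

Lemma sqr_hnorm x : hnorm ip x ^+ 2 = N2 x.
Proof. by rewrite sqr_sqrtr // qf_ge0. Qed.

Lemma ipnorm_ge0 x : 0 <= hnorm ip x.
Proof. exact: sqrtr_ge0. Qed.

Lemma ipnorm_le x (a : R) : 0 <= a -> (hnorm ip x <= a) = (N2 x <= a ^+ 2).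
Proof.
by move=> a0; rewrite -sqr_hnorm ler_pXn2r // nnegrE ?ipnorm_ge0.
Qed.

Lemma ipnorm_lt x (a : R) : 0 <= a -> (hnorm ip x < a) = (N2 x < a ^+ 2).
Proof.
by move=> a0; rewrite -sqr_hnorm ltr_pXn2r // nnegrE ?ipnorm_ge0.
Qed.

Lemma ipnormD x y : hnorm ip (x + y) <= hnorm ip x + hnorm ip y.
Proof.
rewrite ipnorm_le ?addr_ge0 ?ipnorm_ge0 // sqrrD !sqr_hnorm (qfD sd).
rewrite lerD2r lerD2l lerMn2r /= (le_trans (ler_norm _)) //.
rewrite -(@ler_pXn2r _ 2) ?nnegrE ?mulr_ge0 ?ipnorm_ge0 // exprMn !sqr_hnorm.
rewrite real_normK ?num_real //; apply: le_trans (cauchy_schwarz sd x y).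
by rewrite lerDl sqr_ge0.
Qed.

Lemma ipnorm0 : hnorm ip 0 = 0.
Proof. by rewrite /hnorm -/(qf ip _) (qf0 sd) sqrtr0. Qed.

(** The matrix of the values [phi j (e i)] has more rows than columns, so its left kernel is not
    zero. *)
Lemma kill_functionals d k (e : 'I_k.+1 -> H) (phi : 'I_d -> H -> R[i]) :
  (d <= k)%N -> (forall j, linear (phi j : H -> R[i]^o)) ->
  exists2 a : 'I_k.+1 -> R[i], (exists i, a i != 0) &
    forall j, phi j (\sum_i a i *: e i) = 0.
Proof.
move=> dk phil; pose M := \matrix_(i < k.+1, j < d) phi j (e i).
have : kermx M != 0.
  rewrite -mxrank_eq0 mxrank_ker -lt0n subn_gt0.
  exact: leq_ltn_trans (rank_leq_col _) _.
move=> /rowV0Pn[v /sub_kermxP vM v0]; exists (v 0).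
  by move/rV0Pn : v0.
move=> j; rewrite (lin_sum (phil j)).
have := congr1 (fun N : 'rV[R[i]]_d => N 0 j) vM; rewrite !mxE => vM0; rewrite -[RHS]vM0.
by apply: eq_bigr => i _; rewrite (linZ (phil j)) mxE.
Qed.

(* With [G] the Gram matrix of the [e i], both sides differ by the quadratic
   form of [(t_i^2 - s^2) G_ij]. As [G_ij = 0] unless [t_i = t_j], this matrix
   is [c_i G_ij c_j] with [c_i = (t_i^2 - s^2)^(1/2)], hence is positive. *)
Lemma abs_eigen_span T k (e : 'I_k -> H) (t : 'I_k -> R) (s : R)
    (a : 'I_k -> R[i]) : linear T -> 0 <= s ->
  (forall i, s <= t i /\ abs_eigen ip T (t i) (e i)) ->
  s ^+ 2 * N2 (\sum_i a i *: e i) <= N2 (T (\sum_i a i *: e i)).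
Proof.
move=> linT s0 et; rewrite -subr_ge0.
have ts i : 0 <= t i ^+ 2 - s ^+ 2.
  by rewrite subr_ge0 ler_pXn2r // ?nnegrE //; case: (et i) => // ? [].
pose c i : R := Num.sqrt (t i ^+ 2 - s ^+ 2).
suff -> : N2 (T (\sum_i a i *: e i)) - s ^+ 2 * N2 (\sum_i a i *: e i) =
    N2 (\sum_i ((c i)%:C * a i) *: e i) by exact: qf_ge0.
apply: (@complexI R); rewrite real_complexB real_complexM -!(sform_diag sd).
rewrite (lin_sum linT) !(sform_suml sd) mulr_sumr -sumrB.
apply: eq_bigr => i _; rewrite !(sform_sumr sd) mulr_sumr -sumrB.
apply: eq_bigr => j _; rewrite !(linZ linT) !(sformZl sd) !(sformZr sd).
have [_ [_ ei]] := et i; have [_ [_ ej]] := et j; rewrite ei.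
have tG : (t i ^+ 2)%:C * ip (e i) (e j) = (t j ^+ 2)%:C * ip (e i) (e j).
  by rewrite -ei (sformC sd) ej conjcM -(sformC sd) conjc_real.
rewrite conjcM conjc_real.
have -> : (c i)%:C * a i * ((c j)%:C * conjc (a j) * ip (e i) (e j)) =
    a i * conjc (a j) * ((c i * c j)%:C * ip (e i) (e j)).
  by rewrite real_complexM; ring.
suff -> : (c i * c j)%:C * ip (e i) (e j) =
    (t i ^+ 2 - s ^+ 2)%:C * ip (e i) (e j) by rewrite real_complexB; ring.
have [->|G0] := eqVneq (ip (e i) (e j)) 0; first by rewrite !mulr0.
have tt : t i ^+ 2 = t j ^+ 2 by apply/(@complexI R)/(mulIf G0).
by rewrite /c -tt -expr2 sqr_sqrtr.
Qed.

(** The set under the supremum in [singular_value], named so that it can be bounded before it is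
    known to be nonempty. *)
Definition sv_set T k : set R := [set s : R | 0 <= s /\
    exists (e : 'I_k.+1 -> H) (t : 'I_k.+1 -> R),
      lin_indep e /\ forall i, s <= t i /\ abs_eigen ip T (t i) (e i)].

Lemma sv_ub T k d (eps : R) (phi : 'I_d -> H -> R[i]) :
  linear T -> (d <= k)%N -> (forall j, linear (phi j : H -> R[i]^o)) ->
  0 <= eps ->
  (forall x, (forall j, phi j x = 0) -> N2 (T x) <= eps ^+ 2 * N2 x) ->
  ubound (sv_set T k) eps.
Proof.
move=> linT dk phil eps0 small s [s0 [e [t [free et]]]].
have [a [i ai] ka] := kill_functionals e dk phil.
have x0 : \sum_i a i *: e i != 0.
  by apply: contraNneq ai => /free/(_ i) ->.
have := le_trans (abs_eigen_span a linT s0 et) (small _ ka).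
by rewrite ler_pM2r ?N2_gt0 // ler_pXn2r ?nnegrE.
Qed.

Lemma sv_le T k d (eps : R) (phi : 'I_d -> H -> R[i]) :
  linear T -> (d <= k)%N -> (forall j, linear (phi j : H -> R[i]^o)) ->
  0 <= eps ->
  (forall x, (forall j, phi j x = 0) -> N2 (T x) <= eps ^+ 2 * N2 x) ->
  singular_value ip T k <= eps.
Proof.
move=> linT dk phil eps0 small; have ub := sv_ub linT dk phil eps0 small.
rewrite /singular_value -/(sv_set T k).
have [S0|S0] := pselect (sv_set T k !=set0); first exact: ge_sup.
(* The supremum of an empty set is 0 by convention, which is also at most [eps]. *)
by rewrite sup_out // => -[].
Qed.

(** Families are indexed by [nat] with only the first [n] vectors constrained, so that they can be
    truncated and extended freely. *)
Definition orthonormal_fam n (v : nat -> H) : Prop :=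
  forall i j, (i < n)%N -> (j < n)%N -> ip (v i) (v j) = (i == j)%:R.

Section Orthonormal.
Variables (n : nat) (v : nat -> H).
Hypothesis vo : orthonormal_fam n v.

Definition orth_proj x := \sum_(i < n) ip x (v i) *: v i.

Lemma ip_comb (a : nat -> R[i]) j : (j < n)%N ->
  ip (\sum_(i < n) a i *: v i) (v j) = a j.
Proof.
move=> jn; rewrite (sform_suml sd) (bigD1 (Ordinal jn)) //=.
rewrite (sformZl sd) vo // eqxx mulr1 big1 ?addr0 // => i ij.
rewrite (sformZl sd) vo //; case: eqP => [ij'|]; last by rewrite mulr0.
by move: ij; rewrite -val_eqE /= ij' eqxx.
Qed.

Lemma N2_comb (a : nat -> R[i]) :
  N2 (\sum_(i < n) a i *: v i) = \sum_(i < n) nsq (a i).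
Proof.
apply: (@complexI R); rewrite -(sform_diag sd) (sform_sumr sd) rmorph_sum.
by apply: eq_bigr => i _; rewrite (sformZr sd) ip_comb // mulrC mulJ_nsq.
Qed.

Lemma orth_proj_perp x j : (j < n)%N -> ip (x - orth_proj x) (v j) = 0.
Proof.
by move=> jn; rewrite (sformDl sd) (sformNl sd) (@ip_comb (fun i => ip x (v i))) // subrr.
Qed.

Lemma ip_comb_perp x (a : nat -> R[i]) : (forall j, (j < n)%N -> ip x (v j) = 0) ->
  ip x (\sum_(i < n) a i *: v i) = 0.
Proof.
by move=> xv; rewrite (sform_sumr sd) big1 // => i _; rewrite (sformZr sd) xv ?mulr0.
Qed.

Lemma N2_proj x : N2 x = \sum_(i < n) nsq (ip x (v i)) + N2 (x - orth_proj x).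
Proof.
have pp : ip (x - orth_proj x) (orth_proj x) = 0.
  exact: (ip_comb_perp (fun i => ip x (v i)) (orth_proj_perp x)).
by rewrite -[x in LHS](subrK (orth_proj x)) [LHS](qfD sd) pp mul0rn addr0 addrC
  -(N2_comb (fun i => ip x (v i))).
Qed.

Lemma bessel x : \sum_(i < n) nsq (ip x (v i)) <= N2 x.
Proof. by rewrite [leRHS]N2_proj lerDl qf_ge0. Qed.

End Orthonormal.

(** Of membership in the span, only Parseval's identity is kept: it is what [ky_fan] asks of a
    family whose span contains the eigenvectors. *)
Lemma gram_schmidt (s : seq H) : exists m g, [/\ (m <= size s)%N,
  orthonormal_fam m g & forall x, x \in s -> N2 x = \sum_(j < m) nsq (ip x (g j))].
Proof.
suff [m [g [ms go gs]]] : exists m g, [/\ (m <= size s)%N, orthonormal_fam m g &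
    forall x, x \in s -> x = orth_proj m g x].
  exists m, g; split=> // x /gs xE.
  by rewrite (N2_proj go x) -xE subrr (qf0 sd) addr0.
elim/last_ind: s => [|s y [m [g [ms go gs]]]]; first by exists 0%N, (fun=> 0).
pose r := y - orth_proj m g y.
have [r0|r0] := eqVneq r 0.
  exists m, g; split=> //; first by rewrite size_rcons leqW.
  move=> x; rewrite mem_rcons inE => /predU1P[->|/gs//].
  by apply/eqP; rewrite -subr_eq0 -/r r0.
pose c : R := Num.sqrt (N2 r).
have c0 : 0 < c by rewrite sqrtr_gt0 N2_gt0.
pose u := c^-1%:C *: r.
pose g' i := if (i < m)%N then g i else u.
have gu i : (i < m)%N -> ip u (g i) = 0.
  by move=> im; rewrite (sformZl sd) (orth_proj_perp go) // mulr0.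
have uu : ip u u = 1.
  rewrite (sform_diag sd) (qfZ sd) nsqR exprVn sqr_sqrtr ?qf_ge0 // mulVf //.
  by rewrite gt_eqF ?N2_gt0.
have g'o : orthonormal_fam m.+1 g'.
  move=> i j; rewrite !ltnS /g' => im jm.
  case: ltnP => im'; case: ltnP => jm'; first exact: go.
  - by rewrite (sformC sd) gu // rmorph0 ltn_eqF // (leq_trans im').
  - by rewrite gu // gtn_eqF // (leq_trans jm').
  - have -> : i = m by apply/eqP; rewrite eqn_leq im.
    have -> : j = m by apply/eqP; rewrite eqn_leq jm.
    by rewrite eqxx uu.
have projE x : orth_proj m.+1 g' x = orth_proj m g x + ip x u *: u.
  rewrite /orth_proj big_ord_recr /= /g' ltnn; congr (_ + _).
  by apply: eq_bigr => i _; rewrite ltn_ord.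
exists m.+1, g'; split=> //; first by rewrite size_rcons ltnS.
move=> x; rewrite mem_rcons inE projE => /predU1P[->|xs].
- apply/eqP; rewrite -subr_eq0 opprD addrA -/r; apply/eqP.
  have -> : ip y u = c%:C.
    rewrite -(subrK (orth_proj m g y) y) -/r (sformDl sd) [X in _ + X](sformC sd).
    have -> : ip u (orth_proj m g y) = 0.
      exact: (ip_comb_perp (fun i => ip y (g i)) gu).
    rewrite rmorph0 addr0.
    rewrite (sformZr sd) (sform_diag sd) conjc_real -real_complexM.
    by rewrite -(sqr_sqrtr (qf_ge0 sd r)) -/c expr2 mulKf ?gt_eqF.
  by rewrite scalerA -real_complexM divff ?gt_eqF // scale1r subrr.
- have xE := gs _ xs; rewrite -xE.
  rewrite (_ : ip x u = 0) ?scale0r ?addr0 // xE (sformC sd).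
  have -> : ip u (orth_proj m g x) = 0.
    exact: (ip_comb_perp (fun i => ip x (g i)) gu).
  by rewrite rmorph0.
Qed.

End PreHilbert.

(** * Compact positive operators *)

Lemma mem_mkseq (T : eqType) (v : nat -> T) n z :
  z \in mkseq v n -> exists2 i, (i < n)%N & z = v i.
Proof. by case/mapP => i; rewrite mem_iota /= => *; exists i. Qed.

Section CompactPositive.
Context (R : realType) (H : lmodType R[i]) (ip : H -> H -> R[i]).
Hypothesis ipP : inner_product ip.
(* So that the list of eigenvectors of a compact operator never ends. *)
Hypothesis infdim : forall s : seq H,
  exists u, ip u u = 1 /\ forall z, z \in s -> ip u z = 0.
Local Notation N2 := (qf ip).
Implicit Types (x y z : H).

Let sd : semidef ip. Proof. by case: ipP. Qed.

(** Hermitian symmetry comes by polarization over the complex numbers: the form is real at [x + y]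
    and at [x + i y]. *)
Lemma positive_semidef (A : H -> H) : linear A -> positive_operator ip A ->
  semidef (fun x y => ip (A x) y).
Proof.
move=> linA posA; split=> [y a u v|x y|//].
  by rewrite linA (sformDl sd) (sformZl sd).
have re z : complex.Im (ip (A z) z) = 0 by apply: ger0_Im; exact: posA.
have := re (x + y); rewrite (linD linA) !(sformDl sd) !(sformDr sd) !ImD !re.
have := re (x + 'i *: y).
rewrite (linD linA) (linZ linA) !(sformDl sd) !(sformDr sd).
rewrite !(sformZl sd) !(sformZr sd) !ImD !re.
rewrite mulrA mulJ_nsq.
have ImZ (r : R) (w : R[i]) : complex.Im (r%:C * w) = r * complex.Im w.
  by case: w => a b /=; rewrite mul0r addr0.
rewrite ImZ re mulr0.
case: (ip (A x) y) (ip (A y) x) => a b [c d] /= h1 h2.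
by apply/eqP; rewrite eq_complex /=; apply/andP; split; apply/eqP; lra.
Qed.

(** Otherwise the unit ball contains vectors [x n] with [n < |A (x n)|], and no subsequence of their
    images can converge. *)
Lemma compact_bounded (A : H -> H) : compact_operator ip A ->
  exists2 C : R, 0 <= C & forall x, N2 (A x) <= C * N2 x.
Proof.
move=> [linA cA]; apply: contrapT => unb.
have big n : exists x, hnorm ip x <= 1 /\ n%:R < hnorm ip (A x).
  apply: contrapT => nb; apply: unb; exists (n%:R ^+ 2); first exact: sqr_ge0.
  move=> x; have [->|x0] := eqVneq x 0.
    by rewrite (lin0 linA) (qf0 sd) mulr0.
  have c0 := N2_gt0 ipP x0; set c : R := Num.sqrt (N2 x).
  have cc : 0 < c by rewrite sqrtr_gt0.
  have cE : c ^+ 2 = N2 x by rewrite sqr_sqrtr ?ltW.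
  rewrite leNgt; apply/negP => lt; apply: nb; exists (c^-1%:C *: x).
  rewrite ipnorm_le // ltNge ipnorm_le // (linZ linA) !(qfZ sd) !nsqR.
  rewrite exprVn cE mulVf ?gt_eqF // expr1n lexx -ltNge; split=> //.
  by rewrite mulrC ltr_pdivlMr.
have [x xP] := choice big.
have [//|phi phi_mono [y /cvgrPdist_lt/(_ 1 ltr01)[N _ Ny]]] := cA x.
  by move=> n; case: (xP n).
have phi_ge n : (n <= phi n)%N.
  by elim: n => // n ih; rewrite (leq_ltn_trans ih) // phi_mono.
pose m := maxn N (Num.truncn (hnorm ip y + 1)).+1.
have /= := Ny m (leq_maxl _ _); rewrite sub0r normrN ger0_norm ?ipnorm_ge0 // => h1.
have [_] := xP (phi m); have := ipnormD ipP (A (x (phi m)) - y) y; rewrite subrK.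
have : (hnorm ip y + 1 < m%:R).
  apply: lt_le_trans (truncnS_gt _) _.
  by rewrite ler_nat leq_maxr.
have : m%:R <= (phi m)%:R :> R by rewrite ler_nat.
lra.
Qed.

Section Spectral.
Variable A : H -> H.
Hypotheses (cA : compact_operator ip A) (pA : positive_operator ip A).
Let linA : linear A. Proof. by case: cA. Qed.
Let fA x y := ip (A x) y.
Let sdA : semidef fA. Proof. exact: positive_semidef. Qed.
Local Notation NA := (qf fA).
Let perp (s : seq H) x := forall z, z \in s -> ip x z = 0.

Let symA x y : ip (A x) y = ip x (A y).
Proof. by rewrite -[LHS]/(fA x y) (sformC sdA) /fA -(sformC sd). Qed.

Let perpA s x : (forall z, z \in s -> exists l : R, A z = l%:C *: z) ->
  perp s x -> perp s (A x).
Proof.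
move=> eig px z zs; have [l zE] := eig _ zs.
by rewrite symA zE (sformZr sd) px // mulr0.
Qed.

(** Cauchy-Schwarz for the form of [A] at [x] and [A x] reads [|A x|^4 <= NA x * NA (A x)]. As [A x]
    is again orthogonal to the eigenvectors in [s], the second factor is at most [l |A x|^2]. *)
Let N2A_le s (l : R) : (forall z, z \in s -> exists l : R, A z = l%:C *: z) ->
  (forall x, perp s x -> NA x <= l * N2 x) ->
  forall x, perp s x -> N2 (A x) <= l * NA x.
Proof.
move=> eig le x px; have := cauchy_schwarz sdA x (A x).
rewrite /fA (sform_diag sd) nsqR -/fA => cs.
have [->|Ax0] := eqVneq (A x) 0.
  rewrite (qf0 sd) mulr_ge0 ?(qf_ge0 sdA) //.
  (* A unit vector orthogonal to [s] shows that [0 <= l]. *)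
  have [u [u1 pu]] := infdim s; have := le u pu.
  by rewrite [N2 u]/qf u1 /= mulr1; apply: le_trans; exact: qf_ge0.
have N0 := N2_gt0 ipP Ax0.
rewrite -(ler_pM2r N0) -expr2 (le_trans cs) // mulrAC mulrC.
by rewrite ler_wpM2r ?(qf_ge0 sdA) // le //; exact: perpA.
Qed.

(** The form is maximized on the unit ball of the orthogonal complement of [s]. Compactness gives a
    limit [y] of the images [A x] along a maximizing sequence, and [y] itself is the eigenvector: as
    [A x - l x] tends to 0, so does [y - l x]. The vectors [x] are not asked to converge, so
    completeness of [H] does not enter. *)
Let next_eigenvector s : (forall z, z \in s -> exists l : R, A z = l%:C *: z) ->
  exists u, exists l : R, [/\ ip u u = 1, perp s u, A u = l%:C *: u, 0 <= l &
    forall x, perp s x -> NA x <= l * N2 x].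
Proof.
move=> eig; have [C C0 bA] := compact_bounded cA.
pose S := [set r : R | exists x, [/\ perp s x, N2 x <= 1 & r = NA x]].
(* From [0 <= |A x - x|^2 = |A x|^2 - 2 NA x + |x|^2] with [|A x|^2 <= C] and [|x|^2 <= 1]. *)
have Sub : ubound S ((C + 1) / 2).
  move=> _ [x [_ x1 ->]].
  have := qf_ge0 sd (A x - x); rewrite (qfD sd) (qfN sd) (sformNr sd) ReN.
  rewrite -/(fA x x) -/(NA x); have := bA x.
  have : C * N2 x <= C by rewrite ler_piMr.
  by move=> *; lra.
have S0 : S 0.
  exists 0; split; rewrite ?(qf0 sd) ?(qf0 sdA) // => z _; exact: (sform0l sd).
have hS : has_sup S by split; [exists 0 | exists ((C + 1) / 2)].
pose l := sup S.
have l0 : 0 <= l by apply: ub_le_sup => //; exists ((C + 1) / 2).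
have le x : perp s x -> NA x <= l * N2 x.
  move=> px; have [->|x0] := eqVneq x 0.
    by rewrite (qf0 sd) (qf0 sdA) mulr0.
  have c0 := N2_gt0 ipP x0; set c : R := Num.sqrt (N2 x).
  have cE : c ^+ 2 = N2 x by rewrite sqr_sqrtr ?ltW.
  rewrite -ler_pdivrMr //; apply: ub_le_sup; first by exists ((C + 1) / 2).
  exists (c^-1%:C *: x); split.
  - by move=> z zs; rewrite (sformZl sd) px ?mulr0.
  - by rewrite (qfZ sd) nsqR exprVn cE mulVf // gt_eqF.
  - by rewrite (qfZ sdA) nsqR exprVn cE mulrC.
have N2Al := N2A_le eig le.
(* If the supremum is 0, then [N2A_le] makes [A] vanish on the complement of [s], and any unit
   vector there will do. *)
have [l00|lneq0] := eqVneq l 0.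
  have [u [u1 pu]] := infdim s; exists u, 0; split=> //; last first.
    by move=> x /le; rewrite l00.
  rewrite scale0r; apply/eqP; rewrite -(N2_eq0 ipP) eq_le qf_ge0 // andbT.
  by have := N2Al u pu; rewrite l00 mul0r.
have lp : 0 < l by rewrite lt_neqAle eq_sym lneq0.
have approx n : exists x, [/\ perp s x, N2 x <= 1 & l - n.+1%:R^-1 < NA x].
  have [|_ [x [px x1 ->]] lt] := @sup_adherent _ S n.+1%:R^-1 _ hS.
    by rewrite invr_gt0.
  by exists x.
have [x xP] := choice approx; clearbody l; case: (cA) => _ /(_ x)[].
  by move=> n; rewrite ipnorm_le // expr1n; case: (xP n).
move=> phi phi_mono [y yl].
have phi_ge n : (n <= phi n)%N.
  by elim: n => // n ih; rewrite (leq_ltn_trans ih) // phi_mono.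
(* Near-maximizers are near-eigenvectors: [|A z - l z|^2 <= l NA z - 2 l NA z + l^2 = l (l - NA z)].
   With [NA z > l - d] and [|A z - y|^2 < d], this gives [|y - l z|^2 <= 2 (d + l d) = e / 2]. *)
have near (e : R) : 0 < e -> exists z, [/\ perp s z, N2 z <= 1,
    l - e < NA z, N2 (A z - y) < e & N2 (y - l%:C *: z) < e].
  move=> e0; pose d := e / (4 * (1 + l)).
  have d0 : 0 < d by rewrite divr_gt0 // mulr_gt0 // ltr_pwDl.
  have dE : 4 * (d + l * d) = e by rewrite /d; field; lra.
  have ld : 0 <= l * d by rewrite mulr_ge0 // ltW.
  clearbody d.
  have sd0 : 0 < Num.sqrt d by rewrite sqrtr_gt0.
  move/cvgrPdist_lt : yl => /(_ _ sd0)[N _ Ny].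
  pose m := maxn N (Num.truncn d^-1); exists (x (phi m)).
  have [px x1 lx] := xP (phi m).
  have /= := Ny m (leq_maxl _ _).
  rewrite sub0r normrN ger0_norm ?ipnorm_ge0 // ipnorm_lt ?sqrtr_ge0 //.
  rewrite sqr_sqrtr ?(ltW d0) // => Axy.
  have md : (phi m).+1%:R^-1 < d.
    rewrite invf_plt ?posrE //; apply: lt_le_trans (truncnS_gt _) _.
    by rewrite ler_nat ltnS (leq_trans (leq_maxr _ _) (phi_ge m)).
  move: lx md; set q := _^-1; move: q => q lx md.
  split=> //; [lra|lra|].
  have := qfD_eps sd (y - A (x (phi m))) (A (x (phi m)) - l%:C *: x (phi m)) ltr01.
  rewrite addrA subrK invr1 -[in qf _ (y - _)]opprB (qfN sd).
  suff : N2 (A (x (phi m)) - l%:C *: x (phi m)) <= l * d by lra.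
  rewrite (qfD sd) (qfN sd) (qfZ sd) nsqR (sformNr sd) (sformZr sd) ReN.
  rewrite conjc_real ReZ -/(fA (x (phi m)) (x (phi m))) -/(NA (x (phi m))).
  have := N2Al _ px; have : l ^+ 2 * N2 (x (phi m)) <= l ^+ 2.
    by rewrite ler_piMr // sqr_ge0.
  have : l * (l - d) <= l * NA (x (phi m)) by rewrite ler_pM2l //; lra.
  by rewrite mulrBr -expr2; lra.
have small (a b : R) : 0 <= b -> (forall e, 0 < e -> a <= b * e) -> a <= 0.
  move=> b0 ae; rewrite leNgt; apply/negP => a0.
  have := ae (a / (2 * (b + 1))) _; rewrite divr_gt0 ?mulr_gt0 ?ltr_wpDl //.
  move=> /(_ isT); rewrite mulrCA -[leLHS]mulr1 ler_pM2l //.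
  by rewrite ler_pdivlMr ?mulr_gt0 ?ltr_wpDl //; lra.
have py : perp s y.
  move=> w ws; apply/eqP; rewrite -nsq_eq0 eq_le nsq_ge0 andbT.
  apply: (small _ (N2 w)); first exact: qf_ge0.
  move=> e /near[z [pz _ _ _ ye]].
  have := cauchy_schwarz sd (y - l%:C *: z) w.
  rewrite (sformDl sd) (sformNl sd) (sformZl sd) pz // mulr0 subr0.
  by move/le_trans; apply; rewrite mulrC ler_wpM2l ?qf_ge0 // ltW.
have Ay : A y = l%:C *: y.
  apply/eqP; rewrite -subr_eq0 -(N2_eq0 ipP) eq_le qf_ge0 // andbT.
  apply: (small _ (2 * C + 2 * l ^+ 2)).
    by rewrite addr_ge0 ?mulr_ge0 ?sqr_ge0.
  move=> e /near[z [_ _ _ h1 h2]].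
  have -> : A y - l%:C *: y = A (y - l%:C *: z) + l%:C *: (A z - y).
    by rewrite (linB linA) (linZ linA) scalerBr addrA subrK.
  apply: le_trans (qfD_eps sd _ _ ltr01) _.
  rewrite invr1 (qfZ sd) nsqR.
  have := bA (y - l%:C *: z).
  have : C * N2 (y - l%:C *: z) <= C * e by rewrite ler_wpM2l // ltW.
  have : l ^+ 2 * N2 (A z - y) <= l ^+ 2 * e by rewrite ler_wpM2l ?sqr_ge0 ?ltW.
  lra.
(* If [y = 0], then [l^2 |z|^2] is small, whereas [NA z <= l |z|^2] is close to [l > 0]. *)
have y0 : y != 0.
  apply/eqP => y0; suff : l ^+ 2 <= 0 by rewrite leNgt exprn_gt0.
  apply: (small _ (1 + l)); first by rewrite addr_ge0.
  move=> e /near[z [pz _ h1 _]].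
  rewrite y0 sub0r (qfN sd) (qfZ sd) nsqR => h2.
  have := le z pz; rewrite -(ler_pM2l lp) mulrA -expr2.
  have : l * (l - e) <= l * NA z by rewrite ler_pM2l // ltW.
  rewrite mulrBr -expr2; lra.
have c0 := N2_gt0 ipP y0; set c : R := Num.sqrt (N2 y).
have cE : c ^+ 2 = N2 y by rewrite sqr_sqrtr ?ltW.
exists (c^-1%:C *: y), l; split=> //.
- by rewrite (sform_diag sd) (qfZ sd) nsqR exprVn cE mulVf // gt_eqF.
- by move=> w ws; rewrite (sformZl sd) py ?mulr0.
- by rewrite (linZ linA) Ay scalerA mulrC -scalerA.
Qed.

(** The eigenvectors are chosen greedily, each maximizing the form on the complement of its
    predecessors, which is why the eigenvalues decrease. The last clause takes the place of
    completeness of the system: it controls the form on the complement of the first [n]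
    eigenvectors. *)
Lemma spectral_theorem : exists (v : nat -> H) (l : nat -> R),
  [/\ forall i j, ip (v i) (v j) = (i == j)%:R,
      forall i, A (v i) = (l i)%:C *: v i, forall i, 0 <= l i,
      forall i j, (i <= j)%N -> l j <= l i &
      forall n x, (forall i, (i < n)%N -> ip x (v i) = 0) -> NA x <= l n * N2 x].
Proof.
pose good (s : seq H) := forall z, z \in s -> exists l : R, A z = l%:C *: z.
(* A next eigenvector is known to exist only for lists of eigenvectors. Stated as an implication,
   the choice becomes a total function, which can be iterated. *)
have stepex (s : seq H) : exists ul : H * R, good s -> [/\ ip ul.1 ul.1 = 1, perp s ul.1,
    A ul.1 = ul.2%:C *: ul.1, 0 <= ul.2 &
    forall x, perp s x -> NA x <= ul.2 * N2 x].
  have [gs|ngs] := pselect (good s); last by exists (0, 0).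
  by have [u [l P]] := next_eigenvector gs; exists (u, l).
have [step stepP] := choice stepex.
pose st := fix st n := if n is m.+1 then rcons (st m) (step (st m)).1 else [::].
pose v n := (step (st n)).1; pose l n := (step (st n)).2.
have stE n : st n = mkseq v n.
  by elim: n => // n ih /=; rewrite mkseqS -ih.
have goodst n : good (st n).
  elim: n => // n ih z /=; rewrite mem_rcons inE => /predU1P[->|/ih//].
  by have [_ _ -> _ _] := stepP _ ih; exists (step (st n)).2.
have vP n := stepP _ (goodst n).
have perpst n x : (forall i, (i < n)%N -> ip x (v i) = 0) -> perp (st n) x.
  by move=> xv z; rewrite stE => /mem_mkseq[i im ->]; exact: xv.
have lt0 i j : (i < j)%N -> ip (v j) (v i) = 0.
  move=> ij; have [_ + _ _ _] := vP j; apply.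
  by rewrite stE; apply: map_f; rewrite mem_iota.
exists v, l; split.
- move=> i j; have [ij|ji|->] := ltngtP i j.
  + by rewrite (sformC sd) lt0 // rmorph0.
  + by rewrite lt0.
  + by have [-> _ _ _ _] := vP j.
- by move=> i; have [_ _ ->] := vP i.
- by move=> i; have [_ _ _ + _] := vP i.
- move=> i j ij; have [_ _ _ _ h] := vP i; have [v1 _ Av _ _] := vP j.
  have := h (v j); rewrite [N2 _]/qf [in NA _]/qf /fA [A (v j)]Av.
  rewrite (sformZl sd) [ip (v j) (v j)]v1 !mulr1 /=; apply; apply: perpst.
  by move=> k ki; apply: lt0; exact: leq_trans ki ij.
- by move=> n x /perpst px; have [_ _ _ _] := vP n; apply.
Qed.

(** The singular values are the eigenvalues [l i], and the form at [x] is the sum over [i < n] of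
    [l i |<x, v i>|^2] plus the form at the rest of [x]. The third clause drops this nonnegative
    rest; the last one, Ky Fan's maximum principle, bounds it. In both, the weights are the
    [|<g j, v i>|^2], whose partial row and column sums are at most 1 by Bessel. *)
Lemma ky_fan : exists v : nat -> H,
  [/\ forall i j, ip (v i) (v j) = (i == j)%:R,
      forall n, \sum_(k < n) singular_value ip A k = \sum_(k < n) NA (v k),
      forall n m g, orthonormal_fam ip m g ->
        (forall i, (i < n)%N -> \sum_(j < m) nsq (ip (v i) (g j)) = 1) ->
        \sum_(k < n) singular_value ip A k <= \sum_(j < m) NA (g j) &
      forall m f, orthonormal_fam ip m f ->
        \sum_(j < m) NA (f j) <= \sum_(k < m) singular_value ip A k].
Proof.
have [v [l [vo Av l0 ldec lP]]] := spectral_theorem.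
have von n : orthonormal_fam ip n v by move=> i j _ _; exact: vo.
have NAv k : NA (v k) = l k.
  by rewrite /qf /fA Av (sformZl sd) vo eqxx mulr1.
have dec n x : NA x = \sum_(i < n) l i * nsq (ip x (v i)) +
    NA (x - orth_proj ip n v x).
  set r := x - _; have rv := orth_proj_perp ipP (von n) x; rewrite -/r in rv.
  have r0 (a : nat -> R[i]) : fA r (\sum_(i < n) a i *: v i) = 0.
    rewrite /fA symA (lin_sum linA) (sform_sumr sd) big1 // => i _.
    by rewrite (linZ linA) Av !(sformZr sd) rv // !mulr0.
  have -> : NA x = NA (r + orth_proj ip n v x) by rewrite subrK.
  rewrite (qfD sdA) (r0 (fun i => ip x (v i))) mul0rn addr0 addrC; congr (_ + _).
  apply: (@complexI R); rewrite -(sform_diag sdA) rmorph_sum /fA.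
  rewrite (lin_sum linA) (sform_suml sd); apply: eq_bigr => i _.
  rewrite (linZ linA) Av scalerA (sformZl sd) /= real_complexM -mulJ_nsq.
  have -> : ip (v i) (orth_proj ip n v x) = conjc (ip x (v i)).
    by rewrite (sformC sd) (ip_comb ipP (von n) (fun i => ip x (v i))).
  by rewrite mulrAC mulrC.
have svE k : singular_value ip A k = l k.
  have linv (j : 'I_k) : linear ((fun x => ip x (v j)) : H -> R[i]^o).
    exact: (sform_linl sd).
  have small x : (forall j : 'I_k, ip x (v j) = 0) ->
      N2 (A x) <= l k ^+ 2 * N2 x.
    move=> xv; have xs : perp (mkseq v k) x.
      by move=> z /mem_mkseq[i ik ->]; exact: (xv (Ordinal ik)).
    have eig z : z \in mkseq v k -> exists l : R, A z = l%:C *: z.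
      by move=> /mem_mkseq[i _ ->]; exists (l i).
    have le y : perp (mkseq v k) y -> NA y <= l k * N2 y.
      move=> py; apply: lP => i ik; apply: py; apply: map_f.
      by rewrite mem_iota.
    apply: le_trans (N2A_le eig le xs) _.
    by rewrite expr2 -mulrA ler_wpM2l // le.
  have ub := sv_ub ipP linA (leqnn k) linv (l0 k) small.
  apply/eqP; rewrite eq_le (sv_le ipP linA (leqnn k) linv (l0 k) small) /=.
  apply: ub_le_sup; first by exists (l k).
  split=> //; exists (fun i => v i), (fun i => l i); split.
    move=> a a0 i; have := congr1 (fun z => ip z (v i)) a0.
    rewrite /= (sform0l sd) (sform_suml sd) (bigD1 i) //= (sformZl sd) vo eqxx.
    rewrite mulr1 big1 ?addr0 // => j ji; rewrite (sformZl sd) vo.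
    by rewrite (negbTE (_ : (j : nat) != i)) ?mulr0.
  move=> i; split; first by apply: ldec; rewrite -ltnS.
  split=> // y; rewrite Av (sformZl sd) -symA Av (sformZl sd) mulrA -real_complexM.
  by rewrite expr2.
exists v; split=> //.
- by move=> n; apply: eq_bigr => k _; rewrite svE NAv.
- move=> n m g go vg; apply: (@le_trans _ _
      (\sum_(j < m) \sum_(i < n) l i * nsq (ip (g j) (v i)))).
    rewrite exchange_big /=; apply: ler_sum => i _; rewrite svE -mulr_sumr.
    rewrite (eq_bigr (fun j : 'I_m => nsq (ip (v i) (g j)))) ?vg ?mulr1 //.
    by move=> j _; rewrite (sformC sd) nsqJ.
  by apply: ler_sum => j _; rewrite (dec n (g j)) lerDl qf_ge0.
- case=> [|m] f fo; first by rewrite !big_ord0.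
  pose w i := \sum_(j < m.+1) nsq (ip (f j) (v i)).
  have w1 (i : nat) : w i <= 1.
    have := bessel ipP fo (v i); rewrite [N2 _]/qf vo eqxx /=.
    by apply: le_trans; apply: ler_sum => j _; rewrite (sformC sd) nsqJ.
  (* The part of [f j] outside the first [m + 1] eigenvectors counts for at most [l m] times its
     squared norm. The total is then at most the sum of the [l i], because
     [(l i - l m) (1 - w i) >= 0]. *)
  apply: (@le_trans _ _ (\sum_(j < m.+1) (\sum_(i < m.+1) l i * nsq (ip (f j) (v i))
       + l m * (1 - \sum_(i < m.+1) nsq (ip (f j) (v i)))))).
    apply: ler_sum => j _; rewrite (dec m.+1 (f j)) lerD2l.
    have f1 : N2 (f j) = 1 by rewrite /qf fo // eqxx.
    rewrite -f1 (N2_proj ipP (von m.+1) (f j)) [X in _ * X]addrAC.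
    rewrite subrr add0r.
    by apply: lP => i im; rewrite (orth_proj_perp ipP (von m.+1)) // ltnW.
  rewrite big_split /= exchange_big /= -mulr_sumr sumrB [X in _ - X]exchange_big.
  rewrite /= (eq_bigr (fun i : 'I_m.+1 => l i * w i)); last first.
    by move=> i _; rewrite -mulr_sumr.
  rewrite mulrBr mulr_sumr [in X in _ + (_ - X)]mulr_sumr -sumrB -big_split /=.
  apply: ler_sum => i _; rewrite svE mulr1 -/(w i).
  have : l m <= l i by apply: ldec; rewrite -ltnS.
  have := w1 i; nra.
Qed.

End Spectral.
End CompactPositive.

(** * Ultrafilter limits and a criterion for compactness *)

Section UltrafilterLimits.
Context (R : realType) (F : set_system nat) (ultraF : UltraFilter F).

(** A cluster point exists in a compact segment, and a cluster point along an ultrafilter is a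
    limit. *)
Lemma ultra_cvg (u : nat -> R) (C : R) : (forall n, `|u n| <= C) ->
  exists a : R, u @ F --> a.
Proof.
move=> uC; have [a [_ cl]] : (`[(- C), C] `&` cluster (u @ F)) !=set0.
  apply: segment_compact.
  suff : F [set n | u n \in `[(- C), C]] by [].
  by apply: filterE => n /=; rewrite in_itv /= -ler_norml.
exists a; apply/cvgrPdist_lt => e e0.
have [//|Fc] := in_ultra_setVsetC [set n | `|a - u n| < e] ultraF.
have [z [/= zc ze]] := cl [set z | ~ `|a - z| < e] _ Fc (nbhsx_ballx a e e0).
by case: zc.
Qed.

Lemma ultra_cvgC (u : nat -> R[i]) (C : R) : (forall n, nsq (u n) <= C) ->
  exists z, forall e, 0 < e -> F [set n | nsq (u n - z) < e].
Proof.
move=> uC.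
have C0 : 0 <= C by apply: le_trans (uC 0%N); exact: nsq_ge0.
have bnd (v : nat -> R) : (forall n, v n ^+ 2 <= C) -> forall n, `|v n| <= Num.sqrt C.
  by move=> vC n; rewrite -sqrtr_sqr ler_sqrt.
have re n : complex.Re (u n) ^+ 2 <= C.
  by apply: le_trans (uC n); rewrite lerDl sqr_ge0.
have im n : complex.Im (u n) ^+ 2 <= C.
  by apply: le_trans (uC n); rewrite lerDr sqr_ge0.
have [a] := ultra_cvg (bnd _ re).
move=> /cvgrPdist_lt ca.
have [b] := ultra_cvg (bnd _ im).
move=> /cvgrPdist_lt cb.
exists (a +i* b) => e e0; have s0 : 0 < Num.sqrt (e / 2).
  by rewrite sqrtr_gt0 divr_gt0.
apply: filterS2 (ca _ s0) (cb _ s0) => n /= h1 h2.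
have sq x : `|x| < Num.sqrt (e / 2) -> x ^+ 2 < e / 2.
  move=> h; have <- := @sqr_sqrtr _ (e / 2); last by rewrite divr_ge0 // ltW.
  by rewrite -[ltLHS]real_normK ?num_real // ltr_pXn2r ?nnegrE // ltW.
rewrite /nsq ReD ImD ReN ImN /= [ltRHS](splitr e) -sqrrN opprB.
by rewrite -[X in _ + X]sqrrN opprB ltrD // sq.
Qed.

End UltrafilterLimits.

Section CompactCriterion.
Context (R : realType) (H : lmodType R[i]) (ip : H -> H -> R[i]).
Hypothesis ipP : inner_product ip.
Local Notation N2 := (qf ip).
Let sd : semidef ip. Proof. by case: ipP. Qed.

Hypothesis complete : forall u : nat -> H,
  (forall k, hnorm ip (u k.+1 - u k) <= 2^-1 ^+ k) ->
  exists y, (fun k => hnorm ip (u k - y)) @ \oo --> (0 : R).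

(* Limits along an ultrafilter save a diagonal extraction of subsequences. *)
Lemma compact_of_tails (T : H -> H) (C : R) : linear T -> 0 <= C ->
  (forall x, N2 (T x) <= C * N2 x) ->
  (forall e : R, 0 < e -> exists m g, orthonormal_fam ip m g /\
     forall x, (forall j, (j < m)%N -> ip x (g j) = 0) -> N2 (T x) <= e * N2 x) ->
  compact_operator ip T.
Proof.
move=> linT C0 bT tails; split=> // x x1.
have {}x1 n : N2 (x n) <= 1 by have := x1 n; rewrite ipnorm_le // expr1n.
have [F [ultraF Foo]] := ultraFilterLemma (@eventually_filter).
(* On some set of [F] the coordinates of the [x n] along the finite family [g] are nearly constant.
   This makes the projection of [x n - x n'] on their span small, and [T] is small on the
   complement. *)
have dist0 (e : R) : 0 < e -> exists2 B : set nat, F B &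
    forall n n', B n -> B n' -> N2 (T (x n) - T (x n')) <= e.
  move=> e0; have [|m [g [go gT]]] := tails (e / 16); first by rewrite divr_gt0.
  have lims j : exists z : R[i], (j < m)%N -> forall d, 0 < d ->
      F [set n | nsq (ip (x n) (g j) - z) < d].
    have [jm|_] := ltnP j m; last by exists 0.
    have [|z zP] := @ultra_cvgC R F ultraF (fun n => ip (x n) (g j)) 1.
      move=> n; apply: le_trans (cauchy_schwarz sd _ _) _.
      by rewrite [qf ip (g j)]/qf go // eqxx mulr1.
    by exists z => _ d; exact: zP.
  have [xi xiP] := choice lims.
  (* The image of the projection has squared norm at most [4 C m d <= e / 4]. The complementary part
     has squared norm at most 4, so its image has squared norm at most [4 e / 16]. Adding the two
     images doubles the sum. *)
  pose d := e / (16 * C * m%:R + 16).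
  have D0 : 0 < 16 * C * m%:R + 16 by rewrite ltr_wpDl // !mulr_ge0.
  have d0 : 0 < d by rewrite divr_gt0.
  have dE : 16 * C * (m%:R * d) <= e.
    rewrite /d mulrA mulrA [_ * _ / _]mulrAC mulrC -[leRHS]mulr1 ler_pM2l //.
    by rewrite ler_pdivrMr // mul1r lerDl.
  clearbody d; exists [set n | forall j : 'I_m, nsq (ip (x n) (g j) - xi j) < d].
    by apply: filter_forall => j; apply: xiP.
  move=> n n' /= Bn Bn'; rewrite -(linB linT); set y := x n - x n'.
  have y4 : N2 y <= 4.
    have := qfD_eps sd (x n) (- x n') ltr01; rewrite invr1 (qfN sd).
    by have := x1 n; have := x1 n'; rewrite -/y; lra.
  have := N2_proj ipP go y.
  set S := \sum_(_ < m) _; move=> yE.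
  have S_le : S <= m%:R * (4 * d).
    rewrite -[X in X%:R]card_ord mulr_natl -sumr_const; apply: ler_sum => j _.
    rewrite /y (sformDl sd) (sformNl sd); have := Bn j; have := Bn' j.
    set a := ip (x n) _; set b := ip (x n') _; rewrite /nsq.
    case: a b (xi j) => a1 a2 [b1 b2] [c1 c2] /=.
    have := sqr_ge0 (a1 + b1 - 2 * c1); have := sqr_ge0 (a2 + b2 - 2 * c2); lra.
  rewrite -(subrK (orth_proj ip m g y) y) (linD linT).
  apply: le_trans (qfD_eps sd _ _ ltr01) _; rewrite invr1.
  have := gT _ (fun j jm => orth_proj_perp ipP go y jm).
  have : N2 (orth_proj ip m g y) = S by rewrite (N2_comb ipP go (fun i => ip y (g i))).
  have := bT (orth_proj ip m g y).
  have Cm : C * S <= C * (m%:R * (4 * d)) by rewrite ler_wpM2l.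
  have S0 : 0 <= S by apply: sumr_ge0 => j _; exact: nsq_ge0.
  move=> h1 h2; rewrite h2 in h1.
  set r := N2 (y - _) in yE *; move=> h3.
  have : e / 16 * r <= e / 16 * 4.
    by rewrite ler_wpM2l ?divr_ge0 ?(ltW e0) //; lra.
  have : C * (m%:R * (4 * d)) = 4 * C * (m%:R * d) by ring.
  lra.
have dist (e : R) : 0 < e -> exists2 B : set nat, F B &
    forall n n', B n -> B n' -> hnorm ip (T (x n) - T (x n')) <= e.
  move=> e0; have [|B FB Bd] := dist0 (e ^+ 2); first by rewrite exprn_gt0.
  by exists B => // n n' Bn Bn'; rewrite ipnorm_le ?Bd // ltW.
have dist2 k : exists A : set nat, F A /\
    forall n n', A n -> A n' -> hnorm ip (T (x n) - T (x n')) <= 2^-1 ^+ k.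
  have [|A FA AP] := dist (2^-1 ^+ k); first by rewrite exprn_gt0.
  by exists A.
have [B BP] := choice dist2.
(* With [p k] in both sets, [p k] and [p k.+1] lie together in [B k.+1], so the images at the [p k]
   have geometric steps. *)
have BB k : exists n, (B k `&` B k.+1) n.
  apply: (@filter_ex _ F).
  by apply: filterI; case: (BP k) => ? _; case: (BP k.+1).
have [p pP] := choice BB.
have [|y yP] := complete (u := fun k => T (x (p k))).
  move=> k; apply: le_trans (_ : 2^-1 ^+ k.+1 <= _).
    have [_] := BP k.+1; apply; first by case: (pP k.+1).
    by case: (pP k).
  by rewrite exprS ler_piMl ?exprn_ge0 // invf_le1 // ler1n.
have near_y (e : R) : 0 < e -> F [set n | hnorm ip (T (x n) - y) < e].
  move=> e0; have e2 : 0 < e / 2 by rewrite divr_gt0.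
  have /cvgrPdist_lt/(_ _ e2)[N1 _ h1] := yP.
  have g0 : (fun k => 2^-1 ^+ k : R) @ \oo --> (0 : R).
    apply: cvg_expr; rewrite ger0_norm ?invr_ge0 // invf_lt1 // ltr1n //.
  move/cvgrPdist_lt : g0 => /(_ _ e2)[N2' _ h2].
  pose k := maxn N1 N2'; have [FB Bd] := BP k.
  apply: filterS FB => n Bn /=.
  have := h1 k (leq_maxl _ _); have := h2 k (leq_maxr _ _) => /=.
  rewrite !sub0r !normrN ger0_norm ?exprn_ge0 ?invr_ge0 //.
  rewrite ger0_norm ?ipnorm_ge0 // => hk1 hk2.
  have [Bp _] := pP k; have := Bd _ _ Bn Bp.
  have := ipnormD ipP (T (x n) - T (x (p k))) (T (x (p k)) - y).
  rewrite addrA subrK; lra.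
have sub m k : exists n, (m < n)%N /\ hnorm ip (T (x n) - y) < k.+1%:R^-1.
  have k0 : 0 < k.+1%:R^-1 :> R by rewrite invr_gt0 ltr0n.
  by have [n [mn hn]] := filter_ex (filterI (Foo _ (nbhs_infty_gt m)) (near_y _ k0));
    exists n.
have {}sub (mk : nat * nat) : exists n, (mk.1 < n)%N /\
  hnorm ip (T (x n) - y) < mk.2.+1%:R^-1 by exact: sub.
have [c cP] := choice sub.
pose phi := fix phi k := if k is k'.+1 then c (phi k', k) else c (0%N, 0%N).
exists phi.
  apply: homo_ltn => [? ? ?|i]; first exact: ltn_trans.
  by have [] := cP (phi i, i.+1).
exists y.
have le k : 0 <= hnorm ip (T (x (phi k)) - y) <= k.+1%:R^-1.
  rewrite ipnorm_ge0 ltW //.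
  by case: k => [|k] /=; [case: (cP (0%N, 0%N)) | case: (cP (phi k, k.+1))].
apply: (squeeze_cvgr (f := fun=> 0) (h := fun k => k.+1%:R^-1)).
- by near=> k; exact: le.
- exact: cvg_cst.
- exact: cvg_harmonic.
Unshelve. all: by end_near. Qed.

End CompactCriterion.

(** * Singular states and the Dixmier trace *)

Section ComplexSequences.
Context (R : realType).
Implicit Types (c x y : nat -> R[i]).

Lemma normC_nsq (z : R[i]) : `|z| = (Num.sqrt (nsq z))%:C.
Proof. exact: normc_def. Qed.

Lemma null_seqP c : null_seq R c <->
  forall e : R, 0 < e -> exists N, forall n, (N <= n)%N -> nsq (c n) <= e.
Proof.
split=> [/cvgrPdist_le c0 e e0|c0].
  have se : 0 < (Num.sqrt e)%:C by rewrite ltcR sqrtr_gt0.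
  have [N _ hN] := c0 _ se; exists N => n /hN /=.
  rewrite sub0r normrN normC_nsq lecR -(@ler_pXn2r _ 2) ?nnegrE ?sqrtr_ge0 //.
  by rewrite !sqr_sqrtr ?nsq_ge0 ?(ltW e0).
apply/cvgrPdist_le => -[e e']; rewrite ltcE /= => /andP[/eqP-> e0].
have [N hN] := c0 (e ^+ 2) (exprn_gt0 _ e0).
exists N => // n /= /hN cn; rewrite sub0r normrN normC_nsq lecR.
rewrite -(@ler_pXn2r _ 2) ?nnegrE ?sqrtr_ge0 ?(ltW e0) //.
by rewrite sqr_sqrtr ?nsq_ge0.
Qed.

Lemma null_seq_subP x (z : R[i]) : null_seq R (fun n => x n - z) <->
  (x : nat -> R[i]^o) @ \oo --> (z : R[i]^o).
Proof. exact: (@subr_cvg0 R[i] (R[i]^o) nat \oo _ x z). Qed.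

Lemma linftyP c : linfty R c <-> exists C : R, forall n, nsq (c n) <= C.
Proof.
split=> [[[M M'] cM]|[C cC]].
  exists (M ^+ 2) => n; have := cM n; rewrite normC_nsq lecE /= => /andP[_ h].
  rewrite -(@sqr_sqrtr _ (nsq (c n))) ?nsq_ge0 // ler_pXn2r ?nnegrE ?sqrtr_ge0 //.
  exact: le_trans (sqrtr_ge0 _) h.
exists (Num.sqrt C)%:C => n; rewrite normC_nsq lecR.
by rewrite ler_sqrt //; apply: le_trans (cC n); exact: nsq_ge0.
Qed.

Lemma linftyZD (a : R[i]) x y : linfty R x -> linfty R y ->
  linfty R (fun n => a * x n + y n).
Proof.
move=> /linftyP[C xC] /linftyP[D yD]; apply/linftyP.
exists (2 * (nsq a * C) + 2 * D) => n; apply: le_trans (nsqD_le _ _) _.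
by rewrite nsqM lerD // ler_wpM2l // ler_wpM2l // nsq_ge0.
Qed.

Lemma linftyD x y : linfty R x -> linfty R y -> linfty R (fun n => x n + y n).
Proof.
move=> bx /(linftyZD 1 bx); congr linfty.
by apply/funext => n; rewrite mul1r.
Qed.

Lemma linfty_cst (a : R[i]) : linfty R (fun=> a).
Proof. by exists `|a|. Qed.

Lemma linftyZ (a : R[i]) x : linfty R x -> linfty R (fun n => a * x n).
Proof.
move=> bx; have := linftyZD a bx (linfty_cst 0); congr linfty.
by apply/funext => n; rewrite addr0.
Qed.

Section State.
Variables (omega : (nat -> R[i]) -> R[i]) (omegaP : singular_state omega).

Lemma stateZD a x y : linfty R x -> linfty R y ->
  omega (fun n => a * x n + y n) = a * omega x + omega y.
Proof. by case: omegaP => + _ _ _; apply. Qed.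

Lemma stateD x y : linfty R x -> linfty R y ->
  omega (fun n => x n + y n) = omega x + omega y.
Proof.
move=> bx bt; rewrite -[in RHS](mul1r (omega x)) -stateZD //; congr omega.
by apply/funext => n; rewrite mul1r.
Qed.

Lemma state0 : omega (fun=> 0) = 0.
Proof. by case: omegaP => _ _ _; apply; exact: cvg_cst. Qed.

Lemma stateZ a x : linfty R x -> omega (fun n => a * x n) = a * omega x.
Proof.
move=> bx; rewrite -[RHS]addr0 -state0 -stateZD //; last exact: linfty_cst.
by congr omega; apply/funext => n; rewrite addr0.
Qed.

Lemma state_cst (a : R[i]) : omega (fun=> a) = a.
Proof.
have /(congr1 omega) : (fun _ : nat => a) = (fun n => a * (fun=> 1) n).
  by apply/funext => n; rewrite mulr1.
rewrite stateZ; last exact: linfty_cst.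
by case: omegaP => _ _ -> _; rewrite mulr1.
Qed.

Lemma state_eq x y : linfty R x -> linfty R y ->
  null_seq R (fun n => x n - y n) -> omega x = omega y.
Proof.
move=> bx bt xy; have : omega (fun n => x n - y n) = 0 by case: omegaP => _ _ _ ->.
rewrite (_ : (fun n => x n - y n) = fun n => -1 * y n + x n); last first.
  by apply/funext => n; rewrite mulN1r addrC.
by rewrite stateZD // mulN1r addrC => /eqP; rewrite subr_eq0 => /eqP.
Qed.

End State.
End ComplexSequences.

Section LogBounds.
Context (R : realType).

Lemma ln_nat_gt0 n : (1 < n)%N -> 0 < ln (n%:R : R).
Proof. by move=> n1; rewrite ln_gt0 // ltr1n. Qed.

Lemma harmonic_sum_le n : \sum_(0 <= k < n.+1) (1 + k)%:R^-1 <= 1 + ln (n.+1%:R : R).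
Proof.
elim: n => [|n ih]; first by rewrite big_nat1 addn0 invr1 ln1 addr0.
rewrite big_nat_recr //=; apply: le_trans (lerD ih (lexx _)) _.
rewrite -addrA lerD2l -lerBrDl add1n.
have n1 : (0 : R) < n.+1%:R by rewrite ltr0n.
have n2 : (0 : R) < n.+2%:R by rewrite ltr0n.
rewrite -[leRHS]opprK opprB -ln_div ?posrE // lerNr.
have -> : n.+1%:R / n.+2%:R = 1 + - (n.+2%:R^-1) :> R.
  by rewrite -[X in X / _](addrK 1) natr1 mulrBl divff ?mul1r ?gt_eqF.
by apply: le_ln1Dx; rewrite ltrN2 invf_lt1 // ltr1n.
Qed.

Lemma harmonic_ln : exists2 C : R, 0 <= C & forall n, (1 < n)%N ->
  \sum_(0 <= k < n.+1) (1 + k)%:R^-1 <= C * ln n%:R.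
Proof.
(* For [n >= 2] one has [1 <= ln n / ln 2], and [ln (n + 1) <= 2 ln n] because [n + 1 <= n^2]. *)
exists ((ln 2)^-1 + 2).
  by rewrite addr_ge0 // invr_ge0 ln_ge0 // ler1n.
move=> n n1; apply: le_trans (harmonic_sum_le n) _.
have l2 : 0 < ln (2 : R) by exact: (@ln_nat_gt0 2).
rewrite mulrDl lerD //.
  rewrite mulrC ler_pdivlMr // mul1r ler_ln ?posrE ?ltr0n // ?ler_nat //.
  exact: ltnW.
have n0 : (0 : R) < n%:R by rewrite ltr0n ltnW.
rewrite mulr_natl mulr2n -lnM ?posrE // ler_ln ?posrE ?ltr0n ?mulr_gt0 //.
rewrite -natrM ler_nat; nia.
Qed.

Lemma inv_ln_cvg (e : R) : 0 < e ->
  exists N, forall n, (N <= n)%N -> 0 <= (ln (n%:R : R))^-1 <= e.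
Proof.
move=> e0; exists (Num.truncn (expR e^-1)).+1 => n Nn.
have h : expR e^-1 <= n%:R.
  by apply: ltW; apply: lt_le_trans (truncnS_gt _) _; rewrite ler_nat.
have h1 : e^-1 <= ln n%:R.
  rewrite -[leLHS]expRK ler_ln ?posrE ?expR_gt0 //.
  by apply: lt_le_trans h; exact: expR_gt0.
have ie : 0 < e^-1 by rewrite invr_gt0.
have l0 : 0 < ln (n%:R : R) by apply: lt_le_trans h1.
by rewrite invr_ge0 (ltW l0) -[leRHS]invrK lef_pV2 ?posrE.
Qed.

Lemma null_bounded_ln (b : nat -> R) (C : R) : (forall n, `|b n| <= C) ->
  null_seq R (fun n => ((ln (n%:R : R))^-1 * b n)%:C).
Proof.
move=> bC; apply/null_seqP => e e0.
have C0 : 0 <= C by apply: le_trans (bC 0%N).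
pose d := Num.sqrt e / (C + 1).
have C1 : 0 < C + 1 by rewrite ltr_wpDl.
have d0 : 0 < d by rewrite divr_gt0 // sqrtr_gt0.
have [N hN] := inv_ln_cvg d0; exists N => n /hN/andP[l0 ld].
rewrite nsqR -(@sqr_sqrtr _ e) ?(ltW e0) // -[leLHS]real_normK ?num_real //.
rewrite ler_pXn2r ?nnegrE ?sqrtr_ge0 // normrM ger0_norm //.
apply: le_trans (_ : d * (C + 1) <= _); last by rewrite /d divfK ?gt_eqF.
by rewrite ler_pM // (le_trans (bC n)) // lerDl.
Qed.

End LogBounds.

Section DixmierUniqueness.
Context (R : realType) (H : lmodType R[i]) (ip : H -> H -> R[i]).
Hypothesis ipP : inner_product ip.
Hypothesis infdim : forall s : seq H,
  exists u, ip u u = 1 /\ forall z, z \in s -> ip u z = 0.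
Local Notation sv := (singular_value ip).
Let sd : semidef ip. Proof. by case: ipP. Qed.

Lemma sv_ge0 T k : 0 <= sv T k.
Proof.
rewrite /singular_value -/(sv_set ip T k).
have [hs|/sup_out->//] := pselect (has_sup (sv_set ip T k)).
have [[s Ss] ub] := hs; apply: le_trans (ub_le_sup ub Ss).
by case: Ss.
Qed.

Lemma weakL1_bound A : weakL1 ip A ->
  exists2 M : R, 0 <= M & forall k, sv A k <= M / (1 + k)%:R.
Proof.
move=> [_ [M hM]]; exists M => //; have := hM 0%N; rewrite addn0 divr1.
by apply: le_trans; exact: sv_ge0.
Qed.

Lemma linfty_log_mean A : weakL1 ip A -> linfty R (log_mean ip A).
Proof.
move=> /weakL1_bound[M M0 hM]; have [C C0 hC] := harmonic_ln R.
apply/linftyP; exists ((M * C) ^+ 2) => n; rewrite /log_mean nsqR.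
have MC : 0 <= M * C by rewrite mulr_ge0.
have [n1|n1] := leqP n 1.
  have -> : ln (n%:R : R) = 0.
    by move: n1; case: n => [|[|//]] _; rewrite ?ln1 ?ln0.
  by rewrite invr0 mul0r expr0n /= sqr_ge0.
have l0 := ln_nat_gt0 R n1.
have S0 : 0 <= \sum_(0 <= k < n.+1) sv A k by apply: sumr_ge0 => k _; exact: sv_ge0.
rewrite ler_pXn2r ?nnegrE //; last by rewrite mulr_ge0 // invr_ge0 ltW.
rewrite mulrC ler_pdivrMr // -mulrA.
apply: le_trans (_ : M * \sum_(0 <= k < n.+1) (1 + k)%:R^-1 <= _).
  by rewrite mulr_sumr; apply: ler_sum => k _.
by rewrite ler_wpM2l // hC.
Qed.

(* The first [n] eigenvectors of [A] and of [B] span a space of dimension at most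
   [2 n], and the singular values number [n] to [2 n - 1] of [A'] and [B'] have a
   bounded sum. *)
Lemma trace_comparison A B A' B' : pos_weakL1 ip A -> pos_weakL1 ip B ->
  pos_weakL1 ip A' -> pos_weakL1 ip B' ->
  (forall x, qf (fun x y => ip (A x) y) x + qf (fun x y => ip (B x) y) x =
             qf (fun x y => ip (A' x) y) x + qf (fun x y => ip (B' x) y) x) ->
  exists M : R, forall n, \sum_(k < n) sv A k + \sum_(k < n) sv B k <=
    \sum_(k < n) sv A' k + \sum_(k < n) sv B' k + M.
Proof.
move=> [[cA _] pA] [[cB _] pB] [wA' pA'] [wB' pB'] ABE.
have [cA' _] := wA'; have [cB' _] := wB'.
have [M M0 hM] := weakL1_bound wA'; have [M' M'0 hM'] := weakL1_bound wB'.
exists (M + M') => n.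
have [v [vo _ vA _]] := ky_fan ipP infdim cA pA.
have [w [wo _ wB _]] := ky_fan ipP infdim cB pB.
have [_ [_ _ _ uA']] := ky_fan ipP infdim cA' pA'.
have [_ [_ _ _ uB']] := ky_fan ipP infdim cB' pB'.
have [m [g [msize go gs]]] := gram_schmidt ipP (mkseq v n ++ mkseq w n).
rewrite size_cat !size_mkseq addnn in msize.
have gv i : (i < n)%N -> \sum_(j < m) nsq (ip (v i) (g j)) = 1.
  move=> ni; rewrite -gs ?/qf ?vo ?eqxx // mem_cat map_f // mem_iota.
  by rewrite add0n ni.
have gw i : (i < n)%N -> \sum_(j < m) nsq (ip (w i) (g j)) = 1.
  move=> ni; rewrite -gs ?/qf ?wo ?eqxx // mem_cat orbC map_f // mem_iota.
  by rewrite add0n ni.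
apply: le_trans (lerD (vA _ _ _ go gv) (wB _ _ _ go gw)) _.
rewrite -big_split /= (eq_bigr _ (fun (j : 'I_m) _ => ABE (g j))) big_split /=.
have tail D K : 0 <= K -> (forall k, sv D k <= K / (1 + k)%:R) ->
    \sum_(k < m) sv D k <= \sum_(k < n) sv D k + K.
  move=> K0 hK; apply: (@le_trans _ _ (\sum_(0 <= k < n.*2) sv D k)).
    rewrite big_mkord (big_ord_widen _ (fun k => sv D k) msize) big_mkcond /=.
    by apply: ler_sum => k _; case: ifP => // _; exact: sv_ge0.
  rewrite (@big_cat_nat _ _ _ n) //= ?big_mkord; last by rewrite -addnn leq_addr.
  rewrite lerD2l; apply: (@le_trans _ _ (\sum_(n <= k < n.*2) K / (1 + n)%:R)).
    rewrite big_nat_cond [leRHS]big_nat_cond; apply: ler_sum => k.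
    rewrite andbT => /andP[nk _]; apply: le_trans (hK k) _.
    by rewrite ler_wpM2l // lef_pV2 ?posrE ?ltr0n // ler_nat leq_add2l.
  rewrite sumr_const_nat -addnn addnK -[leLHS]mulr_natr -mulrA ler_piMr //.
  by rewrite mulrC ler_pdivrMr ?ltr0n // mul1r ler_nat leq_addl.
apply: le_trans (lerD (uA' _ _ go) (uB' _ _ go)) _.
have := tail _ _ M0 hM; have := tail _ _ M'0 hM'; lra.
Qed.

(** Additivity of the trace on the positive cone. Only the forms are compared, so no sum of
    operators has to be placed in the ideal. The two sums of singular values differ by a bounded
    amount, which vanishes after division by the logarithm. *)
Lemma state_log_meanD omega A B A' B' : singular_state omega ->
  pos_weakL1 ip A -> pos_weakL1 ip B -> pos_weakL1 ip A' -> pos_weakL1 ip B' ->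
  (forall x, qf (fun x y => ip (A x) y) x + qf (fun x y => ip (B x) y) x =
             qf (fun x y => ip (A' x) y) x + qf (fun x y => ip (B' x) y) x) ->
  omega (log_mean ip A) + omega (log_mean ip B) =
  omega (log_mean ip A') + omega (log_mean ip B').
Proof.
move=> oP pA pB pA' pB' ABE.
have b D : pos_weakL1 ip D -> linfty R (log_mean ip D).
  by case=> + _; exact: linfty_log_mean.
have [bA bB] := (b _ pA, b _ pB); have [bA' bB'] := (b _ pA', b _ pB').
rewrite -(stateD oP bA bB) -(stateD oP bA' bB').
apply: (state_eq oP); [exact: linftyD|exact: linftyD|].
have [M hM] := trace_comparison pA pB pA' pB' ABE.
have [M' hM'] := trace_comparison pA' pB' pA pB (fun x => esym (ABE x)).
have := @null_bounded_ln R (fun n => \sum_(k < n.+1) sv A k + \sum_(k < n.+1) sv B k -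
  (\sum_(k < n.+1) sv A' k + \sum_(k < n.+1) sv B' k)) (`|M| + `|M'|) _.
rewrite (_ : (fun n => (_ * _)%:C) = (fun n => log_mean ip A n + log_mean ip B n -
    (log_mean ip A' n + log_mean ip B' n))); last first.
  apply/funext => n; rewrite /log_mean !big_mkord.
  by rewrite -!real_complexD -real_complexB; congr (_%:C); ring.
apply=> n; have := hM n.+1; have := hM' n.+1.
have := ler_norm M; have := ler_norm M'.
have := normr_ge0 M; have := normr_ge0 M'.
move=> *; rewrite ler_norml; apply/andP; split; lra.
Qed.

(** Forms of positive operators are real, so the real and imaginary parts of [<G x, x>] yield
    [A1 + B2 = B1 + A2] and [A3 + B4 = B3 + A4] as forms. *)
Lemma dixmier_value_unique omega G z z' : singular_state omega ->
  is_dixmier_value ip omega G z -> is_dixmier_value ip omega G z' -> z = z'.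
Proof.
move=> oP [A1 [A2 [A3 [A4 [[p1 p2 p3 p4] GE ->]]]]].
move=> [B1 [B2 [B3 [B4 [[q1 q2 q3 q4] GE' ->]]]]].
have real D x : pos_weakL1 ip D ->
    ip (D x) x = (qf (fun x y => ip (D x) y) x)%:C.
  by move=> [[[linD _] _] pD]; exact: (sform_diag (positive_semidef ipP linD pD)).
have eqs x : qf (fun x y => ip (A1 x) y) x + qf (fun x y => ip (B2 x) y) x =
    qf (fun x y => ip (B1 x) y) x + qf (fun x y => ip (A2 x) y) x /\
    qf (fun x y => ip (A3 x) y) x + qf (fun x y => ip (B4 x) y) x =
    qf (fun x y => ip (B3 x) y) x + qf (fun x y => ip (A4 x) y) x.
  have := congr1 (fun y => ip y x) (etrans (esym (GE x)) (GE' x)).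
  rewrite !(sformDl sd) !(sformZl sd) !(sformDl sd) !(sformNl sd) !real //.
  move=> /eqP; rewrite eq_complex /= => /andP[/eqP h1 /eqP h2].
  by split; lra.
have := state_log_meanD oP p1 q2 q1 p2 (fun x => (eqs x).1).
have := state_log_meanD oP p3 q4 q3 p4 (fun x => (eqs x).2).
move=> h34 h12; congr (_ + _ * _); apply/eqP.
- by rewrite subr_eq addrAC eq_sym subr_eq eq_sym; apply/eqP.
- by rewrite subr_eq addrAC eq_sym subr_eq eq_sym; apply/eqP.
Qed.

Lemma dixmier_traceE omega G z : singular_state omega ->
  is_dixmier_value ip omega G z -> dixmier_trace ip omega G = z.
Proof.
move=> oP zP; rewrite /dixmier_trace.
by case: xgetP => [w _ /= wP|/(_ z)//]; exact: dixmier_value_unique oP wP zP.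
Qed.

End DixmierUniqueness.

(** * The Hilbert space of the circle *)

Section ComplexIntegral.
Context (R : realType).
Local Notation T := (measurableTypeR R).
Local Notation mu := (circle_measure R).
Implicit Types (f g : T -> R) (h k : T -> R[i]).

Local Notation intg f := (mu.-integrable [set: T] (EFin \o (f : T -> R))).

Lemma circle_measure_fin : mu [set: T] \is a fin_num.
Proof.
rewrite /circle_measure /= /mrestr setTI lebesgue_measure_itv /= lte_fin.
by case: ifP.
Qed.

Lemma L2_measurable f : f \in Lfun mu 2%:E -> measurable_fun [set: T] f.
Proof. by rewrite inE => /andP[]; rewrite inE. Qed.

Lemma L2_mul_integrable f g : f \in Lfun mu 2%:E -> g \in Lfun mu 2%:E ->
  intg (fun t => f t * g t).
Proof. by move=> f2 g2; apply/Lfun1_integrable; exact: Lfun2_mul_Lfun1. Qed.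

Lemma L2_integrable f : f \in Lfun mu 2%:E -> intg f.
Proof.
by move=> f2; apply/Lfun1_integrable/Lfun_subset12 => //; exact: circle_measure_fin.
Qed.

Lemma L2_of_sqr f : measurable_fun [set: T] f ->
  (\int[mu]_t (f t ^+ 2)%:E < +oo)%E -> f \in Lfun mu 2%:E.
Proof.
move=> mf if2; rewrite inE; apply/andP; split; first by rewrite inE.
rewrite inE /= /finite_norm unlock /Lnorm /=.
apply: poweR_lty; apply: le_lt_trans if2.
apply: ge0_le_integral => //.
- apply/measurable_EFinP; apply/(@measurableT_comp _ _ _ _ _ _ (fun x : R => x `^ 2)) => //.
  exact: measurableT_comp.
- by apply/measurable_EFinP; exact: measurable_funX.
- by move=> t _; rewrite lee_fin powR_mulrn // real_normK ?num_real.
Qed.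

Definition cintegrable h : Prop :=
  intg (fun t => complex.Re (h t)) /\ intg (fun t => complex.Im (h t)).

Definition cint h : R[i] :=
  (\int[mu]_t complex.Re (h t)) +i* (\int[mu]_t complex.Im (h t)).

Lemma integrableT_sub f g : intg f -> intg g -> intg (fun t => f t - g t).
Proof. by move=> fi gi; exact: (integrableB measurableT fi gi). Qed.

Lemma integrableT_add f g : intg f -> intg g -> intg (fun t => f t + g t).
Proof. by move=> fi gi; exact: (integrableD measurableT fi gi). Qed.

Lemma integrableT_scale (a : R) f : intg f -> intg (fun t => a * f t).
Proof. by move=> fi; exact: (integrableZl measurableT a fi). Qed.

Lemma cintZD (a : R[i]) h k : cintegrable h -> cintegrable k ->
  cint (fun t => a * h t + k t) = a * cint h + cint k.
Proof.
move=> [h1 h2] [k1 k2]; apply/eqP; rewrite eq_complex ReD ImD; apply/andP; split.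
- rewrite /= (@eq_Rintegral _ _ _ mu _ (fun t => complex.Re a * complex.Re (h t)
    - complex.Im a * complex.Im (h t) + complex.Re (k t))); last first.
    by move=> t _; rewrite ReD; case: a (h t) => ? ? [].
  rewrite RintegralD //; last by apply: integrableT_sub; exact: integrableT_scale.
  rewrite RintegralB //; do ?exact: integrableT_scale.
  by rewrite !RintegralZl //; case: a => ? ?.
- rewrite /= (@eq_Rintegral _ _ _ mu _ (fun t => complex.Re a * complex.Im (h t)
    + complex.Im a * complex.Re (h t) + complex.Im (k t))); last first.
    by move=> t _; rewrite ImD; case: a (h t) => ? ? [].
  rewrite RintegralD //; last by apply: integrableT_add; exact: integrableT_scale.
  rewrite RintegralD //; do ?exact: integrableT_scale.
  by rewrite !RintegralZl //; case: a => ? ?.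
Qed.

Lemma Rintegral_opp f : intg f -> \int[mu]_t (- f t) = - \int[mu]_t f t.
Proof.
move=> fi; rewrite -mulN1r -RintegralZl //.
by apply: eq_Rintegral => t _; rewrite mulN1r.
Qed.

Lemma cintJ h : cintegrable h -> cint (fun t => conjc (h t)) = conjc (cint h).
Proof.
move=> [h1 h2]; apply/eqP; rewrite eq_complex /=; apply/andP; split; apply/eqP.
  by apply: eq_Rintegral => t _; case: (h t).
by rewrite -Rintegral_opp //; apply: eq_Rintegral => t _; case: (h t).
Qed.

Lemma Rintegral_ae f g : measurable_fun [set: T] f -> measurable_fun [set: T] g ->
  {ae mu, forall t, f t = g t} -> \int[mu]_t f t = \int[mu]_t g t.
Proof.
move=> mf mg fg; congr fine; apply: ae_eq_integral => //.
- exact/measurable_EFinP.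
- exact/measurable_EFinP.
- by apply: filterS fg => t ->.
Qed.

Lemma cint_ae h k : cintegrable h -> cintegrable k ->
  {ae mu, forall t, h t = k t} -> cint h = cint k.
Proof.
move=> [h1 h2] [k1 k2] hk.
have m f : intg f -> measurable_fun [set: T] f.
  by move=> /(measurable_int mu)/measurable_EFinP.
by congr Complex; (apply: Rintegral_ae;
  [exact: m | exact: m | apply: filterS hk => t ->]).
Qed.

Lemma L2fun_prod h k : h \in @L2fun R -> k \in @L2fun R ->
  cintegrable (fun t => h t * conjc (k t)).
Proof.
move=> /andP[h1 h2] /andP[k1 k2]; split.
- rewrite (_ : (fun t => complex.Re _) = fun t => complex.Re (h t) * complex.Re (k t)
    + complex.Im (h t) * complex.Im (k t)).
    by apply: integrableT_add; exact: L2_mul_integrable.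
  by apply/funext => t; case: (h t) (k t) => ? ? [? ?] /=; ring.
- rewrite (_ : (fun t => complex.Im _) = fun t => complex.Im (h t) * complex.Re (k t)
    - complex.Re (h t) * complex.Im (k t)).
    by apply: integrableT_sub; exact: L2_mul_integrable.
  by apply/funext => t; case: (h t) (k t) => ? ? [? ?] /=; ring.
Qed.

Lemma L2fun_nsq_integrable h : h \in @L2fun R -> intg (fun t => nsq (h t)).
Proof.
move=> /andP[h1 h2]; apply: integrableT_add.
  exact: (Lfun2_integrable_sqr h1).
exact: (Lfun2_integrable_sqr h2).
Qed.

Lemma L2fun_of_nsq h : measurable_fun [set: T] (fun t => complex.Re (h t)) ->
  measurable_fun [set: T] (fun t => complex.Im (h t)) ->
  (\int[mu]_t (nsq (h t))%:E < +oo)%E -> h \in @L2fun R.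
Proof.
move=> m1 m2 ih.
have mn : measurable_fun [set: T] (fun t => nsq (h t)).
  by apply: measurable_funD; exact: measurable_funX.
apply/andP; split; apply: L2_of_sqr => //; apply: le_lt_trans ih.
- apply: ge0_le_integral => //.
  + by move=> t _; rewrite lee_fin sqr_ge0.
  + by apply/measurable_EFinP; exact: measurable_funX.
  + exact/measurable_EFinP.
  + by move=> t _; rewrite lee_fin lerDl sqr_ge0.
- apply: ge0_le_integral => //.
  + by move=> t _; rewrite lee_fin sqr_ge0.
  + by apply/measurable_EFinP; exact: measurable_funX.
  + exact/measurable_EFinP.
  + by move=> t _; rewrite lee_fin lerDr sqr_ge0.
Qed.

End ComplexIntegral.

Section L2InnerProduct.
Context (R : realType).
Local Notation T := (measurableTypeR R).
Local Notation mu := (circle_measure R).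
Local Open Scope quotient_scope.
Implicit Types (u v w : L2S1 R).

Definition rep u : T -> R[i] := (repr u : L2rep R).

Lemma rep_L2 u : rep u \in @L2fun R.
Proof. exact: L2repP. Qed.

Lemma rep_pi (f : L2rep R) : {ae mu, forall t, rep (\pi_(L2S1 R) f) t = f t}.
Proof. exact: L2_reprK. Qed.

Lemma rep_ext u v : {ae mu, forall t, rep u t = rep v t} -> u = v.
Proof. by move=> /L2eqP; rewrite !reprK. Qed.

Lemma rep_class (f : T -> R[i]) : f \in @L2fun R ->
  {ae mu, forall t, rep (L2class f) t = f t}.
Proof.
move=> f2; have := rep_pi (insubd (0 : L2rep R) f).
have e : L2rep_fun (insubd (0 : L2rep R) f) = f by exact: (insubdK _ f2).
by apply: filterS => t; rewrite /L2class e.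
Qed.

Lemma repZD (a : R[i]) u v :
  {ae mu, forall t, rep (a *: u + v) t = a * rep u t + rep v t}.
Proof.
have h1 : {ae mu, forall t, rep (a *: u + v) t = rep (a *: u) t + rep v t}.
  exact: rep_pi (repr (a *: u) + repr v).
have h2 : {ae mu, forall t, rep (a *: u) t = a * rep u t}.
  exact: rep_pi (L2Rep (L2scale_subproof a (repr u))).
by apply: filterS2 h1 h2 => t -> ->.
Qed.

Lemma rep0 : {ae mu, forall t, rep (0 : L2S1 R) t = 0}.
Proof. exact: (rep_pi 0). Qed.

Lemma L2innerE u v : L2inner u v = cint (fun t => rep u t * conjc (rep v t)).
Proof. by []. Qed.

Lemma L2inner_ae u v (f g : T -> R[i]) : f \in @L2fun R -> g \in @L2fun R ->
  {ae mu, forall t, rep u t = f t} -> {ae mu, forall t, rep v t = g t} ->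
  L2inner u v = cint (fun t => f t * conjc (g t)).
Proof.
move=> f2 g2 uf vg; rewrite L2innerE; apply: cint_ae.
- exact: L2fun_prod (rep_L2 u) (rep_L2 v).
- exact: L2fun_prod.
- by apply: filterS2 uf vg => t -> ->.
Qed.

Lemma L2_N2E u : (qf (@L2inner R) u)%:E = (\int[mu]_t (nsq (rep u t))%:E)%E.
Proof.
rewrite /qf L2innerE /=.
rewrite (@eq_Rintegral _ _ _ mu _ (fun t => nsq (rep u t))); last first.
  by move=> t _; rewrite mulJ_nsq.
rewrite fineK //; apply: integrable_fin_num => //.
exact/L2fun_nsq_integrable/rep_L2.
Qed.

Lemma L2_inner_product : inner_product (@L2inner R).
Proof.
split; first split.
- move=> w a u v; rewrite !(L2innerE u, L2innerE v) -cintZD; last 2 first.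
  + exact: L2fun_prod (rep_L2 _) (rep_L2 _).
  + exact: L2fun_prod (rep_L2 _) (rep_L2 _).
  rewrite (L2inner_ae (L2fun_linear a (rep_L2 u) (rep_L2 v)) (rep_L2 w) (repZD a u v)).
    by congr cint; apply/funext => t; rewrite mulrDl mulrA.
  exact: aeW.
- move=> u v; rewrite !L2innerE -cintJ; last first.
    exact: L2fun_prod (rep_L2 _) (rep_L2 _).
  by congr cint; apply/funext => t; rewrite conjcM conjcK mulrC.
- move=> u; rewrite L2innerE lecE /=; apply/andP; split.
    rewrite (@eq_Rintegral _ _ _ mu _ (fun=> 0)) ?Rintegral0 //.
      by rewrite /Rintegral integral0.
    by move=> t _; rewrite mulJ_nsq.
  by apply: Rintegral_ge0 => t _; rewrite mulJ_nsq nsq_ge0.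
- move=> u u0; have := L2_N2E u; rewrite /qf u0 => /esym N0.
  have i2 := L2fun_nsq_integrable (rep_L2 u).
  apply: rep_ext.
  have /(ae_eq_integral_abs _ measurableT) : (\int[mu]_t `|(nsq (rep u t))%:E| = 0)%E.
    by rewrite -[RHS]N0; apply: eq_integral => t _; rewrite gee0_abs // lee_fin nsq_ge0.
  move=> /(_ (measurable_int mu i2)) h.
  apply: filterS2 h rep0 => t /= h ->; apply/eqP; rewrite -nsq_eq0.
  by apply/eqP; have [] := h I.
Qed.

End L2InnerProduct.

Section CircleIntegral.
Context (R : realType).
Local Notation T := (measurableTypeR R).
Local Notation mu := (circle_measure R).
Local Notation leb := (@lebesgue_measure R).
Local Notation D2pi := `[(0 : R), pi *+ 2[%classic.
Implicit Types (f g : T -> R).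

Lemma ae_circle (P : T -> Prop) :
  {ae leb, forall t, D2pi t -> P t} -> {ae mu, forall t, P t}.
Proof.
move=> [A [mA A0 PA]]; exists (A `|` ~` D2pi); split.
- by apply: measurableU => //; apply: measurableC; exact: measurable_itv.
- rewrite /circle_measure /= /mrestr setIUl setICl setU0.
  apply/eqP; rewrite eq_le measure_ge0 andbT -A0.
  apply: le_measure; rewrite ?inE //.
  by apply: measurableI => //; exact: measurable_itv.
- move=> t /= nP; have [Dt|] := pselect (D2pi t); last by right.
  by left; apply: PA => /=; apply: contra_not nP; apply.
Qed.

Lemma circle_integralE f : measurable_fun [set: T] f ->
  (\int[mu]_t (f t)%:E = \int[leb]_(t in D2pi) (f t)%:E)%E.
Proof.
move=> mf; have mD : measurable (D2pi : set T) by exact: measurable_itv.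
rewrite -(@eq_measure_integral _ T R D2pi leb mu); last first.
  by move=> A mA AD; rewrite /circle_measure /= /mrestr setIidl.
rewrite [RHS]integral_mkcond; apply: ae_eq_integral => //.
- exact/measurable_EFinP.
- by apply/(measurable_restrictT _ mD); apply: measurable_funTS; exact/measurable_EFinP.
- have : {ae mu, forall t : T, (D2pi : set T) t} by apply: ae_circle; apply: aeW.
  apply: (@filterS _ (almost_everywhere mu) (ae_filter_ringOfSetsType mu)) => t Dt _.
  by rewrite patchE mem_set.
Qed.

Lemma circle_RintegralE f : measurable_fun [set: T] f ->
  \int[mu]_t f t = \int[leb]_(t in D2pi) f t.
Proof. by move=> mf; rewrite /Rintegral circle_integralE. Qed.

Lemma circle_integral_FTC (f F : R -> R) : continuous f ->
  (forall x : R, is_derive x (1 : R) F (f x)) -> \int[mu]_t f t = F (pi *+ 2) - F 0.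
Proof.
move=> cf dF; rewrite circle_RintegralE; last exact: continuous_measurable_fun.
have pi0 : 0 < pi *+ 2 :> R by rewrite pmulrn_lgt0 // pi_gt0.
have cF x : {for x, continuous F}.
  by apply: differentiable_continuous; apply/derivable1_diffP; case: (dF x).
have cfi : {within `[0, pi *+ 2], continuous f}.
  by apply: continuous_subspaceT => x; exact: cf.
rewrite Rintegral_itv_bndo_bndc; last first.
  apply: (@integrableS _ _ _ leb `[0, pi *+ 2]%classic) => //.
    exact: subset_itv_co_cc.
  by apply: continuous_compact_integrable => //; exact: segment_compact.
rewrite /Rintegral (@continuous_FTC2 _ _ F _ _ pi0 cfi) //.
- split=> [x _||]; first by case: (dF x).
  + by apply: cvg_at_right_filter; exact: cF.
  + by apply: cvg_at_left_filter; exact: cF.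
- by move=> x _; rewrite derive1E; case: (dF x).
Qed.

Lemma is_derive_intl (l : int) (x : R) :
  is_derive x (1 : R) (fun t : R => l%:~R * t) l%:~R.
Proof. by apply: is_derive_eq; rewrite -[_ *: _]/(_ * _) mulr1 ?addr0. Qed.

Lemma continuous_intl (l : int) : continuous (fun t : R => l%:~R * t).
Proof. by move=> t; apply: cvgM; [exact: cvg_cst|exact: cvg_id]. Qed.

Lemma continuous_cos_int (l : int) : continuous (fun t : R => cos (l%:~R * t)).
Proof.
by move=> t; apply: continuous_comp; [exact: continuous_intl|exact: continuous_cos].
Qed.

Lemma continuous_sin_int (l : int) : continuous (fun t : R => sin (l%:~R * t)).
Proof.
by move=> t; apply: continuous_comp; [exact: continuous_intl|exact: continuous_sin].
Qed.

Lemma cos_sin_int2pi (l : int) :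
  cos (l%:~R * (pi *+ 2)) = 1 :> R /\ sin (l%:~R * (pi *+ 2)) = 0 :> R.
Proof.
have nat (n : nat) :
    cos (n%:R * (pi *+ 2)) = 1 :> R /\ sin (n%:R * (pi *+ 2)) = 0 :> R.
  elim: n => [|n [ihc ihs]]; first by rewrite mul0r sin0 cos0.
  by rewrite -natr1 mulrDl mul1r sinD2pi cosD2pi.
case: l => n; first exact: nat.
by rewrite NegzE mulrNz mulNr sinN cosN; have [-> ->] := nat n.+1; rewrite oppr0.
Qed.

Lemma integral_cos_int (l : int) :
  \int[mu]_t cos (l%:~R * t) = if l == 0 then pi *+ 2 else 0.
Proof.
have [l0|l0] := eqVneq l 0.
  have dF (x : R) : is_derive x (1 : R) (@id R) (cos (l%:~R * x)).
    by apply: is_derive_eq; rewrite l0 mul0r cos0.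
  by rewrite (circle_integral_FTC (@continuous_cos_int l) dF) subr0.
have lR : l%:~R != 0 :> R by rewrite intr_eq0.
have dF (x : R) : is_derive x (1 : R)
    (l%:~R^-1 \*: (sin \o (fun t : R => l%:~R * t))) (cos (l%:~R * x)).
  have := is_deriveZ (l%:~R^-1)
    (is_derive1_comp (is_derive_sin (l%:~R * x)) (is_derive_intl l x)).
  by move=> h; apply: is_derive_eq; rewrite -[_ *: _]/(_ * _) mulrC mulfK.
rewrite (circle_integral_FTC (@continuous_cos_int l) dF) /=.
by have [_ ->] := cos_sin_int2pi l; rewrite mulr0 sin0 !scaler0 subr0.
Qed.

Lemma integral_sin_int (l : int) : \int[mu]_t sin (l%:~R * t) = 0.
Proof.
have [l0|l0] := eqVneq l 0.
  have dF (x : R) : is_derive x (1 : R) (fun=> 0 : R) (sin (l%:~R * x)).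
    by apply: is_derive_eq; rewrite l0 mul0r sin0.
  by rewrite (circle_integral_FTC (@continuous_sin_int l) dF) subr0.
have lR : l%:~R != 0 :> R by rewrite intr_eq0.
have dF (x : R) : is_derive x (1 : R)
    ((- l%:~R^-1) \*: (cos \o (fun t : R => l%:~R * t))) (sin (l%:~R * x)).
  have := is_deriveZ (- l%:~R^-1)
    (is_derive1_comp (is_derive_cos (l%:~R * x)) (is_derive_intl l x)).
  move=> h; apply: is_derive_eq; rewrite -[_ *: _]/(_ * _) mulNr mulNr mulrN opprK.
  by rewrite mulrC mulfK.
rewrite (circle_integral_FTC (@continuous_sin_int l) dF) /=.
by have [-> _] := cos_sin_int2pi l; rewrite mulr0 cos0 subrr.
Qed.

End CircleIntegral.

Section Multipliers.
Context (R : realType).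
Local Notation T := (measurableTypeR R).
Local Notation mu := (circle_measure R).
Local Notation ip := (@L2inner R).
Local Notation N2 := (qf ip).
Implicit Types (w : R -> R[i]) (u v : L2S1 R) (B : R).

Definition bounded_multiplier w B : Prop :=
  [/\ measurable_fun [set: T] (fun t => complex.Re (w t)),
      measurable_fun [set: T] (fun t => complex.Im (w t)) &
      forall t, nsq (w t) <= B].

Lemma bounded_multiplier_prod w B (f : T -> R[i]) : bounded_multiplier w B ->
  f \in @L2fun R -> (fun t => w t * f t) \in @L2fun R.
Proof.
move=> [m1 m2 wB] f2; have B0 : 0 <= B by apply: le_trans (wB 0); exact: nsq_ge0.
have /andP[/L2_measurable /= f1 /L2_measurable /= f3] := f2.
apply: L2fun_of_nsq.
- rewrite (_ : (fun t => complex.Re _) = fun t => complex.Re (w t) * complex.Re (f t)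
    - complex.Im (w t) * complex.Im (f t)).
    by apply: measurable_funB; exact: measurable_funM.
  by apply/funext => t; case: (w t) (f t) => ? ? [].
- rewrite (_ : (fun t => complex.Im _) = fun t => complex.Re (w t) * complex.Im (f t)
    + complex.Im (w t) * complex.Re (f t)).
    by apply: measurable_funD; exact: measurable_funM.
  by apply/funext => t; case: (w t) (f t) => ? ? [].
- have i2 := L2fun_nsq_integrable f2.
  have mn (g : T -> R[i]) : measurable_fun [set: T] (fun t => complex.Re (g t)) ->
      measurable_fun [set: T] (fun t => complex.Im (g t)) ->
      measurable_fun [set: T] (fun t => nsq (g t)).
    by move=> h1 h2; apply: measurable_funD; exact: measurable_funX.
  apply: (@le_lt_trans _ _ (\int[mu]_t (B%:E * (nsq (f t))%:E))%E).
    apply: ge0_le_integral => //.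
    + by move=> t _; rewrite lee_fin nsq_ge0.
    + apply/measurable_EFinP; under eq_fun do rewrite nsqM.
      by apply: measurable_funM; exact: mn.
    + by apply/measurable_EFinP; apply: measurable_funM => //; exact: mn.
    + by move=> t _; rewrite nsqM lee_fin ler_wpM2r // nsq_ge0.
  have /integrableP[_] := integrableZl measurableT B i2.
  apply: le_lt_trans; rewrite le_eqVlt; apply/orP; left; apply/eqP.
  by apply: eq_integral => t _; rewrite gee0_abs // -EFinM lee_fin mulr_ge0 // nsq_ge0.
Qed.

Lemma L2fun_cst1 : (fun=> 1) \in @L2fun R.
Proof.
apply: L2fun_of_nsq => //=.
rewrite integral_cst //= nsq1 mul1e.
by have := circle_measure_fin R; rewrite fin_numE ltey => /andP[].
Qed.

Lemma bounded_multiplier_L2 w B : bounded_multiplier w B -> w \in @L2fun R.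
Proof.
move=> bw; have := bounded_multiplier_prod bw L2fun_cst1.
rewrite (_ : (fun t : T => w t * 1) = w) //.
by apply/funext => t; rewrite mulr1.
Qed.

Lemma rep_mul w B u : bounded_multiplier w B ->
  {ae mu, forall t, rep (L2mul w u) t = w t * rep u t}.
Proof. by move=> bw; apply: rep_class; exact: bounded_multiplier_prod bw (rep_L2 u). Qed.

Lemma L2mul_linear w B : bounded_multiplier w B -> linear (L2mul w).
Proof.
move=> bw a u v; apply: rep_ext.
have h1 := rep_mul (a *: u + v) bw; have h2 := repZD a u v.
have h3 := repZD a (L2mul w u) (L2mul w v).
have h4 := rep_mul u bw; have h5 := rep_mul v bw.
apply: filterS2 (filterI h1 h2) (filterI (filterI h3 h4) h5).
- by move=> t /= [-> ->] [[-> ->] ->]; ring.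
Qed.

Lemma N2_mul w B u : bounded_multiplier w B -> N2 (L2mul w u) <= B * N2 u.
Proof.
move=> bw; have [m1 m2 wB] := bw.
have B0 : 0 <= B by apply: le_trans (wB 0); exact: nsq_ge0.
have i2 := L2fun_nsq_integrable (rep_L2 u).
rewrite -lee_fin EFinM !L2_N2E -ge0_integralZl //; last 2 first.
- exact: measurable_int i2.
- by move=> t _; rewrite lee_fin nsq_ge0.
apply: ae_ge0_le_integral => //.
- by move=> t _; rewrite lee_fin nsq_ge0.
- exact: (measurable_int mu (L2fun_nsq_integrable (rep_L2 _))).
- by move=> t _; rewrite -EFinM lee_fin mulr_ge0 // nsq_ge0.
- by apply: measurable_funeM; exact: measurable_int i2.
- by apply: filterS (rep_mul u bw) => t -> _; rewrite nsqM lee_fin ler_wpM2r // nsq_ge0.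
Qed.

Lemma bounded_multiplierJ w B : bounded_multiplier w B ->
  bounded_multiplier (fun t => conjc (w t)) B.
Proof.
move=> [m1 m2 wB]; split.
- by apply: eq_measurable_fun m1 => t _; case: (w t).
- rewrite (_ : (fun t => _) = fun t => - complex.Im (w t)); last first.
    by apply/funext => t; case: (w t).
  exact: measurable_funN.
- by move=> t; rewrite nsqJ.
Qed.

Lemma L2mul_adj w B u v : bounded_multiplier w B ->
  ip (L2mul w u) v = ip u (L2mul (fun t => conjc (w t)) v).
Proof.
move=> bw; have bw' := bounded_multiplierJ bw.
rewrite (L2inner_ae (bounded_multiplier_prod bw (rep_L2 u)) (rep_L2 v)
  (rep_mul u bw)); last exact: aeW.
rewrite (L2inner_ae (rep_L2 u) (bounded_multiplier_prod bw' (rep_L2 v)) _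
  (rep_mul v bw')); last exact: aeW.
congr cint; apply/funext => t; rewrite conjcM conjcK.
by ring.
Qed.

Lemma L2mulZD (a : R[i]) w B w' B' u : bounded_multiplier w B ->
  bounded_multiplier w' B' ->
  bounded_multiplier (fun t => a * w t + w' t) (2 * (nsq a * B) + 2 * B') /\
  L2mul (fun t => a * w t + w' t) u = a *: L2mul w u + L2mul w' u.
Proof.
move=> bw bw'; have [m1 m2 wB] := bw; have [m1' m2' wB'] := bw'.
have bS : bounded_multiplier (fun t => a * w t + w' t) (2 * (nsq a * B) + 2 * B').
  split.
  - rewrite (_ : (fun t => complex.Re _) = fun t => complex.Re a * complex.Re (w t)
      - complex.Im a * complex.Im (w t) + complex.Re (w' t)).
      by apply: measurable_funD => //; apply: measurable_funB; exact: measurable_funM.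
    by apply/funext => t; rewrite ReD; case: a (w t) => ? ? [].
  - rewrite (_ : (fun t => complex.Im _) = fun t => complex.Re a * complex.Im (w t)
      + complex.Im a * complex.Re (w t) + complex.Im (w' t)).
      by apply: measurable_funD => //; apply: measurable_funD; exact: measurable_funM.
    by apply/funext => t; rewrite ImD; case: a (w t) => ? ? [].
  - move=> t; have := nsqD_le (a * w t) (w' t).
    rewrite nsqM; move/le_trans; apply; rewrite lerD // ler_wpM2l //.
    by rewrite ler_wpM2l // nsq_ge0.
split=> //; apply: rep_ext.
have h1 := rep_mul u bS; have h2 := repZD a (L2mul w u) (L2mul w' u).
have h3 := rep_mul u bw; have h4 := rep_mul u bw'.
apply: filterS2 (filterI h1 h2) (filterI h3 h4).
- by move=> t /= [-> ->] [-> ->]; ring.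
Qed.

Definition etz (l : int) (t : R) : R[i] := cos (l%:~R * t) +i* sin (l%:~R * t).

Lemma nsq_etz l t : nsq (etz l t) = 1.
Proof. by rewrite /nsq /= cos2Dsin2. Qed.

Lemma etzD l m t : etz l t * etz m t = etz (l + m) t.
Proof.
by rewrite /etz rmorphD /= mulrDl cosD sinD [X in _ = _ +i* X]addrC.
Qed.

Lemma etzJ l t : conjc (etz l t) = etz (- l) t.
Proof. by rewrite /etz mulrNz mulNr cosN sinN. Qed.

Lemma bounded_multiplier_etz l : bounded_multiplier (etz l) 1.
Proof.
split=> [||t]; last by rewrite nsq_etz.
- by apply: continuous_measurable_fun; exact: continuous_cos_int.
- by apply: continuous_measurable_fun; exact: continuous_sin_int.
Qed.

Lemma rep_zpow l : {ae mu, forall t, rep (zpow R l) t = etz l t}.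
Proof. exact: rep_class (bounded_multiplier_L2 (bounded_multiplier_etz l)). Qed.

Lemma L2mul_zpow l m : L2mul (etz m) (zpow R l) = zpow R (l + m).
Proof.
apply: rep_ext.
have h1 := rep_mul (zpow R l) (bounded_multiplier_etz m).
have h2 := rep_zpow l; have h3 := rep_zpow (l + m).
apply: filterS2 (filterI h1 h2) h3.
- by move=> t /= [-> ->] ->; rewrite etzD addrC.
Qed.

Lemma ip_zpowr u l : ip u (zpow R l) = cint (fun t => rep u t * etz (- l) t).
Proof.
rewrite (L2inner_ae (rep_L2 u) (bounded_multiplier_L2 (bounded_multiplier_etz l)) _
  (rep_zpow l)); last exact: aeW.
by congr cint; apply/funext => t; rewrite etzJ.
Qed.

Lemma ip_zpow l m : ip (zpow R l) (zpow R m) = if l == m then (pi *+ 2)%:C else 0.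
Proof.
have bl k := bounded_multiplier_L2 (bounded_multiplier_etz k).
rewrite (L2inner_ae (bl l) (bl m) (rep_zpow l) (rep_zpow m)).
rewrite (_ : (fun t => _) = etz (l - m)); last first.
  by apply/funext => t; rewrite etzJ etzD.
rewrite /cint integral_cos_int integral_sin_int subr_eq0.
by case: ifP.
Qed.

End Multipliers.

(** * The Riesz-Fischer theorem *)

Section RieszFischer.
Context (R : realType).
Local Notation T := (measurableTypeR R).
Local Notation mu := (circle_measure R).
Local Notation ip := (@L2inner R).
Local Notation N2 := (qf ip).
Implicit Types (u v : L2S1 R).

Let measurable_nsq (g : T -> R[i]) :
  measurable_fun [set: T] (fun t => complex.Re (g t)) ->
  measurable_fun [set: T] (fun t => complex.Im (g t)) ->
  measurable_fun [set: T] (fun t => (nsq (g t))%:E).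
Proof.
by move=> h1 h2; apply/measurable_EFinP; apply: measurable_funD; exact: measurable_funX.
Qed.

Let rep_measurable u : measurable_fun [set: T] (fun t => complex.Re (rep u t)) /\
  measurable_fun [set: T] (fun t => complex.Im (rep u t)).
Proof. by have /andP[/L2_measurable ? /L2_measurable ?] := rep_L2 u. Qed.

Lemma measurable_sub_rep (f : T -> R[i]) u :
  measurable_fun [set: T] (fun t => complex.Re (f t)) ->
  measurable_fun [set: T] (fun t => complex.Im (f t)) ->
  measurable_fun [set: T] (fun t => complex.Re (f t - rep u t)) /\
  measurable_fun [set: T] (fun t => complex.Im (f t - rep u t)).
Proof.
move=> f1 f2; have [u1 u2] := rep_measurable u; split.
- under eq_fun do rewrite ReD ReN.
  exact: measurable_funB.
- under eq_fun do rewrite ImD ImN.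
  exact: measurable_funB.
Qed.

Lemma N2_sub_ae u v (f : T -> R[i]) :
  measurable_fun [set: T] (fun t => complex.Re (f t)) ->
  measurable_fun [set: T] (fun t => complex.Im (f t)) ->
  {ae mu, forall t, rep v t = f t} ->
  (N2 (u - v))%:E = (\int[mu]_t (nsq (f t - rep u t))%:E)%E.
Proof.
move=> f1 f2 vf; rewrite L2_N2E; apply: ae_eq_integral => //.
- have [h1 h2] := rep_measurable (u - v); exact: measurable_nsq.
- have [h1 h2] := measurable_sub_rep u f1 f2; exact: measurable_nsq.
- have h := repZD (-1) v u.
  rewrite scaleN1r addrC in h.
  apply: (@filterS2 _ (almost_everywhere mu) (ae_filter_ringOfSetsType mu) _ _ _ _ h vf).
  by move=> t -> -> _; rewrite mulN1r addrC -nsqN opprB.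
Qed.

Lemma geometric_half_sum n : \sum_(0 <= k < n) 2^-1 ^+ k <= 2 :> R.
Proof.
suff -> : \sum_(0 <= k < n) 2^-1 ^+ k = 2 - 2 * 2^-1 ^+ n :> R.
  by rewrite gerBl mulr_ge0 // exprn_ge0.
elim: n => [|n ih]; first by rewrite big_geq // expr0 mulr1 subrr.
by rewrite big_nat_recr //= ih exprS; field.
Qed.

(** The hypothesis is on squared increments because it will come from squared norms; the increments
    themselves are dominated by a geometric series of ratio [2^(-1/2)]. *)
Lemma cvg_of_geometric_steps (a : nat -> R) (s : R) :
  (forall k, (a k.+1 - a k) ^+ 2 <= s * 2^-1 ^+ k) -> cvgn a.
Proof.
move=> ak; pose q : R := Num.sqrt 2^-1.
have q0 : 0 <= q := sqrtr_ge0 _.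
have q1 : `|q| < 1.
  by rewrite ger0_norm // -[ltRHS]sqrtr1 ltr_sqrt // invf_lt1 // ltr1n.
have s0 : 0 <= s.
  by have := ak 0%N; rewrite expr0 mulr1; apply: le_trans; exact: sqr_ge0.
have steps k : `|a k.+1 - a k| <= Num.sqrt s * q ^+ k.
  rewrite -(@ler_pXn2r _ 2) ?nnegrE ?mulr_ge0 ?sqrtr_ge0 ?exprn_ge0 //.
  rewrite real_normK ?num_real // exprMn sqr_sqrtr // -exprM mulnC exprM.
  by rewrite sqr_sqrtr ?invr_ge0.
have : cvgn (series (telescope a)).
  apply: normed_cvg.
  apply: (series_le_cvg _ _ steps) => [k|k|]; first exact: normr_ge0.
  - by rewrite mulr_ge0 ?sqrtr_ge0 ?exprn_ge0.
  - by apply/cvg_ex; exists (Num.sqrt s / (1 - q)); exact: cvg_geometric_series.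
rewrite telescopeK => /cvg_ex[l al]; apply/cvg_ex; exists (l + a 0%N).
have al' : (fun n => a n - a 0%N + a 0%N) @ \oo --> l + a 0%N.
  by apply: cvgD; [exact: al | exact: cvg_cst].
have aE : (fun n => a n - a 0%N + a 0%N) = a by apply/funext => n; rewrite subrK.
by rewrite aE in al'.
Qed.

(** The squared increments [d k] have integrals at most [4^-k], so the sum [S] of the [2^k d k] is
    integrable, hence finite almost everywhere. There [d k t <= S t * 2^-k], which forces pointwise
    convergence. *)
Lemma L2_complete (u : nat -> L2S1 R) :
  (forall k, hnorm ip (u k.+1 - u k) <= 2^-1 ^+ k) ->
  exists y, (fun k => hnorm ip (u k - y)) @ \oo --> (0 : R).
Proof.
have ipP := @L2_inner_product R.
move=> ustep.
have half0 k : 0 <= 2^-1 ^+ k :> R by rewrite exprn_ge0.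
have udist k m : hnorm ip (u (k + m)%N - u k) <= 2 * 2^-1 ^+ k.
  suff : hnorm ip (u (k + m)%N - u k) <= 2^-1 ^+ k * \sum_(0 <= j < m) 2^-1 ^+ j.
    by move/le_trans; apply; rewrite mulrC ler_wpM2r // geometric_half_sum.
  elim: m => [|m ih]; first by rewrite addn0 subrr (ipnorm0 ipP) big_geq // mulr0.
  rewrite big_nat_recr //= mulrDr -exprD addnS.
  apply: le_trans (lerD ih (ustep (k + m)%N)).
  rewrite [leRHS]addrC; apply: le_trans (ipnormD ipP _ _).
  by rewrite addrA subrK.
pose d k t := nsq (rep (u k.+1) t - rep (u k) t).
have mrep k := rep_measurable (u k).
have md k : measurable_fun [set: T] (fun t => (d k t)%:E).
  have [h1 h2] := mrep k.+1.
  by have [h3 h4] := measurable_sub_rep (u k) h1 h2; exact: measurable_nsq.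
have id k : (\int[mu]_t (d k t)%:E <= (4^-1 ^+ k)%:E)%E.
  have [h1 h2] := mrep k.+1.
  have := @N2_sub_ae (u k) (u k.+1) _ h1 h2 (aeW _ (fun=> erefl)).
  move=> <-; rewrite lee_fin -opprB (qfN ipP.1).
  have := ustep k; rewrite (ipnorm_le ipP) // -exprM mulnC exprM.
  by rewrite expr2 -invfM -natrM.
pose S t := (\sum_(0 <= k <oo) (2 ^+ k * d k t)%:E)%E.
have d0 k t : (0 <= (2 ^+ k * d k t)%:E)%E.
  by rewrite lee_fin mulr_ge0 ?exprn_ge0 ?nsq_ge0.
have md2 k : measurable_fun [set: T] (fun t => (2 ^+ k * d k t)%:E).
  have /measurable_EFinP h := md k.
  by apply/measurable_EFinP; apply: measurable_funM => //; exact: measurable_cst.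
have S0 t : (0 <= S t)%E by apply: nneseries_ge0.
have iS : (\int[mu]_t S t <= 2%:E)%E.
  rewrite integral_nneseries //.
  apply: lime_le; first by apply: is_cvg_nneseries => *; apply: integral_ge0.
  apply: nearW => n; apply: (@le_trans _ _ (\sum_(0 <= k < n) (2^-1 ^+ k)%:E)%E).
    apply: lee_sum => k _.
    under eq_integral do rewrite EFinM.
    rewrite ge0_integralZl //; last by move=> t _; rewrite lee_fin nsq_ge0.
    apply: (@le_trans _ _ ((2 ^+ k)%:E * (4^-1 ^+ k)%:E)%E).
      by rewrite lee_wpmul2l // lee_fin exprn_ge0.
    rewrite -EFinM lee_fin -exprMn (_ : 2 * 4^-1 = 2^-1) //.
    by field.
  by rewrite sumEFin lee_fin geometric_half_sum.
have mS : measurable_fun [set: T] S by exact: ge0_emeasurable_sum.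
have aeS : {ae mu, forall t, S t \is a fin_num}.
  have : mu.-integrable [set: T] S.
    apply/integrableP; split=> //; under eq_integral do rewrite gee0_abs //.
    by apply: le_lt_trans iS _; rewrite ltry.
  move=> /(integrable_ae measurableT).
  apply: (@filterS _ (almost_everywhere mu) (ae_filter_ringOfSetsType mu)).
  by move=> t; apply.
have cv t : S t \is a fin_num -> cvgn (fun k => complex.Re (rep (u k) t)) /\
    cvgn (fun k => complex.Im (rep (u k) t)).
  move=> St; have dS k : d k t <= fine (S t) * 2^-1 ^+ k.
    have : ((2 ^+ k * d k t)%:E <= S t)%E.
      have := @nneseries_lim_ge R (fun k => (2 ^+ k * d k t)%:E) xpredT 0 k.+1
        (fun n _ _ => d0 n t).
      apply: le_trans; rewrite big_nat_recr //= leeDr //.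
      by apply: sume_ge0 => *; exact: d0.
    rewrite -(fineK St) lee_fin => h.
    by rewrite exprVn ler_pdivlMr ?exprn_gt0 // mulrC.
  split; apply: (@cvg_of_geometric_steps _ (fine (S t))) => k; apply: le_trans (dS k).
  - by rewrite /d /nsq ReD ReN lerDl sqr_ge0.
  - by rewrite /d /nsq ImD ImN lerDr sqr_ge0.
(* Upper limits are measurable everywhere and agree with the limits wherever these exist. *)
pose re t := fine (limn_esup (fun k => (complex.Re (rep (u k) t))%:E)).
pose im t := fine (limn_esup (fun k => (complex.Im (rep (u k) t))%:E)).
have limE (a : nat -> R) : cvgn a -> a @ \oo --> fine (limn_esup (fun k => (a k)%:E)).
  move=> ca; have ca' : (fun k => (a k)%:E) @ \oo --> (limn a)%:E.
    by apply: cvg_EFin => //; exact: nearW.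
  by rewrite is_cvg_limn_esupE ?(cvg_lim _ ca') //; apply/cvg_ex; exists (limn a)%:E.
have aelim : {ae mu, forall t, (fun k => complex.Re (rep (u k) t)) @ \oo --> re t /\
    (fun k => complex.Im (rep (u k) t)) @ \oo --> im t}.
  apply: (@filterS _ (almost_everywhere mu) (ae_filter_ringOfSetsType mu) _ _ _ aeS).
  by move=> t /cv[c1 c2]; split; exact: limE.
pose f t : R[i] := re t +i* im t.
have mre : measurable_fun [set: T] (fun t => complex.Re (f t)).
  apply: (measurableT_comp (fine_measurable measurableT)) => //.
  apply: measurable_fun_limn_esup => k; apply/measurable_EFinP.
  by case: (mrep k).
have mim : measurable_fun [set: T] (fun t => complex.Im (f t)).
  apply: (measurableT_comp (fine_measurable measurableT)) => //.
  apply: measurable_fun_limn_esup => k; apply/measurable_EFinP.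
  by case: (mrep k).
(* Fatou's lemma along the shifted sequence, whose members are all within [2 * 2^-k] of [u k]. *)
have bound k : (\int[mu]_t (nsq (f t - rep (u k) t))%:E <=
    ((2 * 2^-1 ^+ k) ^+ 2)%:E)%E.
  pose h M t := (nsq (rep (u (k + M)%N) t - rep (u k) t))%:E.
  have mh M : measurable_fun [set: T] (h M).
    have [h1 h2] := mrep (k + M)%N.
    by have [h3 h4] := measurable_sub_rep (u k) h1 h2; exact: measurable_nsq.
  have ih M : (\int[mu]_t h M t <= ((2 * 2^-1 ^+ k) ^+ 2)%:E)%E.
    have [h1 h2] := mrep (k + M)%N.
    have := @N2_sub_ae (u k) (u (k + M)%N) _ h1 h2 (aeW _ (fun=> erefl)).
    by move=> <-; rewrite lee_fin -opprB (qfN ipP.1) -(ipnorm_le ipP) ?mulr_ge0 //.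
  apply: (@le_trans _ _ (\int[mu]_t limn_einf (h^~ t))%E); last first.
    apply: le_trans (fatou mu measurableT mh _) _.
      by move=> M t _; rewrite lee_fin nsq_ge0.
    rewrite limn_einf_lim; apply: lime_le; first exact: is_cvg_einfs.
    apply: nearW => M; apply: le_trans (ih M).
    by apply: ereal_inf_lbound; exists M => //=.
  rewrite le_eqVlt; apply/orP; left; apply/eqP; apply: ae_eq_integral => //.
  - by have [h3 h4] := measurable_sub_rep (u k) mre mim; exact: measurable_nsq.
  - apply: measurableT_comp; first exact: oppe_measurable.
    apply: measurable_fun_limn_esup => M.
    by apply: measurableT_comp; [exact: oppe_measurable | exact: mh].
  apply: (@filterS _ (almost_everywhere mu) (ae_filter_ringOfSetsType mu) _ _ _ aelim).
  move=> t [c1 c2] _.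
  have hc : h^~ t @ \oo --> (nsq (f t - rep (u k) t))%:E.
    apply: cvg_EFin; first exact: nearW.
    have -> : nsq (f t - rep (u k) t) = (re t - complex.Re (rep (u k) t)) ^+ 2 +
        (im t - complex.Im (rep (u k) t)) ^+ 2 by rewrite /nsq ReD ImD ReN ImN.
    have -> : fine \o h^~ t = fun M =>
        (complex.Re (rep (u (k + M)%N) t) - complex.Re (rep (u k) t)) ^+ 2 +
        (complex.Im (rep (u (k + M)%N) t) - complex.Im (rep (u k) t)) ^+ 2.
      by apply/funext => M; rewrite /h /= /nsq ReD ImD ReN ImN.
    have sh (a : nat -> R) (l b : R) : a @ \oo --> l ->
        (fun M => (a (k + M)%N - b) ^+ 2) @ \oo --> (l - b) ^+ 2.
      move=> al; have al' : (fun M => a (k + M)%N) @ \oo --> l.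
        rewrite (_ : (fun M => a (k + M)%N) = [sequence a (n + k)%N]_n).
          by rewrite cvg_shiftn.
        by apply/funext => M /=; rewrite addnC.
      by apply: cvgM; apply: cvgB => //; exact: cvg_cst.
    by apply: cvgD; [exact: (sh (fun k => complex.Re (rep (u k) t)))
      | exact: (sh (fun k => complex.Im (rep (u k) t)))].
  by rewrite is_cvg_limn_einfE ?(cvg_lim _ hc) //; apply/cvg_ex; eexists; exact: hc.
have f2 : f \in @L2fun R.
  have [h3 h4] := measurable_sub_rep (u 0%N) mre mim.
  have g2 : (fun t => f t - rep (u 0%N) t) \in @L2fun R.
    by apply: L2fun_of_nsq => //; apply: le_lt_trans (bound 0%N) _; rewrite ltry.
  have := L2fun_linear 1 g2 (rep_L2 (u 0%N)).
  rewrite (_ : (fun t => 1 * _ + _) = f) //.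
  by apply/funext => t; rewrite mul1r subrK.
exists (L2class f).
have le k : 0 <= hnorm ip (u k - L2class f) <= 2 * 2^-1 ^+ k.
  rewrite ipnorm_ge0 (ipnorm_le ipP) ?mulr_ge0 // -lee_fin.
  rewrite (N2_sub_ae _ mre mim (rep_class f2)); exact: bound.
apply: (squeeze_cvgr (f := fun=> 0) (h := fun k => 2 * 2^-1 ^+ k)).
- by near=> k; exact: le.
- exact: cvg_cst.
- rewrite -[X in _ --> X](mulr0 2); apply: cvgM; first exact: cvg_cst.
  by apply: cvg_expr; rewrite ger0_norm ?invr_ge0 // invf_lt1 // ltr1n.
Unshelve. all: by end_near. Qed.

End RieszFischer.

(** * Completeness of the trigonometric system *)

Section PeakPolynomials.
Context (R : realType).

Lemma bernoulli_ge (z : R) m : 0 <= z <= 1 -> 1 - m%:R * z <= (1 - z) ^+ m.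
Proof.
move=> /andP[z0 z1]; elim: m => [|m ih]; first by rewrite mul0r subr0 expr0.
rewrite exprS; apply: (@le_trans _ _ ((1 - z) * (1 - m%:R * z))); last first.
  by rewrite ler_wpM2l // subr_ge0.
rewrite -natr1 -subr_ge0.
have -> : (1 - z) * (1 - m%:R * z) - (1 - (m%:R + 1) * z) = m%:R * z ^+ 2 by ring.
by rewrite mulr_ge0 // sqr_ge0.
Qed.

Lemma bernoulli_le (z : R) m : 0 <= z -> 1 + m%:R * z <= (1 + z) ^+ m.
Proof.
move=> z0; elim: m => [|m ih]; first by rewrite mul0r addr0 expr0.
rewrite exprS; apply: (@le_trans _ _ ((1 + z) * (1 + m%:R * z))); last first.
  by rewrite ler_wpM2l // addr_ge0.
rewrite -natr1 -subr_ge0.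
have -> : (1 + z) * (1 + m%:R * z) - (1 + (m%:R + 1) * z) = m%:R * z ^+ 2 by ring.
by rewrite mulr_ge0 // sqr_ge0.
Qed.

(** With [s] the square root of [q], one factor [s^n] absorbs [n], as
    [n s^n <= (1 - s^n) / (1 - s)], and the other tends to 0. *)
Lemma cvg_natM_expr (q : R) : 0 <= q < 1 -> (fun n => n%:R * q ^+ n) @ \oo --> (0 : R).
Proof.
move=> /andP[q0 q1]; pose s := Num.sqrt q.
have s0 : 0 <= s := sqrtr_ge0 _.
have sE : s ^+ 2 = q by rewrite sqr_sqrtr.
have s1 : s < 1 by rewrite -[ltRHS]sqrtr1 ltr_sqrt.
have ns n : n%:R * s ^+ n <= (1 - s)^-1.
  rewrite -[leRHS]mul1r ler_pdivlMr ?subr_gt0 //.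
  apply: (@le_trans _ _ (1 - s ^+ n)); last by rewrite gerBl exprn_ge0.
  have sn k : 0 <= s ^+ k by rewrite exprn_ge0.
  elim: n => [|n ih]; first by rewrite mul0r mul0r expr0 subrr.
  have h := ler_wpM2l s0 ih.
  have h1 : 0 <= (1 - s) * (1 - s ^+ n.+1).
    by rewrite mulr_ge0 // subr_ge0 ?(ltW s1) // exprn_ile1 // ltW.
  by rewrite exprS in h1; rewrite -natr1 exprS; lra.
apply: (squeeze_cvgr (f := fun=> 0) (h := fun n => (1 - s)^-1 * s ^+ n)).
- apply: nearW => n; rewrite mulr_ge0 ?exprn_ge0 //=.
  by rewrite -sE -exprM mulnC exprM expr2 mulrA ler_wpM2r ?exprn_ge0.
- exact: cvg_cst.
- rewrite -[X in _ --> X](mulr0 (1 - s)^-1); apply: cvgM; first exact: cvg_cst.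
  by apply: cvg_expr; rewrite ger0_norm.
Qed.

(** An integer [m] with [n k^n < m <= n k^n + 1], as in elementary proofs of the Stone-Weierstrass
    theorem: [m y^n] tends to 0 if [y k < 1] and to infinity if [y k >= 1]. The factor [n] settles
    the boundary case [y k = 1]. *)
Definition peak_exp (k : R) n := (Num.truncn (n%:R * k ^+ n)).+1.

(* Applied to y = (1 + cos (t - a)) / 2, this makes the indicator of an arc a
   bounded limit of trigonometric polynomials. *)
Lemma peak_cvg (y k : R) : 0 <= y <= 1 -> 1 < k ->
  (fun n => (1 - y ^+ n) ^+ (peak_exp k n)) @ \oo --> ((y * k < 1)%R%:R : R).
Proof.
move=> /andP[y0 y1] k1; have k0 : 0 < k by apply: lt_trans k1.
have z01 n : 0 <= y ^+ n <= 1 by rewrite exprn_ge0 //= exprn_ile1.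
have w01 n : 0 <= 1 - y ^+ n by rewrite subr_ge0; case/andP: (z01 n).
have nk n : 0 <= n%:R * k ^+ n by rewrite mulr_ge0 // exprn_ge0 // ltW.
have [yk|yk] := ltP (y * k) 1.
  have y1' : y < 1.
    by apply: le_lt_trans yk; rewrite ler_peMr // ltW.
  apply: (squeeze_cvgr (f := fun n => 1 - (n%:R * (y * k) ^+ n + y ^+ n)) (h := fun=> 1)).
  - apply: nearW => n; rewrite exprn_ile1 ?w01 //=; last first.
      by rewrite gerBl; case/andP: (z01 n).
    rewrite andbT; apply: le_trans (bernoulli_ge _ (z01 n)).
    rewrite lerD2l lerN2; case/andP: (z01 n) => z0 _.
    apply: (@le_trans _ _ ((n%:R * k ^+ n + 1) * y ^+ n)).
      by rewrite ler_wpM2r // -natr1 lerD2r truncn_le.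
    by rewrite mulrDl mul1r exprMn mulrAC mulrA.
  - rewrite -[X in _ --> X](subr0 1); apply: cvgB; first exact: cvg_cst.
    rewrite -[X in _ --> X](addr0 0); apply: cvgD.
      by apply: cvg_natM_expr; rewrite yk mulr_ge0 // ltW.
    by apply: cvg_expr; rewrite ger0_norm.
  - exact: cvg_cst.
apply: (squeeze_cvgr (f := fun=> 0) (h := fun n => n.+1%:R^-1)).
- apply: nearW => n; rewrite exprn_ge0 //=.
  have /andP[z0 z1] := z01 n; set m := peak_exp k n.
  (* With [z = y^n], Bernoulli's inequality gives [(1 - z)^m (1 + m z) <= (1 - z)^m (1 + z)^m = (1 -
     z^2)^m <= 1]. *)
  have mz : n.+1%:R <= 1 + m%:R * y ^+ n.
    rewrite -natr1 addrC lerD2l.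
    apply: (@le_trans _ _ (n%:R * k ^+ n * y ^+ n)); last first.
      rewrite ler_wpM2r // ltW //; exact: truncnS_gt.
    by rewrite -mulrA -exprMn ler_peMr // exprn_ege1 // mulrC.
  rewrite -[leRHS]mul1r ler_pdivlMr ?ltr0n //.
  apply: (@le_trans _ _ ((1 - y ^+ n) ^+ m * (1 + y ^+ n) ^+ m)).
    rewrite ler_wpM2l ?exprn_ge0 //; apply: le_trans mz _.
    exact: bernoulli_le.
  have zp : 0 <= 1 + y ^+ n by rewrite addr_ge0.
  rewrite -exprMn exprn_ile1 ?mulr_ge0 //.
  by rewrite -subr_sqr expr1n gerBl sqr_ge0.
- exact: cvg_cst.
- exact: cvg_harmonic.
Qed.

End PeakPolynomials.

Section Totality.
Context (R : realType).
Local Notation T := (measurableTypeR R).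
Local Notation mu := (circle_measure R).
Local Notation leb := (@lebesgue_measure R).
Local Notation D2pi := `[(0 : R), pi *+ 2[%classic.
Local Notation intg f := (mu.-integrable [set: T] (EFin \o (f : T -> R))).

Definition null_integral (f : T -> R) : Prop := intg f /\ \int[mu]_t f t = 0.

Lemma null_integralD f g : null_integral f -> null_integral g ->
  null_integral (fun t => f t + g t).
Proof.
move=> [fi f0] [gi g0]; split; first exact: integrableT_add.
by rewrite RintegralD // f0 g0 addr0.
Qed.

Lemma null_integralZ a f : null_integral f -> null_integral (fun t => a * f t).
Proof.
move=> [fi f0]; split; first exact: integrableT_scale.
by rewrite RintegralZl // f0 mulr0.
Qed.

Section Orthogonal.
Variable g : T -> R.

(** The factor [q] makes the condition stable under multiplication by [cos] and [sin], hence by any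
    trigonometric polynomial; [q = 1] is orthogonality of [g] to the trigonometric system. *)
Definition trig_null (q : R -> R) : Prop := forall l : int,
  null_integral (fun t => g t * q t * cos (l%:~R * t)) /\
  null_integral (fun t => g t * q t * sin (l%:~R * t)).

Lemma trig_nullD q r : trig_null q -> trig_null r -> trig_null (fun t => q t + r t).
Proof.
move=> hq hr l; have [q1 q2] := hq l; have [r1 r2] := hr l; split.
  rewrite (_ : (fun t => _) = fun t => g t * q t * cos (l%:~R * t) +
      g t * r t * cos (l%:~R * t)); first exact: null_integralD.
  by apply/funext => t; ring.
rewrite (_ : (fun t => _) = fun t => g t * q t * sin (l%:~R * t) +
    g t * r t * sin (l%:~R * t)); first exact: null_integralD.
by apply/funext => t; ring.
Qed.

Lemma trig_nullZ a q : trig_null q -> trig_null (fun t => a * q t).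
Proof.
move=> hq l; have [q1 q2] := hq l; split.
  rewrite (_ : (fun t => _) = fun t => a * (g t * q t * cos (l%:~R * t))).
    exact: null_integralZ.
  by apply/funext => t; ring.
rewrite (_ : (fun t => _) = fun t => a * (g t * q t * sin (l%:~R * t))).
  exact: null_integralZ.
by apply/funext => t; ring.
Qed.

Lemma trig_null_cos q : trig_null q -> trig_null (fun t => cos t * q t).
Proof.
move=> hq l; have [c1 s1] := hq (l + 1); have [c2 s2] := hq (l - 1); split.
  rewrite (_ : (fun t => _) = fun t => 2^-1 * (g t * q t * cos ((l + 1)%:~R * t) +
      g t * q t * cos ((l - 1)%:~R * t))).
    by apply: null_integralZ; exact: null_integralD.
  apply/funext => t; rewrite intrD intrB mulrDl mulrBl mul1r cosD cosB.
  by field.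
rewrite (_ : (fun t => _) = fun t => 2^-1 * (g t * q t * sin ((l + 1)%:~R * t) +
    g t * q t * sin ((l - 1)%:~R * t))).
  by apply: null_integralZ; exact: null_integralD.
apply/funext => t; rewrite intrD intrB mulrDl mulrBl mul1r sinD sinB.
by field.
Qed.

Lemma trig_null_sin q : trig_null q -> trig_null (fun t => sin t * q t).
Proof.
move=> hq l; have [c1 s1] := hq (l + 1); have [c2 s2] := hq (l - 1); split.
  rewrite (_ : (fun t => _) = fun t => 2^-1 * (g t * q t * sin ((l + 1)%:~R * t) +
      - 1 * (g t * q t * sin ((l - 1)%:~R * t)))).
    by apply: null_integralZ; apply: null_integralD => //; exact: null_integralZ.
  apply/funext => t; rewrite intrD intrB mulrDl mulrBl mul1r sinD sinB.
  by field.
rewrite (_ : (fun t => _) = fun t => 2^-1 * (- 1 * (g t * q t * cos ((l + 1)%:~R * t)) +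
    g t * q t * cos ((l - 1)%:~R * t))).
  by apply: null_integralZ; apply: null_integralD => //; exact: null_integralZ.
apply/funext => t; rewrite intrD intrB mulrDl mulrBl mul1r cosD cosB.
by field.
Qed.

Lemma trig_null_peak a q : trig_null q ->
  trig_null (fun t => (1 + cos (t - a)) / 2 * q t).
Proof.
move=> hq; rewrite (_ : (fun t => _) = fun t => 2^-1 * q t +
   (cos a / 2 * (cos t * q t) + sin a / 2 * (sin t * q t))).
  apply: trig_nullD; first exact: trig_nullZ.
  by apply: trig_nullD; apply: trig_nullZ; [exact: trig_null_cos|exact: trig_null_sin].
by apply/funext => t; rewrite cosB; field.
Qed.

Lemma trig_null_peakn a n m : trig_null (fun=> 1) ->
  trig_null (fun t => (1 - ((1 + cos (t - a)) / 2) ^+ n) ^+ m).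
Proof.
move=> h1; elim: m => [|m ih]; first by under eq_fun do rewrite expr0.
have hn q : trig_null q -> trig_null (fun t => ((1 + cos (t - a)) / 2) ^+ n * q t).
  move=> hq; elim: n {ih} => [|n ih].
    by under eq_fun do rewrite expr0 mul1r.
  by under eq_fun do rewrite exprS -mulrA; exact: trig_null_peak.
rewrite (_ : (fun t => _) = fun t => (1 - ((1 + cos (t - a)) / 2) ^+ n) ^+ m +
    -1 * (((1 + cos (t - a)) / 2) ^+ n * (1 - ((1 + cos (t - a)) / 2) ^+ n) ^+ m)).
  by apply: trig_nullD => //; apply: trig_nullZ; exact: hn.
by apply/funext => t; rewrite exprS; ring.
Qed.

Hypotheses (gi : intg g) (g0 : trig_null (fun=> 1)).

Let mg : measurable_fun [set: T] g.
Proof. by have /measurable_int/measurable_EFinP := gi. Qed.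

Let y (a : R) (t : T) : R := (1 + cos (t - a)) / 2.

Let cy a : continuous (y a : R -> R).
Proof.
move=> t; apply: cvgM; last exact: cvg_cst.
apply: cvgD; first exact: cvg_cst.
apply: (@continuous_comp _ _ _ (fun t => t - a) cos); last exact: continuous_cos.
by apply: cvgB; [exact: cvg_id|exact: cvg_cst].
Qed.

Let y01 a t : 0 <= y a t <= 1.
Proof. by rewrite /y; have := cos_geN1 (t - a); have := cos_le1 (t - a); lra. Qed.

(** The integrals of [g] against the peak polynomials vanish, and these are bounded by 1, so
    dominated convergence applies with [|g|] as the bound. *)
Lemma integral_off_peak (a k : R) : 1 < k ->
  null_integral (fun t => g t * (y a t * k < 1)%R%:R).
Proof.
move=> k1.
pose f n t := g t * (1 - y a t ^+ n) ^+ (peak_exp k n).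
have my : measurable_fun [set: T] (y a) by exact: continuous_measurable_fun.
have mf n : measurable_fun [set: T] (f n).
  apply: measurable_funM => //; apply: measurable_funX; apply: measurable_funB => //.
  exact: measurable_funX.
have f0 n : (\int[mu]_t (f n t)%:E = 0)%E.
  have [_] := trig_null_peakn a n (peak_exp k n) g0 0.
  have [[i0 h0] _] := trig_null_peakn a n (peak_exp k n) g0 0.
  have fE : f n = fun t => g t * (1 - ((1 + cos (t - a)) / 2) ^+ n) ^+ peak_exp k n *
     cos (0%:~R * t) by apply/funext => t; rewrite mul0r cos0 mulr1.
  move=> _; rewrite -fE in i0 h0.
  by rewrite -(fineK (integrable_fin_num measurableT i0)) -[fine _]/(Rintegral _ _ _) h0.
have mlim : measurable_fun [set: T] (fun t => g t * (y a t * k < 1)%R%:R).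
  apply: measurable_funM => //.
  rewrite (_ : (fun t => _) = \1_[set t | y a t * k < 1]); last first.
    apply/funext => t; rewrite indicE; case: (boolP (y a t * k < 1)) => h.
      by rewrite mem_set.
    by rewrite memNset //=; exact/negP.
  apply: measurable_indic; rewrite -[X in measurable X]setTI.
  apply: (measurable_fun_ltr (f := fun t => y a t * k) (g := fun=> 1)) => //.
  by apply: measurable_funM.
have [] := @dominated_convergence _ T R mu setT measurableT (fun n t => (f n t)%:E)
  (fun t => (g t * (y a t * k < 1)%R%:R)%:E) (fun t => `|(g t)%:E|%E).
- by move=> n; exact/measurable_EFinP.
- exact/measurable_EFinP.
- apply: aeW => t _; apply: cvg_EFin; first exact: nearW.
  have h : (fun n => g t * (1 - y a t ^+ n) ^+ peak_exp k n) @ \oo -->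
      g t * (y a t * k < 1)%R%:R.
    by apply: cvgM; [exact: cvg_cst | exact: peak_cvg (y01 a t) k1].
  exact: h.
- exact: integrable_abse.
- apply: aeW => t n _; rewrite lee_fin normrM ler_piMr //.
  have /andP[h0 h1] := y01 a t.
  rewrite normrX exprn_ile1 // ger0_norm ?subr_ge0 ?exprn_ile1 //.
  by rewrite gerBl exprn_ge0.
move=> il _; under eq_fun do rewrite f0.
move=> /(cvg_lim (@ereal_hausdorff _)) h; split; first exact: il.
by rewrite /Rintegral -h lim_cst.
Qed.

End Orthogonal.

(** The point [x / 2] is the midpoint of the arc [[0, x]], so [cos (t - x / 2)] is at least its
    value at the two ends exactly on this arc. *)
Lemma arc_peak (x t : R) : 0 < x < pi *+ 2 -> 0 <= t < pi *+ 2 ->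
  (cos (t - x / 2) < cos (x / 2)) = (x < t).
Proof.
move=> /andP[x0 x1] /andP[t0 t1].
have p0 := pi_gt0 R; rewrite mulr2n in x1 t1.
have hx : x / 2 \in `[0, pi] by rewrite in_itv /=; apply/andP; split; lra.
have [tx|tx] := leP (x / 2) t; last first.
  rewrite -opprB cosN ltr_cos //; last by rewrite in_itv /=; apply/andP; split; lra.
  by apply/idP/idP => h; lra.
have [upi|upi] := leP (t - x / 2) pi.
  rewrite ltr_cos //; last by rewrite in_itv /=; apply/andP; split; lra.
  by apply/idP/idP => h; lra.
(* Beyond the antipode of the midpoint, [t - x / 2] is replaced by [2 pi - (t - x / 2)], which lies
   in [[0, pi]]. *)
rewrite -cosN -cosD2pi [pi *+ 2]mulr2n ltr_cos //; last first.
  by rewrite in_itv /=; apply/andP; split; lra.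
by apply/idP/idP => h; lra.
Qed.

Lemma circle_integrable (h : T -> R) : intg h -> leb.-integrable D2pi (EFin \o h).
Proof.
move=> hi; have /measurable_int/measurable_EFinP mh := hi.
have /integrableP[_ ih] := hi; apply/integrableP; split.
  by apply: measurable_funTS; exact/measurable_EFinP.
rewrite -[X in (X < _)%E](@circle_integralE R (fun t => `|h t|)) //.
exact: measurableT_comp.
Qed.

(** The integral of [g] over each arc [[0, x]] vanishes, being the total integral minus the integral
    off the arc. So the primitive of [g] is 0, and Lebesgue's differentiation theorem gives [g = 0]
    almost everywhere. *)
Lemma trig_total (g : T -> R) : intg g -> trig_null g (fun=> 1) ->
  {ae mu, forall t, g t = 0}.
Proof.
move=> gi g0.
have mg : measurable_fun [set: T] g by have /measurable_int/measurable_EFinP := gi.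
have mD : measurable (D2pi : set R) by exact: measurable_itv.
have pi0 := pi_gt0 R.
have pi2 : 0 < pi *+ 2 :> R by rewrite pmulrn_lgt0.
have intg0 : \int[mu]_t g t = 0.
  have [[_ h] _] := g0 0; rewrite -[RHS]h; apply: eq_Rintegral => t _.
  by rewrite mul0r cos0 !mulr1.
pose f := g \_ D2pi.
pose F x := \int[leb]_(t in `]-oo, x]) f t.
have fi : leb.-integrable [set: R] (EFin \o f).
  rewrite /f -restrict_EFin; apply/(integrable_mkcond _ _).1 => //.
  exact: circle_integrable.
have mle x : measurable_fun [set: T] (fun t : T => (t <= x)%R%:R : R).
  rewrite (_ : (fun t => _) = \1_(`]-oo, x]%classic : set T)); last first.
    apply/funext => t; rewrite indicE; case: (boolP (t <= x)) => h.
      by rewrite mem_set //= in_itv.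
    by rewrite memNset //= in_itv /=; exact/negP.
  by apply: measurable_indic; exact: measurable_itv.
have FE x : F x = \int[leb]_(t in D2pi) (g t * (t <= x)%R%:R).
  rewrite /F Rintegral_mkcond [RHS]Rintegral_mkcond; apply: eq_Rintegral => t _.
  rewrite !patchE /f patchE /=.
  case: ifPn => [|tx].
    by rewrite inE /= in_itv /= => ->; rewrite mulr1.
  case: ifPn => // _; move: tx; rewrite notin_setE /= in_itv /= => /negP/negbTE->.
  by rewrite mulr0.
have F0 x : F x = 0.
  have [x0|x0|->] := ltgtP x 0; last first.
  - rewrite /F -[RHS](Rintegral_set1 f 0) Rintegral_mkcond [RHS]Rintegral_mkcond.
    apply: eq_Rintegral => t _; rewrite !patchE /f patchE /=.
    have [->|t0] := eqVneq t 0; first by rewrite !mem_set //= in_itv /= lexx.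
    rewrite [in RHS]memNset /=; last exact/eqP.
    case: ifPn => //; rewrite inE /= in_itv /= => tle.
    rewrite memNset //= in_itv /= => /andP[tge _].
    by case/eqP: t0; apply/eqP; rewrite eq_le tle.
  - have [x2|x2] := ltP x (pi *+ 2); last first.
      rewrite FE -[RHS]intg0 circle_RintegralE //.
      apply: eq_Rintegral => t; rewrite inE /= in_itv /= => /andP[_ tx].
      by rewrite (ltW (lt_le_trans tx x2)) mulr1.
    (* Chosen so that the threshold of the peak, [(1 + cos (t - x / 2)) / 2 * k < 1], reads
       [cos (t - x / 2) < cos (x / 2)]. *)
    pose k : R := ((1 + cos (x / 2)) / 2)^-1.
    have x2' : x < pi + pi by rewrite -mulr2n.
    have cx1 : -1 < cos (x / 2).
      by rewrite -cospi ltr_cos ?in_itv /=; do ?(apply/andP; split); lra.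
    have cx2 : cos (x / 2) < 1.
      by rewrite -[ltRHS]cos0 ltr_cos ?in_itv /=; do ?(apply/andP; split); lra.
    have k1 : 1 < k by rewrite /k invf_gt1; lra.
    have kE t : 0 <= t < pi *+ 2 ->
        ((1 + cos (t - x / 2)) / 2 * k < 1) = (x < t).
      move=> ht; rewrite -(arc_peak _ ht) ?x0 // /k ltr_pdivrMr; last by lra.
      by apply/idP/idP => h; lra.
    have [offi off] := integral_off_peak gi g0 (x / 2) k1.
    have /measurable_int/measurable_EFinP moff := offi.
    rewrite FE -[RHS]subr0 -[in X in _ - X]off -[in X in X - _]intg0.
    rewrite !circle_RintegralE // -RintegralB //; do ?exact: circle_integrable.
    apply: eq_Rintegral => t; rewrite inE /= in_itv /= => ht.
    by rewrite kE // leNgt; case: ltP; rewrite ?mulr0 ?mulr1 ?subr0 ?subrr.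
  - rewrite FE (@eq_Rintegral _ _ _ leb _ (fun=> 0)) ?Rintegral_cst ?mul0r //.
    move=> t; rewrite inE /= in_itv /= => /andP[t0 _].
    by rewrite leNgt (lt_le_trans x0 t0) /= mulr0.
have := @FTC1Ny R f _ (open_integrable_locally openT fi).
rewrite -/F => h.
have F'0 x : F^`()%classic x = 0.
  by rewrite (_ : F = cst 0) ?derive1_cst //; apply/funext.
apply: ae_circle.
have {h} : {ae leb, forall x, derivable F x 1 /\ F^`()%classic x = f x}.
  by apply: h => y; apply: integrableS fi.
apply: (@filterS _ _ (ae_filter_ringOfSetsType leb)) => t [_]; rewrite F'0 /f patchE => ft Dt.
by move: ft; rewrite mem_set.
Qed.

End Totality.

(** * Commutators with the Szego projection *)

Section FourierBasis.
Context (R : realType).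
Local Notation T := (measurableTypeR R).
Local Notation mu := (circle_measure R).
Local Notation ip := (@L2inner R).
Local Notation N2 := (qf ip).
Implicit Types (u v : L2S1 R) (l m : int).

Let ipP : inner_product ip := @L2_inner_product R.
Let sd : semidef ip := ipP.1.

(** The condition at [l] mixes the integrals of the real and imaginary parts of [u] against [cos]
    and [sin]. Combined with the condition at [- l] it separates the four of them, which reduces the
    claim to real functions. *)
Lemma L2_total u : (forall l, ip u (zpow R l) = 0) -> u = 0.
Proof.
move=> u0; pose a t := complex.Re (rep u t); pose b t := complex.Im (rep u t).
have /andP[a2 b2] := rep_L2 u.
have c2 l : (fun t : T => cos (l%:~R * t)) \in Lfun mu 2%:E /\
    (fun t : T => sin (l%:~R * t)) \in Lfun mu 2%:E.
  by have /andP[] := bounded_multiplier_L2 (bounded_multiplier_etz R l).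
have prod (f g : T -> R) : f \in Lfun mu 2%:E -> g \in Lfun mu 2%:E ->
    mu.-integrable [set: T] (EFin \o (fun t => f t * g t)).
  exact: L2_mul_integrable.
pose A l := \int[mu]_t (a t * cos (l%:~R * t)).
pose B l := \int[mu]_t (b t * sin (l%:~R * t)).
pose C l := \int[mu]_t (b t * cos (l%:~R * t)).
pose D l := \int[mu]_t (a t * sin (l%:~R * t)).
have eqs l : A l + B l = 0 /\ C l - D l = 0.
  have := u0 l; rewrite ip_zpowr /cint => /eqP; rewrite eq_complex /=.
  have [cl sl] := c2 l.
  move=> /andP[/eqP h1 /eqP h2]; split.
    rewrite -[RHS]h1 -RintegralD //; do ?exact: prod.
    apply: eq_Rintegral => t _; rewrite /a /b; case: (rep u t) => ? ? /=.
    by rewrite mulrNz mulNr cosN sinN mulrN opprK.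
  rewrite -[RHS]h2 -RintegralB //; do ?exact: prod.
  apply: eq_Rintegral => t _; rewrite /a /b; case: (rep u t) => ? ? /=.
  by rewrite mulrNz mulNr cosN sinN mulrN addrC.
have even l : A (- l) = A l /\ C (- l) = C l.
  by split; apply: eq_Rintegral => t _; rewrite mulrNz mulNr cosN.
have odd l : B (- l) = - B l /\ D (- l) = - D l.
  have [cl sl] := c2 l.
  by split; rewrite -Rintegral_opp; do ?exact: prod;
    apply: eq_Rintegral => t _; rewrite mulrNz mulNr sinN mulrN.
have zero l : [/\ A l = 0, B l = 0, C l = 0 & D l = 0].
  have [h1 h2] := eqs l; have := eqs (- l).
  have [-> ->] := even l; have [-> ->] := odd l => -[h3 h4].
  by split; lra.
have a0 : {ae mu, forall t, a t = 0}.
  apply: trig_total; first exact: L2_integrable.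
  move=> l; have [cl sl] := c2 l; have [A0 _ _ D0] := zero l.
  split; split; do ?[under eq_fun do rewrite mulr1; exact: prod].
    by rewrite -[RHS]A0; apply: eq_Rintegral => t _; rewrite mulr1.
  by rewrite -[RHS]D0; apply: eq_Rintegral => t _; rewrite mulr1.
have b0 : {ae mu, forall t, b t = 0}.
  apply: trig_total; first exact: L2_integrable.
  move=> l; have [cl sl] := c2 l; have [_ B0 C0 _] := zero l.
  split; split; do ?[under eq_fun do rewrite mulr1; exact: prod].
    by rewrite -[RHS]C0; apply: eq_Rintegral => t _; rewrite mulr1.
  by rewrite -[RHS]B0; apply: eq_Rintegral => t _; rewrite mulr1.
apply: rep_ext; apply: filterS2 (filterI a0 b0) (rep0 R) => t /= [at0 bt0] ->.
by move: at0 bt0; rewrite /a /b; case: (rep u t) => ? ? /= -> ->.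
Qed.

Definition ez l : L2S1 R := ((Num.sqrt (pi *+ 2))^-1)%:C *: zpow R l.

Lemma ip_ez l m : ip (ez l) (ez m) = (l == m)%:R.
Proof.
rewrite (sformZl sd) (sformZr sd) ip_zpow conjc_real.
case: eqP => [_|_]; last by rewrite !mulr0.
have p : 0 <= pi *+ 2 :> R by rewrite mulrn_wge0 // pi_ge0.
rewrite mulrA -!real_complexM -[X in _ * X](sqr_sqrtr p) -invfM -expr2.
by rewrite mulVf // sqrf_eq0 sqrtr_eq0 -ltNge pmulrn_lgt0 // pi_gt0.
Qed.

Lemma L2_total_ez u : (forall l, ip u (ez l) = 0) -> u = 0.
Proof.
move=> u0; apply: L2_total => l; apply/eqP; have /eqP := u0 l.
rewrite (sformZr sd) mulf_eq0 conjc_real.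
move=> /orP[/eqP/(congr1 (@complex.Re R))/= /eqP|//]; rewrite invr_eq0 sqrtr_eq0.
by rewrite leNgt pmulrn_lgt0 // pi_gt0.
Qed.

Lemma L2_infdim (s : seq (L2S1 R)) :
  exists u, ip u u = 1 /\ forall z, z \in s -> ip u z = 0.
Proof.
pose e (i : 'I_(size s).+1) := ez i.
have [a [i0 ai0] ka] := @kill_functionals R _ (size s) (size s) e
  (fun j x => ip x (nth 0 s j)) (leqnn _) (fun j => sform_linl sd (nth 0 s j)).
set x := \sum_i _ in ka.
have x0 : x != 0.
  apply: contraNneq ai0 => x0; have := congr1 (fun y => ip y (e i0)) x0.
  rewrite (sform0l sd) (sform_suml sd) (bigD1 i0) //= (sformZl sd) ip_ez eqxx mulr1.
  rewrite big1 ?addr0 => [->//|j ji]; rewrite (sformZl sd) ip_ez.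
  by rewrite (negbTE (_ : (j : nat) != i0 :> int)) ?mulr0.
have c0 := N2_gt0 ipP x0; set c : R := Num.sqrt (N2 x).
have cE : c ^+ 2 = N2 x by rewrite sqr_sqrtr ?ltW.
exists (c^-1%:C *: x); split.
  by rewrite (sform_diag sd) (qfZ sd) nsqR exprVn cE mulVf // gt_eqF.
move=> z zs; rewrite (sformZl sd).
have iz : (index z s < size s)%N by rewrite index_mem.
by have /= := ka (Ordinal iz); rewrite nth_index // => ->; rewrite mulr0.
Qed.

End FourierBasis.

Section SzegoCommutator.
Context (R : realType) (P : L2S1 R -> L2S1 R) (hP : is_szego P).
Local Notation ip := (@L2inner R).
Local Notation N2 := (qf ip).
Implicit Types (u v : L2S1 R) (l m : int) (w : R -> R[i]) (B : R).

Let ipP : inner_product ip := @L2_inner_product R.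
Let sd : semidef ip := ipP.1.
Let linP : linear P. Proof. by case: hP. Qed.
Let symP u v : ip (P u) v = ip u (P v). Proof. by case: hP. Qed.

Lemma N2_szego u : N2 (P u) <= N2 u.
Proof.
have [Pu0|Pu0] := eqVneq (P u) 0; first by rewrite Pu0 (qf0 sd) qf_ge0.
have idP : P (P u) = P u by case: hP.
have := cauchy_schwarz sd u (P u).
rewrite -{1}idP -symP (sform_diag sd) nsqR expr2.
by rewrite ler_pM2r ?(N2_gt0 ipP).
Qed.

Section OneMultiplier.
Variables (w : R -> R[i]) (B : R).
Hypothesis wB : bounded_multiplier w B.

Lemma commutator_linear : linear (commutator P w).
Proof.
move=> a u v; have linw := L2mul_linear wB.
rewrite /commutator (linw a) !(linP a) (linw a) scalerBr opprD.
by rewrite addrACA.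
Qed.

Lemma N2_commutator u : N2 (commutator P w u) <= 4 * B * N2 u.
Proof.
have B0 : 0 <= B by case: wB => _ _ h; apply: le_trans (h 0); exact: nsq_ge0.
apply: le_trans (qfD_eps sd _ _ ltr01) _; rewrite invr1 (qfN sd).
have h1 := le_trans (N2_szego (L2mul w u)) (N2_mul u wB).
have h2 := le_trans (N2_mul (P u) wB) (ler_wpM2l B0 (N2_szego u)).
lra.
Qed.

(** For real-valued [w] the commutator is therefore skew-adjoint, and minus its square is
    positive. *)
Lemma commutator_adj u v :
  ip (commutator P w u) v = - ip u (commutator P (fun t => conjc (w t)) v).
Proof.
rewrite (sformDl sd) (sformNl sd) (sformDr sd) (sformNr sd) opprB.
by rewrite symP (L2mul_adj _ _ wB) (L2mul_adj _ _ wB) symP.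
Qed.

End OneMultiplier.

Lemma commutatorZD (a : R[i]) w B w' B' u : bounded_multiplier w B ->
  bounded_multiplier w' B' ->
  commutator P (fun t => a * w t + w' t) u = a *: commutator P w u + commutator P w' u.
Proof.
move=> wB wB'; rewrite /commutator.
rewrite (L2mulZD a u wB wB').2 (L2mulZD a (P u) wB wB').2 (linP a).
by rewrite scalerBr opprD addrACA.
Qed.

Lemma commutator_zpow m l : commutator P (etz m) (zpow R l) =
  ((0 <= l + m)%R%:R - (0 <= l)%R%:R : R[i]) *: zpow R (l + m).
Proof.
have [_ _ _ Pz] := hP; rewrite /commutator L2mul_zpow !Pz scalerBl.
congr (_ - _); first by case: ifP; rewrite ?scale1r ?scale0r.
case: ifP => _; rewrite ?scale1r ?scale0r ?L2mul_zpow //.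
exact: (lin0 (L2mul_linear (bounded_multiplier_etz R m))).
Qed.

End SzegoCommutator.

Section ComplexLimits.
Context (R : realType).

Lemma cvg_scale (F : numFieldType) (a : F) (x : nat -> F) (l : F) :
  (x : nat -> F^o) @ \oo --> (l : F^o) ->
  ((fun n => a * x n) : nat -> F^o) @ \oo --> (a * l : F^o).
Proof. by move=> xl; apply: cvgM => //; exact: cvg_cst. Qed.

Lemma cvg_complexP (x : nat -> R[i]) (a b : R) :
  (fun n => complex.Re (x n)) @ \oo --> a -> (fun n => complex.Im (x n)) @ \oo --> b ->
  (x : nat -> R[i]^o) @ \oo --> ((a +i* b) : R[i]^o).
Proof.
move=> xa xb.
apply: (null_seq_subP x (a +i* b)).1; apply/null_seqP => e e0.
have s0 : 0 < Num.sqrt (e / 2) by rewrite sqrtr_gt0 divr_gt0.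
move/cvgrPdist_le : xa => /(_ _ s0)[N1 _ h1].
move/cvgrPdist_le : xb => /(_ _ s0)[N2 _ h2].
exists (maxn N1 N2) => n; rewrite geq_max => /andP[/h1 /= {}h1 /h2 /= {}h2].
have sq z : `|z| <= Num.sqrt (e / 2) -> z ^+ 2 <= e / 2.
  move=> h; have <- := @sqr_sqrtr _ (e / 2); last by rewrite divr_ge0 // ltW.
  by rewrite -[leLHS]real_normK ?num_real // ler_pXn2r ?nnegrE // ltW.
rewrite /nsq ReD ImD ReN ImN /= [leRHS]splitr -sqrrN opprB.
by rewrite -[X in _ + X]sqrrN opprB lerD // sq.
Qed.

Lemma normcE_nsq (z : R[i]) : Normc.normc z = Num.sqrt (nsq z).
Proof. by case: z. Qed.

Lemma normc_sum (I : Type) (r : seq I) (Q : pred I) (F : I -> R[i]) :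
  Normc.normc (\sum_(i <- r | Q i) F i) <= \sum_(i <- r | Q i) Normc.normc (F i).
Proof.
elim/big_ind2 : _ => [|x1 x2 y1 y2 h1 h2|//].
  by rewrite normcE_nsq nsq0 sqrtr0.
by apply: le_trans (le_normcD _ _) _; rewrite lerD.
Qed.

End ComplexLimits.

(** * Weierstrass functions as multipliers *)

Section Weierstrass.
Context (R : realType) (gamma : nat) (c : nat -> R[i]) (M : R).
Hypotheses (gamma1 : (1 < gamma)%N) (cM : forall n, nsq (c n) <= M).
Local Notation T := (measurableTypeR R).

Definition wcoef n : R := gamma%:R `^ (- (2^-1 * n%:R)).

Definition wpartial N (t : R) : R[i] :=
  \sum_(0 <= n < N) (2 * (wcoef n)%:C * c n) * (cos ((gamma ^ n)%:R * t))%:C.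

Let gR : 0 < gamma%:R :> R. Proof. by rewrite ltr0n ltnW. Qed.

Lemma wcoef_sqr n : wcoef n ^+ 2 = (gamma%:R ^+ n)^-1.
Proof.
rewrite /wcoef -powR_mulrn ?powR_ge0 // -powRrM -[RHS]powR_inv1 ?exprn_ge0 ?ltW //.
rewrite -powR_mulrn ?ltW // -powRrM; congr (_ `^ _).
by field.
Qed.

Lemma wcoef_ge0 n : 0 <= wcoef n. Proof. exact: powR_ge0. Qed.

Let q : R := wcoef 1.

Lemma wcoefE n : wcoef n = q ^+ n.
Proof.
rewrite /q /wcoef -powR_mulrn ?powR_ge0 // -powRrM; congr (_ `^ _).
by rewrite mulr1 mulNr.
Qed.

Let q1 : q < 1.
Proof.
rewrite -(@ltr_pXn2r _ 2) ?nnegrE ?wcoef_ge0 // wcoef_sqr expr1 expr1n.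
by rewrite invf_lt1 // ltr1n.
Qed.

Let q0 : 0 <= q. Proof. exact: wcoef_ge0. Qed.

Let M0 : 0 <= M. Proof. by apply: le_trans (cM 0%N); exact: nsq_ge0. Qed.

Let D : R := 2 * Num.sqrt M / (1 - q).

Let D0 : 0 <= D.
Proof. by rewrite /D divr_ge0 ?mulr_ge0 ?sqrtr_ge0 // subr_ge0 ltW. Qed.

Lemma wpartial_dist N k t :
  Normc.normc (wpartial (N + k) t - wpartial N t) <= D * q ^+ N.
Proof.
rewrite /wpartial (@big_cat_nat _ _ _ N) ?leq_addr //= addrAC subrr add0r.
apply: le_trans (normc_sum _ _ _) _.
apply: (@le_trans _ _ (\sum_(N <= n < N + k) 2 * Num.sqrt M * q ^+ n)).
  rewrite !big_nat; apply: ler_sum => n _.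
  have n2 : Num.sqrt (nsq (2 : R[i])) = 2.
    have -> : (2 : R[i]) = (2 : R)%:C by rewrite rmorphMn /= rmorph1.
    by rewrite nsqR sqrtr_sqr ger0_norm.
  rewrite !Normc.normcM !normcE_nsq n2 !nsqR !sqrtr_sqr.
  rewrite (ger0_norm (wcoef_ge0 n)) -wcoefE.
  rewrite -[leRHS]mulr1 ler_pM ?cos_max ?mulr_ge0 ?wcoef_ge0 ?sqrtr_ge0 //.
  by rewrite mulrAC ler_wpM2r ?wcoef_ge0 // ler_wpM2l // ler_wsqrtr.
rewrite -mulr_sumr /D -[leRHS]mulrA ler_wpM2l ?mulr_ge0 ?sqrtr_ge0 //.
have -> : \sum_(N <= n < N + k) q ^+ n = (q ^+ N - q ^+ (N + k)) / (1 - q).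
  elim: k => [|k ih]; first by rewrite addn0 big_geq // subrr mul0r.
  rewrite addnS big_nat_recr ?leq_addr //= ih exprS.
  by field; rewrite subr_eq0 eq_sym lt_eqF.
rewrite mulrC ler_wpM2l ?invr_ge0 ?subr_ge0 ?(ltW q1) //.
by rewrite gerBl exprn_ge0.
Qed.

Lemma nsq_wpartial_dist N k t :
  nsq (wpartial (N + k) t - wpartial N t) <= D ^+ 2 * (gamma%:R ^+ N)^-1.
Proof.
rewrite -wcoef_sqr wcoefE -exprMn -(sqr_sqrtr (nsq_ge0 _)) -normcE_nsq.
rewrite ler_pXn2r ?nnegrE.
- exact: wpartial_dist.
- by [].
- by rewrite normcE_nsq sqrtr_ge0.
- by rewrite mulr_ge0 // exprn_ge0.
Qed.

Let steps (f : R[i] -> R) : (forall z w, f (z - w) = f z - f w) ->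
  (forall z, f z ^+ 2 <= nsq z) -> forall t, cvgn (fun N => f (wpartial N t)).
Proof.
move=> fB fle t; apply: (@cvg_of_geometric_steps _ _ (D ^+ 2)) => N.
rewrite -fB; apply: le_trans (fle _) _; rewrite -addn1.
apply: le_trans (nsq_wpartial_dist N 1 t) _.
rewrite ler_wpM2l ?sqr_ge0 // exprVn lef_pV2 ?posrE ?exprn_gt0 //.
by rewrite lerXn2r ?nnegrE ?ler0n // ler_nat.
Qed.

(** The [limn] in [weierstrass] is a genuine limit, because the partial sums have geometrically
    small increments. *)
Lemma weierstrass_cvg t : (fun N => complex.Re (wpartial N t)) @ \oo -->
    complex.Re (weierstrass 2^-1 gamma c t) /\
  (fun N => complex.Im (wpartial N t)) @ \oo -->
    complex.Im (weierstrass 2^-1 gamma c t).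
Proof.
have cR : cvgn (fun N => complex.Re (wpartial N t)).
  apply: (steps (f := @complex.Re R)) => [z w|z]; first by rewrite ReD ReN.
  by rewrite lerDl sqr_ge0.
have cI : cvgn (fun N => complex.Im (wpartial N t)).
  apply: (steps (f := @complex.Im R)) => [z w|z]; first by rewrite ImD ImN.
  by rewrite lerDr sqr_ge0.
have h := cvg_complexP cR cI.
suff -> : weierstrass 2^-1 gamma c t =
  limn (fun N => complex.Re (wpartial N t)) +i* limn (fun N => complex.Im (wpartial N t)).
  by split; [exact: cR | exact: cI].
rewrite /weierstrass.
set s := series _.
have sE : (s : nat -> R[i]^o) = (fun N => 2^-1 * wpartial N t).
  apply/funext => N; rewrite /s /series /= /wpartial mulr_sumr.
  by apply: eq_bigr => n _; rewrite /wcoef !mulrA mulVf // mul1r.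
have h2 : (s : nat -> R[i]^o) @ \oo -->
    (2^-1 * (limn (fun N => complex.Re (wpartial N t)) +i*
             limn (fun N => complex.Im (wpartial N t))) : R[i]^o).
  by rewrite sE; exact: cvg_scale h.
by rewrite (cvg_lim (@norm_hausdorff _ _) h2) mulrA mulfV // mul1r.
Qed.

Lemma weierstrass_tail N t :
  nsq (weierstrass 2^-1 gamma c t - wpartial N t) <= D ^+ 2 * (gamma%:R ^+ N)^-1.
Proof.
have [cR cI] := weierstrass_cvg t.
set W := weierstrass _ _ _ _ in cR cI *.
have h : (fun k => nsq (wpartial (N + k)%N t - wpartial N t)) @ \oo --> nsq (W - wpartial N t).
  rewrite (_ : (fun k => _) = fun k =>
    (complex.Re (wpartial (N + k)%N t) - complex.Re (wpartial N t)) ^+ 2 +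
    (complex.Im (wpartial (N + k)%N t) - complex.Im (wpartial N t)) ^+ 2); last first.
    by apply/funext => k; rewrite /nsq ReD ImD ReN ImN.
  have -> : nsq (W - wpartial N t) = (complex.Re W - complex.Re (wpartial N t)) ^+ 2 +
        (complex.Im W - complex.Im (wpartial N t)) ^+ 2 by rewrite /nsq ReD ImD ReN ImN.
  have sh (a : nat -> R) (l b : R) : a @ \oo --> l ->
      (fun k => (a (N + k)%N - b) ^+ 2) @ \oo --> (l - b) ^+ 2.
    move=> al; have al' : (fun k => a (N + k)%N) @ \oo --> l.
      rewrite (_ : (fun k => a (N + k)%N) = [sequence a (n + N)%N]_n).
        by rewrite cvg_shiftn.
      by apply/funext => k /=; rewrite addnC.
    by apply: cvgM; apply: cvgB => //; exact: cvg_cst.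
  by apply: cvgD; [exact: (sh (fun N => complex.Re (wpartial N t)))
    | exact: (sh (fun N => complex.Im (wpartial N t)))].
apply: (@ler_cvg_to _ _ _ _ _ (fun=> D ^+ 2 * (gamma%:R ^+ N)^-1) _ _ h (cvg_cst _)).
by apply: nearW => k; exact: nsq_wpartial_dist.
Qed.

Lemma wpartial_measurable N :
  measurable_fun [set: T] (fun t => complex.Re (wpartial N t)) /\
  measurable_fun [set: T] (fun t => complex.Im (wpartial N t)).
Proof.
have mcos n : measurable_fun [set: T] (fun t : T => cos ((gamma ^ n)%:R * t)).
  exact: continuous_measurable_fun (@continuous_cos_int R (gamma ^ n)%N).
split.
- rewrite (_ : (fun t => _) = fun t => \sum_(0 <= n < N)
    complex.Re (2 * (wcoef n)%:C * c n) * cos ((gamma ^ n)%:R * t)).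
    by apply: measurable_sum => n; apply: measurable_funM.
  apply/funext => t; rewrite Re_sum; apply: eq_bigr => n _.
  by case: (2 * _ * c n) => a b /=; ring.
- rewrite (_ : (fun t => _) = fun t => \sum_(0 <= n < N)
    complex.Im (2 * (wcoef n)%:C * c n) * cos ((gamma ^ n)%:R * t)).
    by apply: measurable_sum => n; apply: measurable_funM.
  apply/funext => t; rewrite Im_sum; apply: eq_bigr => n _.
  by case: (2 * _ * c n) => a b /=; ring.
Qed.

Lemma weierstrass_multiplier : exists2 B : R, 0 <= B & forall N,
  [/\ bounded_multiplier (wpartial N) B,
      bounded_multiplier (fun t => weierstrass 2^-1 gamma c t - wpartial N t)
        (B * (gamma%:R ^+ N)^-1) &
      bounded_multiplier (weierstrass 2^-1 gamma c) B].
Proof.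
exists (D ^+ 2) => [|N]; first exact: sqr_ge0.
have [mR mI] := wpartial_measurable N.
have mW : measurable_fun [set: T] (fun t => complex.Re (weierstrass 2^-1 gamma c t)) /\
    measurable_fun [set: T] (fun t => complex.Im (weierstrass 2^-1 gamma c t)).
  split.
  - apply: (measurable_fun_cvg (h := fun N t => complex.Re (wpartial N t))) => [k|t _].
      by case: (wpartial_measurable k).
    by case: (weierstrass_cvg t).
  - apply: (measurable_fun_cvg (h := fun N t => complex.Im (wpartial N t))) => [k|t _].
      by case: (wpartial_measurable k).
    by case: (weierstrass_cvg t).
case: mW => mWR mWI.
have w0 t : wpartial 0 t = 0 by rewrite /wpartial big_geq.
split; split=> //.
- move=> t; have := nsq_wpartial_dist 0 N t.
  by rewrite w0 subr0 expr0 invr1 mulr1 add0n.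
- by under eq_fun do rewrite ReD ReN; exact: measurable_funB.
- by under eq_fun do rewrite ImD ImN; exact: measurable_funB.
- by move=> t; exact: weierstrass_tail.
- move=> t; have := weierstrass_tail 0 t.
  by rewrite w0 subr0 expr0 invr1 mulr1.
Qed.

End Weierstrass.

(** * The commutator with a Weierstrass function in the Fourier basis *)

Section WeierstrassCommutator.
Context (R : realType) (P : L2S1 R -> L2S1 R) (hP : is_szego P).
Variables (gamma : nat).
Hypothesis gamma1 : (1 < gamma)%N.
Local Notation ip := (@L2inner R).
Local Notation N2 := (qf ip).
Implicit Types (x y : L2S1 R) (l m : int) (c : nat -> R[i]) (N n : nat).

Let ipP : inner_product ip := @L2_inner_product R.
Let sd : semidef ip := ipP.1.
Let gpow n : (0 < gamma ^ n)%N. Proof. by rewrite expn_gt0 ltnW. Qed.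

Local Notation wp := (wpartial gamma).
Local Notation KN c N := (commutator P (wp c N)).

(** With [m = gamma^n], the commutator [[P, z^m + z^-m]] sends [z^l] to [dcoef n l] times
    [z^(dshift n l)]. *)
Definition dcoef n l : R := if (0 <= l)%R then (if (l < (gamma ^ n)%N%:Z)%R then -1 else 0)
  else (if (- (gamma ^ n)%N%:Z <= l)%R then 1 else 0).

Definition dshift n l : int :=
  if (0 <= l)%R then l - (gamma ^ n)%N%:Z else l + (gamma ^ n)%N%:Z.

Definition in_block N l : bool := (- (gamma ^ N)%N%:Z <= l < (gamma ^ N)%N%:Z)%R.

Lemma dcoefE n l : dcoef n l ^+ 2 = (in_block n l)%:R.
Proof.
rewrite /dcoef /in_block; have := gpow n; set g := (gamma ^ n)%N => g0.
case: (boolP (0 <= l)%R) => l0.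
  have -> : (- g%:Z <= l)%R by lia.
  by rewrite andTb; case: ifP; rewrite ?sqrrN ?expr1n ?expr0n.
have -> : (l < g%:Z)%R by lia.
by rewrite andbT; case: ifP; rewrite ?expr1n ?expr0n.
Qed.

Lemma dcoef_out n N l : (n <= N)%N -> ~~ in_block N l -> dcoef n l = 0.
Proof.
move=> nN; have := dcoefE n l.
have : (gamma ^ n <= gamma ^ N)%N by rewrite leq_exp2l.
have := gpow n; rewrite /in_block; set g := (gamma ^ n)%N; set h := (gamma ^ N)%N.
move=> g0 gh h1 h2; apply/eqP; rewrite -sqrf_eq0 h1.
suff -> : (- g%:Z <= l < g%:Z)%R = false by [].
by apply/negP => h3; move/negP: h2; apply; lia.
Qed.

Lemma dshift_in n N l : (n <= N)%N -> dcoef n l != 0 -> in_block N (dshift n l).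
Proof.
move=> nN; rewrite -sqrf_eq0 dcoefE.
have : (gamma ^ n <= gamma ^ N)%N by rewrite leq_exp2l.
have := gpow n; rewrite /in_block /dshift.
set g := (gamma ^ n)%N; set h := (gamma ^ N)%N => g0 gh.
case: (boolP (- g%:Z <= l < g%:Z)%R) => [hl _|_]; last by rewrite eqxx.
by case: ifP => l0; lia.
Qed.

(** Different terms of the series thus send a given [z^l] to orthogonal vectors, which rules out
    cross terms in the Hilbert-Schmidt norm. *)
Lemma dshift_inj l : injective (dshift^~ l).
Proof.
move=> n n'; rewrite /dshift => h; apply/eqP.
rewrite -(@eqn_exp2l gamma) //; apply/eqP.
by move: h; case: ifP => _; lia.
Qed.

Definition block_basis N j : L2S1 R := ez R (j%:Z - (gamma ^ N)%N%:Z).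

Lemma block_basis_orthonormal N n : orthonormal_fam ip n (block_basis N).
Proof.
move=> i j _ _; rewrite ip_ez; congr (_%:R); apply: congr1.
by apply/eqP/eqP => [|->//]; lia.
Qed.

Lemma in_blockP N l : in_block N l ->
  exists2 j, (j < 2 * gamma ^ N)%N & ez R l = block_basis N j.
Proof.
rewrite /in_block => h; exists (absz (l + (gamma ^ N)%N%:Z)%R); first by lia.
by congr ez; lia.
Qed.

Lemma block_basis_in N j : (j < 2 * gamma ^ N)%N ->
  in_block N (j%:Z - (gamma ^ N)%N%:Z).
Proof. by rewrite /in_block; lia. Qed.

Section Coefficients.
Variables (c : nat -> R[i]) (M : R).
Hypothesis cM : forall n, nsq (c n) <= M.

Let wpB N : exists B, bounded_multiplier (wp c N) B.
Proof.
have [B _ h] := weierstrass_multiplier gamma1 cM.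
by exists B; case: (h N).
Qed.

Definition beta n : R[i] := (wcoef R gamma n)%:C * c n.

Lemma nsq_beta n : nsq (beta n) = (gamma%:R ^+ n)^-1 * nsq (c n).
Proof. by rewrite nsqM nsqR wcoef_sqr. Qed.

Lemma wpartialS N : wp c N.+1 = fun t => 1 * wp c N t +
  (beta N * etz (gamma ^ N)%N%:Z t + (beta N * etz (- (gamma ^ N)%N%:Z) t + 0)).
Proof.
apply/funext => t; rewrite /wpartial big_nat_recr //= mul1r; congr (_ + _).
rewrite addr0 -mulrDr -etzJ.
have -> : etz (gamma ^ N)%N%:Z t + conjc (etz (gamma ^ N)%N%:Z t) =
    2 * (cos ((gamma ^ N)%:R * t))%:C.
  by apply/eqP; rewrite eq_complex /=; apply/andP; split; apply/eqP; ring.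
by rewrite /beta; ring.
Qed.

Lemma partial_zpow N l : KN c N (zpow R l) =
  \sum_(n < N) (beta n * (dcoef n l)%:C) *: zpow R (dshift n l).
Proof.
have b0 : bounded_multiplier (fun=> 0 : R[i]) 0.
  by split=> [||t]; rewrite ?nsq0 //; exact: measurable_cst.
have K0 u : commutator P (fun=> 0) u = 0.
  have := commutatorZD hP (-1) u b0 b0.
  rewrite (_ : (fun _ : R => -1 * 0 + 0 : R[i]) = fun=> 0); last first.
    by apply/funext => t; rewrite mulr0 addr0.
  by rewrite scaleN1r addNr.
elim: N => [|N ih].
  rewrite big_ord0 (_ : wp c 0 = fun=> 0) //.
  by apply/funext => t; rewrite /wpartial big_geq.
have [B bB] := wpB N.
have be m := bounded_multiplier_etz R m.
have b1 := (L2mulZD (beta N) (zpow R l) (be (- (gamma ^ N)%N%:Z)) b0).1.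
have b2 := (L2mulZD (beta N) (zpow R l) (be (gamma ^ N)%N%:Z) b1).1.
rewrite wpartialS (commutatorZD hP 1 _ bB b2) (commutatorZD hP _ _ (be _) b1).
rewrite (commutatorZD hP _ _ (be _) b0) K0 addr0 scale1r ih big_ord_recr /=.
congr (_ + _); rewrite !(commutator_zpow hP) /dcoef /dshift.
have := gpow N; set g := (gamma ^ N)%N => g0.
case: (boolP (0 <= l)%R) => l0.
  have -> : (0 <= l + g%:Z)%R by lia.
  rewrite subrr scale0r scaler0 add0r scalerA.
  have -> : (0 <= l - g%:Z)%R = ~~ (l < g%:Z)%R by lia.
  case: (l < g%:Z)%R; last by rewrite subrr rmorph0 !mulr0.
  by congr (_ *: _); rewrite sub0r rmorphN /= rmorph1.
have -> : (0 <= l - g%:Z)%R = false by lia.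
rewrite [X in X *: zpow R (l - _)]subrr scale0r scaler0 addr0 subr0 scalerA.
have -> : (0 <= l + g%:Z)%R = (- g%:Z <= l)%R by lia.
by case: (- g%:Z <= l)%R; rewrite /= ?rmorph1 ?rmorph0.
Qed.

Lemma partial_ez N l : KN c N (ez R l) =
  \sum_(n < N) (beta n * (dcoef n l)%:C) *: ez R (dshift n l).
Proof.
have [B bB] := wpB N; rewrite (linZ (commutator_linear hP bB)) partial_zpow.
rewrite scaler_sumr; apply: eq_bigr => n _; rewrite /ez !scalerA.
by congr (_ *: _); rewrite mulrC.
Qed.

Lemma partial_ez_out N l : ~~ in_block N l -> KN c N (ez R l) = 0.
Proof.
move=> lN; rewrite partial_ez big1 // => n _.
by rewrite (dcoef_out (ltnW (ltn_ord n)) lN) mulr0 scale0r.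
Qed.

Lemma N2_partial_ez N l :
  N2 (KN c N (ez R l)) = \sum_(n < N) nsq (beta n) * (in_block n l)%:R.
Proof.
rewrite partial_ez (N2_comb ipP (v := fun n => ez R (dshift n l))
   _ (fun n => beta n * (dcoef n l)%:C)).
  by apply: eq_bigr => n _; rewrite nsqM nsqR dcoefE.
by move=> i j _ _; rewrite ip_ez (inj_eq (@dshift_inj l)).
Qed.

Lemma block_count n N : (n <= N)%N ->
  \sum_(j < 2 * gamma ^ N) (in_block n (j%:Z - (gamma ^ N)%N%:Z))%:R =
  2 * gamma%:R ^+ n :> R.
Proof.
move=> nN; have gh : (gamma ^ n <= gamma ^ N)%N by rewrite leq_exp2l.
rewrite /in_block -natrX -natrM.
set g := (gamma ^ n)%N in gh *; set h := (gamma ^ N)%N in gh *.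
rewrite -(big_mkord xpredT (fun j => ((- g%:Z <= j%:Z - h%:Z < g%:Z)%R)%:R : R)).
rewrite (@big_cat_nat _ _ _ (h - g)%N) //=; last by lia.
rewrite (@big_cat_nat _ _ _ (h + g)%N _ (2 * h)%N) //=; [|lia|lia].
rewrite big_nat big1 ?add0r => [|j hj]; last first.
  by rewrite (_ : (- g%:Z <= j%:Z - h%:Z < g%:Z)%R = false) //; lia.
rewrite [X in _ + X]big_nat [X in _ + X]big1 ?addr0 => [|j hj]; last first.
  by rewrite (_ : (- g%:Z <= j%:Z - h%:Z < g%:Z)%R = false) //; lia.
rewrite (eq_big_nat _ _ (F2 := fun=> 1)) => [|j hj]; last first.
  by rewrite (_ : (- g%:Z <= j%:Z - h%:Z < g%:Z)%R = true) //; lia.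
by rewrite sumr_const_nat; congr (_%:R); lia.
Qed.

(** The term of index [n] acts on [2 gamma^n] basis vectors, each time with squared coefficient
    [gamma^-n |c n|^2]. *)
Lemma partial_hilbert_schmidt N :
  \sum_(j < 2 * gamma ^ N) N2 (KN c N (block_basis N j)) =
  2 * \sum_(n < N) nsq (c n).
Proof.
rewrite (eq_bigr _ (fun (j : 'I__) _ => N2_partial_ez N _)) exchange_big /=.
rewrite mulr_sumr; apply: eq_bigr => n _.
rewrite -mulr_sumr block_count ?(ltnW (ltn_ord n)) // nsq_beta.
by field; rewrite expf_neq0 // pnatr_eq0 -lt0n ltnW.
Qed.

End Coefficients.

Lemma wpartialJ c N t : conjc (wp c N t) = wp (fun n => conjc (c n)) N t.
Proof.
rewrite /wpartial conjc_sum; apply: eq_bigr => n _.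
rewrite !conjcM !conjc_real; congr (_ * _ * _ * _).
have -> : (2 : R[i]) = (2 : R)%:C by rewrite rmorphMn /= rmorph1.
exact: conjc_real.
Qed.

Section Coefficients2.
Variables (c : nat -> R[i]) (M : R).
Hypothesis cM : forall n, nsq (c n) <= M.
Let cM' n : nsq (conjc (c n)) <= M. Proof. by rewrite nsqJ. Qed.

Local Notation W := (weierstrass 2^-1 gamma c).
Local Notation K := (commutator P W).
Local Notation KT N := (commutator P (fun t => W t - wp c N t)).

Lemma partial_adj N x y : ip (KN c N x) y = - ip x (KN (fun n => conjc (c n)) N y).
Proof.
have [B _ h] := weierstrass_multiplier gamma1 cM; have [bB _ _] := h N.
rewrite (commutator_adj hP bB); congr (- ip x (commutator P _ y)).
by apply/funext => t; exact: wpartialJ.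
Qed.

(** The image is tested against all [z^m] by means of the adjoint, which maps each of them into the
    span of the block; a vector orthogonal to all [z^m] is 0. *)
Lemma partial_perp N x :
  (forall j, (j < 2 * gamma ^ N)%N -> ip x (block_basis N j) = 0) -> KN c N x = 0.
Proof.
move=> xp; apply: L2_total_ez => m; rewrite partial_adj (partial_ez cM').
rewrite (sform_sumr sd) big1 ?oppr0 // => n _; rewrite (sformZr sd).
have [->|d0] := eqVneq (dcoef n m) 0; first by rewrite mulr0 rmorph0 mul0r.
have [j jN ->] := in_blockP (dshift_in (ltnW (ltn_ord n)) d0).
by rewrite xp // mulr0.
Qed.

(** Parseval within the block: the adjoint kills the basis vectors outside it, so the range is
    orthogonal to them, and totality of the basis shows that the residual of the projection is 0. *)
Lemma partial_range N y :
  N2 (KN c N y) = \sum_(j < 2 * gamma ^ N) nsq (ip (KN c N y) (block_basis N j)).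
Proof.
set z := KN c N y; have go := @block_basis_orthonormal N (2 * gamma ^ N).
have := N2_proj ipP go z; set p := orth_proj _ _ _ _.
suff -> : z - p = 0 by rewrite (qf0 sd) addr0.
apply: L2_total_ez => m; have [mN|mN] := boolP (in_block N m).
  have [j jN ->] := in_blockP mN; exact: (orth_proj_perp ipP go).
rewrite (sformDl sd) (sformNl sd) partial_adj (partial_ez_out cM') //.
rewrite (sform0r sd) oppr0 add0r /p /orth_proj (sform_suml sd) big1 ?oppr0 //.
move=> j _; rewrite (sformZl sd) ip_ez.
case: eqP => [jm|]; last by rewrite mulr0.
by move/negP: mN; rewrite -jm; case; exact: block_basis_in.
Qed.

Lemma commutator_split N x : K x = KN c N x + KT N x.
Proof.
have [B _ h] := weierstrass_multiplier gamma1 cM; have [b1 b2 _] := h N.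
have := commutatorZD hP 1 x b1 b2; rewrite scale1r => <-.
by congr (commutator P _ x); apply/funext => t; rewrite mul1r addrC subrK.
Qed.

Lemma commutator_bounds : exists2 B : R, 0 <= B &
  [/\ linear K, forall x, N2 (K x) <= B * N2 x &
     forall N, [/\ linear (KN c N), linear (KT N) &
       forall x, N2 (KT N x) <= B * (gamma%:R ^+ N)^-1 * N2 x]].
Proof.
have [B B0 h] := weierstrass_multiplier gamma1 cM.
exists (4 * B); first by rewrite mulr_ge0.
split=> [|x|N].
- by have [_ _ b] := h 0%N; exact: (commutator_linear hP b).
- by have [_ _ b] := h 0%N; exact: (N2_commutator hP b).
- have [b1 b2 _] := h N; split; [exact: (commutator_linear hP b1)|
    exact: (commutator_linear hP b2)|move=> x].
  by rewrite -(mulrA 4); exact: (N2_commutator hP b2).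
Qed.

Section Square.
Variable s : R[i].
Hypothesis s1 : nsq s = 1.
(** The unimodular factor covers both [K^2] and, for real coefficients, the positive operator
    [- K^2]. *)
Let T x := s *: K (K x).

Lemma square_linear : linear T.
Proof.
have [B _ [linK _ _]] := commutator_bounds.
by move=> a u v; rewrite /T !linK scalerDr !scalerA mulrC.
Qed.

Lemma square_compact : compact_operator ip T.
Proof.
have [B B0 [linK bK bN]] := commutator_bounds.
have N2T x : N2 (T x) <= B * N2 (K x) by rewrite (qfZ sd) s1 mul1r.
apply: (compact_of_tails ipP (@L2_complete R) square_linear (mulr_ge0 B0 B0)).
  by move=> x; apply: le_trans (N2T x) _; rewrite -mulrA ler_wpM2l.
move=> e e0; pose N := (Num.truncn (B * B / e)).+1.
exists (2 * gamma ^ N)%N, (block_basis N); split.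
  exact: block_basis_orthonormal.
move=> x xp; apply: le_trans (N2T x) _.
rewrite (commutator_split N) partial_perp // add0r.
have [_ _ hT] := bN N; apply: le_trans (ler_wpM2l B0 (hT x)) _.
rewrite !mulrA ler_wpM2r ?qf_ge0 //.
rewrite ler_pdivrMr; last by rewrite exprn_gt0 // ltr0n ltnW.
rewrite -ler_pdivrMl // mulrC; apply: ltW; apply: lt_trans (truncnS_gt _) _.
by rewrite -natrX ltr_nat ltn_expl.
Qed.

(** If both [x] and [K x] are orthogonal to the block, then [K^2 x] is the square of the tail
    applied to [x]; these are [4 gamma^N] linear conditions. The tail has norm [O(gamma^(-N/2))], so
    replacing only one factor by it would lose half of the decay. *)
Lemma square_sv_le : exists2 B : R, 0 <= B & (forall k, singular_value ip T k <= B) /\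
  forall N k, (4 * gamma ^ N <= k)%N ->
    singular_value ip T k <= B * (gamma%:R ^+ N)^-1.
Proof.
have [B B0 [linK bK bN]] := commutator_bounds; exists B => //; split.
  move=> k; apply: (@sv_le _ _ _ ipP T k 0 B (fun _ _ => 0)) => //.
  - exact: square_linear.
  - by case.
  - move=> x _; rewrite (qfZ sd) s1 mul1r expr2 -mulrA.
    by apply: le_trans (bK _) _; rewrite ler_wpM2l.
move=> N k hk; have [linN linT hT] := bN N.
have g0 : 0 < gamma%:R ^+ N :> R by rewrite exprn_gt0 // ltr0n ltnW.
pose phi (j : 'I_(2 * gamma ^ N + 2 * gamma ^ N)) x :=
  match fintype.split j with
  | inl i => ip x (block_basis N i)
  | inr i => ip (KT N x) (block_basis N i)
  end.
apply: (@sv_le _ _ _ ipP T k _ _ phi) => //.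
- exact: square_linear.
- by apply: leq_trans hk; lia.
- move=> j; rewrite /phi; case: (fintype.split j) => i a u v; first exact: (sform_linl sd).
  by rewrite (linT a u v); exact: (sform_linl sd).
- by rewrite mulr_ge0 // invr_ge0 ltW.
move=> x xp; have x1 i : (i < 2 * gamma ^ N)%N -> ip x (block_basis N i) = 0.
  move=> hi; have := xp (lshift _ (Ordinal hi)); rewrite /phi.
  by case: split_ordP => [j /lshift_inj <- //|j /eqP]; rewrite eq_lrshift.
have x2 i : (i < 2 * gamma ^ N)%N -> ip (KT N x) (block_basis N i) = 0.
  move=> hi; have := xp (rshift _ (Ordinal hi)); rewrite /phi.
  by case: split_ordP => [j /eqP|j /rshift_inj <- //]; rewrite eq_rlshift.
rewrite (qfZ sd) s1 mul1r (commutator_split N x) partial_perp // add0r.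
rewrite (commutator_split N) partial_perp // add0r expr2 -mulrA.
apply: le_trans (hT _) _; rewrite ler_wpM2l // mulr_ge0 // invr_ge0 ltW //.
Qed.

Lemma square_weakL1 : weakL1 ip T.
Proof.
split; first exact: square_compact.
have [B B0 [h0 hN]] := square_sv_le.
(* If [4 gamma^N <= k < 4 gamma^(N+1)], then [gamma^-N <= 4 gamma / (1 + k)]. For [k < 4] there is
   no such [N], and the uniform bound [B] is enough. *)
exists (B * (4 * gamma%:R)) => k.
have k1 : 0 < (1 + k)%:R :> R by rewrite ltr0n.
have [k4|k4] := ltnP k 4.
  apply: le_trans (h0 k) _; rewrite ler_pdivlMr // ler_wpM2l //.
  by rewrite -natrM ler_nat; lia.
have kd : (0 < k %/ 4)%N by rewrite divn_gt0.
have /andP[lo up] := trunc_log_bounds gamma1 kd.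
set N := trunc_log gamma (k %/ 4) in lo up.
have g0 : 0 < gamma%:R ^+ N :> R by rewrite exprn_gt0 // ltr0n ltnW.
apply: le_trans (hN N k _) _.
  by apply: leq_trans (leq_divM k 4); rewrite mulnC leq_mul2r lo orbT.
rewrite -mulrA ler_wpM2l // ler_pdivlMr // mulrC ler_pdivrMr // -natrX -!natrM ler_nat.
rewrite -mulnA -expnS.
have := ltn_pmod k (isT : (0 < 4)%N); have := divn_eq k 4; lia.
Qed.

End Square.
End Coefficients2.
End WeierstrassCommutator.

(** * Asymptotics of the traces *)

Section RealCoefficients.
Context (R : realType) (P : L2S1 R -> L2S1 R) (hP : is_szego P).
Variables (gamma : nat) (r : nat -> R) (M : R).
Hypotheses (gamma1 : (1 < gamma)%N) (rM : forall n, r n ^+ 2 <= M).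
Local Notation ip := (@L2inner R).
Local Notation N2 := (qf ip).
Local Notation c := (fun n => (r n)%:C : R[i]).
Local Notation W := (weierstrass 2^-1 gamma c).
Local Notation K := (commutator P W).
Local Notation KN N := (commutator P (wpartial gamma c N)).

Let ipP : inner_product ip := @L2_inner_product R.
Let sd : semidef ip := ipP.1.
Let cM n : nsq (c n) <= M. Proof. by rewrite nsqR. Qed.
Let M0 : 0 <= M. Proof. by apply: le_trans (rM 0%N); exact: sqr_ge0. Qed.
Let nsqN1 : nsq (-1 : R[i]) = 1. Proof. by rewrite nsqN nsq1. Qed.

Definition neg_square x : L2S1 R := -1 *: K (K x).

Let Kadj x y : ip (K x) y = - ip x (K y).
Proof.
have [B _ h] := weierstrass_multiplier gamma1 cM; have [_ _ bB] := h 0%N.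
rewrite (commutator_adj hP bB); congr (- ip x (commutator P _ y)).
apply/funext => t.
suff im0 : complex.Im (W t) = 0 by move: im0; case: (W t) => ? ? /= ->; rewrite oppr0.
have [_ cI] := weierstrass_cvg gamma1 cM t.
have im0 N : complex.Im (wpartial gamma c N t) = 0.
  have := wpartialJ gamma c N t.
  rewrite (_ : (fun n => conjc (c n)) = c); last by apply/funext => n; rewrite conjc_real.
  by case: (wpartial _ _ _ _) => ? ? /= [h2]; lra.
rewrite (_ : (fun N => _) = fun=> 0) in cI; last by apply/funext => N; exact: im0.
by have := cvg_lim (@Rhausdorff _) cI; rewrite lim_cst // => <-.
Qed.

Lemma neg_square_pos : pos_weakL1 ip neg_square.
Proof.
split; first exact: (square_weakL1 hP gamma1 cM nsqN1).
by move=> x; rewrite (sformZl sd) Kadj mulN1r opprK; case: sd => _ _; apply.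
Qed.

Let fA x y := ip (neg_square x) y.

Let qf_neg_square x : qf fA x = N2 (K x).
Proof. by rewrite /qf /fA (sformZl sd) Kadj mulN1r opprK. Qed.

Local Notation X n := (\sum_(k < n) singular_value ip neg_square k).
Local Notation S N := (\sum_(n < N) r n ^+ 2).

(** Both bounds compare [K] with [K_N] on an orthonormal family. The upper one uses the eigenvectors
    of [- K^2], on which Bessel's inequality bounds the share of [K_N] by its Hilbert-Schmidt norm.
    The lower one applies the maximum principle to the block basis, on which this norm is
    attained. *)
Lemma trace_bounds : exists2 B : R, 0 <= B & forall e n N, 0 < e ->
  X n <= (1 + e) * (2 * S N) + (1 + e^-1) * (n%:R * (B * (gamma%:R ^+ N)^-1)) /\
  2 * S N <= (1 + e) * X (2 * gamma ^ N)%N + (1 + e^-1) * (2 * B).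
Proof.
have [B B0 [linK bK bN]] := commutator_bounds hP gamma1 cM; exists B => //.
move=> e n N e0; have [linN linT hT] := bN N.
have g0 : 0 < gamma%:R ^+ N :> R by rewrite exprn_gt0 // ltr0n ltnW.
have [[cA _] pA] := neg_square_pos.
have [v [vo vX _ up]] := ky_fan ipP (@L2_infdim R) cA pA.
have go := @block_basis_orthonormal R gamma gamma1 N (2 * gamma ^ N).
have HS : \sum_(j < 2 * gamma ^ N) N2 (KN N (block_basis R gamma N j)) = 2 * S N.
  rewrite (partial_hilbert_schmidt hP gamma1 cM).
  by congr (2 * _); apply: eq_bigr => i _; rewrite nsqR.
have N2v f m j : orthonormal_fam ip m f -> (j < m)%N -> N2 (f j) = 1.
  by move=> fo jm; rewrite /qf fo // eqxx.
have von : orthonormal_fam ip n v by move=> i j _ _; exact: vo.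
have e1 : 0 <= 1 + e^-1 by rewrite addr_ge0 // invr_ge0 ltW.
have e2 : 0 <= 1 + e by rewrite addr_ge0 // ltW.
split.
- rewrite vX; apply: (@le_trans _ _ (\sum_(k < n) ((1 + e) * N2 (KN N (v k)) +
      (1 + e^-1) * (B * (gamma%:R ^+ N)^-1)))).
    apply: ler_sum => k _; rewrite -[leLHS]/(qf fA (v k)) qf_neg_square.
    rewrite (commutator_split hP gamma1 cM N); apply: le_trans (qfD_eps sd _ _ e0) _.
    rewrite lerD2l ler_wpM2l //; apply: le_trans (hT _) _.
    by rewrite (N2v _ _ _ von) ?mulr1.
  rewrite big_split /= sumr_const card_ord -!mulr_sumr -HS.
  rewrite -[Z in _ + Z <= _]mulr_natl [Z in _ + Z <= _]mulrCA lerD2r ler_wpM2l //.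
  apply: (@le_trans _ _ (\sum_(k < n) \sum_(j < 2 * gamma ^ N)
      nsq (ip (v k) (KN N (block_basis R gamma N j))))).
    apply: ler_sum => k _; rewrite (partial_range hP gamma1 cM).
    apply: ler_sum => j _; rewrite (partial_adj hP gamma1 cM) nsqN.
    rewrite (_ : (fun n => conjc (c n)) = c) //.
    by apply/funext => i; rewrite conjc_real.
  rewrite exchange_big /=; apply: ler_sum => j _.
  have := bessel ipP von (KN N (block_basis R gamma N j)).
  by apply: le_trans; apply: ler_sum => k _; rewrite (sformC sd) nsqJ.
- rewrite -HS; apply: (@le_trans _ _ (\sum_(j < 2 * gamma ^ N)
    ((1 + e) * qf fA (block_basis R gamma N j) + (1 + e^-1) * (B * (gamma%:R ^+ N)^-1)))).
    apply: ler_sum => j _; rewrite qf_neg_square.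
    set z := block_basis _ _ _ _.
    have zE : KN N z = K z + - commutator P (fun t => W t - wpartial gamma c N t) z.
      by rewrite (commutator_split hP gamma1 cM N) addrK.
    rewrite {1}zE; apply: le_trans (qfD_eps sd _ _ e0) _.
    rewrite (qfN sd) lerD2l ler_wpM2l //; apply: le_trans (hT _) _.
    by rewrite (N2v _ _ _ go) ?mulr1.
  rewrite big_split /= sumr_const card_ord -!mulr_sumr -[Z in _ + Z <= _]mulr_natl.
  rewrite lerD //; first by rewrite ler_wpM2l // (up _ _ go).
  rewrite mulrCA ler_wpM2l // natrM natrX.
  by rewrite le_eqVlt; apply/orP; left; apply/eqP; field; rewrite gt_eqF.
Qed.

Let SM N : 0 <= S N <= N%:R * M.
Proof.
apply/andP; split; first by apply: sumr_ge0 => i _; exact: sqr_ge0.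
rewrite mulr_natl -[Z in M *+ Z]card_ord -sumr_const.
by apply: ler_sum => i _.
Qed.

Let X_le m n : (m <= n)%N -> X m <= X n.
Proof.
move=> mn; rewrite (big_ord_widen _ (fun k => singular_value ip neg_square k) mn).
by rewrite big_mkcond; apply: ler_sum => k _; case: ifP => // _; exact: sv_ge0.
Qed.

Lemma trace_asymptotics e : 0 < e -> exists C : R, forall N, (gamma <= N)%N ->
  `|X N.+1 - 2 * S (trunc_log gamma N).+1| <= e * (trunc_log gamma N)%:R + C.
Proof.
move=> e0; have [B B0 hB] := trace_bounds.
(* The errors below are at most [8 d M L] plus a constant, for [L] the logarithm of [N]; adding 1
   covers [M = 0]. *)
pose d := e / (8 * M + 1).
have D0 : 0 < 8 * M + 1 by rewrite ltr_wpDl // mulr_ge0.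
have d0 : 0 < d by rewrite divr_gt0.
have dE : d * (8 * M + 1) = e by rewrite /d divfK ?gt_eqF.
have id0 : 0 <= d^-1 by rewrite invr_ge0 ltW.
exists (2 * ((1 + d^-1) * B) + 4 * M + 2 * d * B + 1) => N gN.
have N0 : (0 < N)%N by apply: leq_trans gN; exact: ltnW.
have /andP[lo up] := trunc_log_bounds gamma1 N0.
have L1 : (0 < trunc_log gamma N)%N by rewrite -(trunc_lognn gamma1) leq_trunc_log.
move: lo up L1; set L := trunc_log gamma N => lo up L1.
have idB : 0 <= (1 + d^-1) * B by rewrite mulr_ge0 // addr_ge0.
have L1R : (1 : R) <= L%:R by rewrite ler1n.
have /andP[S0 SM1] := SM L.+1.
rewrite -natr1 in SM1.
have LM : M <= L%:R * M by rewrite ler_peMl.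
(* As [N + 1 <= gamma^(L+1)], the tail after [L + 1] terms contributes at most [(1 + 1/f) B]. The
   choice [f = d] gives the upper bound; [f = 1] gives an a priori bound on [X N.+1], which controls
   [d * X N.+1] in the lower one. *)
have upb f : 0 < f -> X N.+1 <= (1 + f) * (2 * S L.+1) + (1 + f^-1) * B.
  move=> f0; have [h _] := hB f N.+1 L.+1 f0; apply: le_trans h _.
  rewrite lerD2l ler_wpM2l //; first by rewrite addr_ge0 // invr_ge0 ltW.
  rewrite mulrCA ler_piMr // ler_pdivrMr ?exprn_gt0 ?ltr0n ?(ltnW gamma1) //.
  by rewrite mul1r -natrX ler_nat.
have h1 := upb _ d0; have h2 := upb _ ltr01.
rewrite invr1 in h2.
have [_ h3] := hB d 0%N L.-1 d0.
have h4 : X (2 * gamma ^ L.-1)%N <= X N.+1.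
  apply: X_le; apply: ltnW; rewrite ltnS; apply: leq_trans lo.
  by rewrite -[in leqRHS](prednK L1) expnS leq_mul2r gamma1 orbT.
have SL : S L.+1 <= S L.-1 + 2 * M.
  rewrite -[in S L.+1](prednK L1) !big_ord_recr /= -addrA lerD2l mulr_natl.
  by rewrite mulr2n lerD.
have X0 : 0 <= X N.+1 by apply: sumr_ge0 => k _; exact: sv_ge0.
have dS : d * S L.+1 <= d * (2 * (L%:R * M)) by rewrite ler_pM2l //; lra.
have dLM : d * (8 * (L%:R * M)) <= e * L%:R.
  rewrite -dE -mulrA ler_pM2l // mulrC -mulrA mulrC.
  rewrite [leRHS]mulrC; have := ler0n R L; nra.
have dX : d * X N.+1 <= d * (4 * S L.+1 + 2 * B) by rewrite ler_pM2l //; lra.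
have h5 : (1 + d) * X (2 * gamma ^ L.-1)%N <= (1 + d) * X N.+1.
  by rewrite ler_wpM2l // addr_ge0 // ltW.
have dB : 0 <= d * B by rewrite mulr_ge0 // ltW.
clearbody d; set x := X N.+1 in h1 h2 h4 X0 dX h5 *.
set y := S L.+1 in S0 SM1 h1 h2 SL dS dX *.
rewrite ler_norml; apply/andP; split; lra.
Qed.

Definition square_mean (L : nat) : R := L%:R^-1 * \sum_(0 <= n < L.+1) r n ^+ 2.

(** The numbers [ln N] and [L ln gamma] differ by at most [ln gamma], and the sum of squares is
    [O(L)], so exchanging the two denominators costs [O(1 / ln N)]. *)
Lemma log_mean_asymptotics : null_seq R (fun N => log_mean ip neg_square N -
  (2 / ln gamma%:R * square_mean (trunc_log gamma N))%:C).
Proof.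
apply/null_seqP => eps eps0.
have lg : 0 < ln (gamma%:R : R) by exact: ln_nat_gt0.
pose d := Num.sqrt eps.
have d0 : 0 < d by rewrite sqrtr_gt0.
(* As [L ln gamma <= ln N], the error [e L / ln N] is at most [d / 2]; the other half of [d] absorbs
   the constants. *)
pose e := d * ln gamma%:R / 2.
have e0 : 0 < e by rewrite divr_gt0 // mulr_gt0.
have [C hC] := trace_asymptotics e0.
have C1 : 0 < `|C| + 4 * M + 1 by rewrite ltr_wpDl // addr_ge0 // mulr_ge0.
have dC : 0 < d / 2 / (`|C| + 4 * M + 1) by rewrite !divr_gt0.
have [N0 hN0] := inv_ln_cvg dC.
exists (maxn gamma N0) => N; rewrite geq_max => /andP[gN /hN0/andP[l0 lN]].
rewrite /log_mean -real_complexB nsqR -(@sqr_sqrtr _ eps) ?(ltW eps0) // -/d.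
rewrite -[leLHS]real_normK ?num_real // ler_pXn2r ?nnegrE ?(ltW d0) //.
have NN0 : (0 < N)%N by apply: leq_trans gN; exact: ltnW.
have N1 : (1 < N)%N by apply: leq_trans gN.
have /andP[lo up] := trunc_log_bounds gamma1 NN0.
have L1 : (0 < trunc_log gamma N)%N by rewrite -(trunc_lognn gamma1) leq_trunc_log.
have := hC N gN; rewrite big_mkord /square_mean big_mkord.
move: lo up L1; set L := trunc_log gamma N => lo up L1.
set x := X N.+1; set y := \sum_(i < L.+1) _ => hxy.
have lnN := ln_nat_gt0 R N1.
have L0 : 0 < L%:R :> R by rewrite ltr0n.
have L1R : (1 : R) <= L%:R by rewrite ler1n.
have gR : 0 < gamma%:R :> R by rewrite ltr0n ltnW.
have b1 : L%:R * ln gamma%:R <= ln N%:R :> R.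
  rewrite mulr_natl -lnXn // ler_ln ?posrE ?exprn_gt0 ?ltr0n ?(ltnW gamma1) //.
  by rewrite -natrX ler_nat.
have b2 : ln N%:R <= (L%:R + 1) * ln gamma%:R :> R.
  rewrite natr1 mulr_natl -lnXn // ler_ln ?posrE ?exprn_gt0 ?ltr0n ?(ltnW gamma1) //.
  by rewrite -natrX ler_nat ltnW.
have /andP[y0 yM] := SM L.+1; rewrite -/y in y0 yM.
rewrite -natr1 in yM.
have split2 : (ln N%:R)^-1 * x - 2 / ln gamma%:R * (L%:R^-1 * y) =
   (ln N%:R)^-1 * (x - 2 * y) -
   (ln N%:R)^-1 * (2 * y * (ln N%:R - L%:R * ln gamma%:R) / (L%:R * ln gamma%:R)).
  by field; rewrite !gt_eqF.
rewrite split2 -mulrBr normrM ger0_norm //.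
have q0 : 0 <= 2 * y * (ln N%:R - L%:R * ln gamma%:R) / (L%:R * ln gamma%:R).
  by rewrite divr_ge0 ?mulr_ge0 ?subr_ge0 ?(ltW lg).
have q1 : 2 * y * (ln N%:R - L%:R * ln gamma%:R) / (L%:R * ln gamma%:R) <= 4 * M.
  rewrite ler_pdivrMr ?mulr_gt0 //.
  apply: (@le_trans _ _ (2 * y * ln gamma%:R)).
    by rewrite ler_wpM2l ?mulr_ge0 //; lra.
  rewrite !mulrA ler_wpM2r ?(ltW lg) //.
  have : M <= M * L%:R by rewrite ler_peMr.
  lra.
have tri : `|x - 2 * y - 2 * y * (ln N%:R - L%:R * ln gamma%:R) / (L%:R * ln gamma%:R)|
    <= e * L%:R + (`|C| + 4 * M + 1).
  apply: le_trans (ler_normB _ _) _; rewrite (ger0_norm q0).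
  have := ler_norm C; lra.
apply: le_trans (ler_wpM2l l0 tri) _; rewrite mulrDr [leRHS](splitr d) lerD //.
  rewrite mulrC ler_pdivrMr // /e.
  apply: (@le_trans _ _ (d / 2 * (L%:R * ln gamma%:R))).
    by rewrite le_eqVlt; apply/orP; left; apply/eqP; field.
  by rewrite ler_wpM2l // divr_ge0 // ltW.
by rewrite -ler_pdivlMr.
Qed.

End RealCoefficients.

(** * Measurability *)

Section UltrafilterState.
Context (R : realType) (F : set_system nat) (ultraF : UltraFilter F).
Hypothesis Foo : (\oo : set_system nat) `<=` F.

Let near_lim (x : nat -> R[i]) (z : R[i]) : Prop :=
  forall e : R, 0 < e -> F [set n | nsq (x n - z) < e].

Let near_lim_unique x z z' : near_lim x z -> near_lim x z' -> z = z'.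
Proof.
move=> xz xz'; apply/eqP; rewrite -subr_eq0 -nsq_eq0 eq_le nsq_ge0 andbT.
rewrite leNgt; apply/negP => zz'.
have e0 : 0 < nsq (z - z') / 4 by rewrite divr_gt0.
have [n [/= h1 h2]] := filter_ex (filterI (xz _ e0) (xz' _ e0)).
have := nsqD_le (- (x n - z)) (x n - z'); rewrite nsqN.
have -> : - (x n - z) + (x n - z') = z - z' by ring.
lra.
Qed.

(** The limit along [F], with the junk value 0 on sequences that have none. *)
Definition ultra_state (x : nat -> R[i]) : R[i] := xget 0 [set z | near_lim x z].

Lemma ultra_stateP x : linfty R x ->
  forall e, 0 < e -> F [set n | nsq (x n - ultra_state x) < e].
Proof.
move=> /linftyP[C xC]; have [z zP] := ultra_cvgC ultraF xC.
rewrite /ultra_state; case: xgetP => [w _ wP|/(_ z)]; first exact: wP.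
by move=> h; exfalso; apply: h.
Qed.

Let ultra_stateE x z : linfty R x -> near_lim x z -> ultra_state x = z.
Proof. by move=> bx; apply: near_lim_unique; exact: ultra_stateP. Qed.

Lemma ultra_state_singular : singular_state ultra_state.
Proof.
split.
- move=> a x y bx bt; apply: ultra_stateE; first exact: linftyZD.
  move=> e e0; pose A := nsq a; have A0 : 0 <= A := nsq_ge0 _.
  pose d := e / (4 * (A + 1)).
  have d0 : 0 < d by rewrite divr_gt0 // mulr_gt0 // ltr_wpDl.
  have dE : 4 * (A * d + d) = e by rewrite /d; field; lra.
  apply: filterS2 (ultra_stateP bx d0) (ultra_stateP bt d0) => n /= h1 h2.
  have -> : a * x n + y n - (a * ultra_state x + ultra_state y) =
    a * (x n - ultra_state x) + (y n - ultra_state y) by ring.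
  apply: le_lt_trans (nsqD_le _ _) _; rewrite nsqM -/A.
  have : A * nsq (x n - ultra_state x) <= A * d by rewrite ler_wpM2l // ltW.
  have : 0 <= A * d by rewrite mulr_ge0 // ltW.
  lra.
- move=> x bx x0; set z := ultra_state x.
  have key e : 0 < e -> exists n, nsq (x n - z) < e.
    by move=> /(ultra_stateP bx)/filter_ex[n hn]; exists n.
  have x0' n : complex.Im (x n) = 0 /\ 0 <= complex.Re (x n).
    by have := x0 n; rewrite lecE /= => /andP[/eqP -> ->].
  rewrite lecE /=; apply/andP; split.
    rewrite -sqrf_eq0 eq_le sqr_ge0 andbT leNgt; apply/negP => /key[n].
    rewrite /nsq ImD ImN (x0' n).1 sub0r sqrrN.
    by have := sqr_ge0 (complex.Re (x n - z)); lra.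
  rewrite leNgt; apply/negP => zlt.
  have : 0 < complex.Re z ^+ 2 by rewrite lt_neqAle eq_sym sqrf_eq0 lt_eqF ?sqr_ge0.
  move=> /key[n]; rewrite /nsq ReD ReN.
  have := sqr_ge0 (complex.Im (x n - z)); have := (x0' n).2; nra.
- apply: ultra_stateE; first exact: linfty_cst.
  by move=> e e0; apply: filterE => n /=; rewrite subrr nsq0.
- move=> x x0; apply: ultra_stateE.
    have [N hN] := (null_seqP x).1 x0 1 ltr01.
    apply/linftyP; exists (1 + \sum_(i < N) nsq (x i)) => n.
    have s0 : 0 <= \sum_(i < N) nsq (x i) by apply: sumr_ge0 => i _; exact: nsq_ge0.
    have [Nn|nN] := leqP N n; first by apply: le_trans (hN _ Nn) _; rewrite lerDl.
    rewrite (bigD1 (Ordinal nN)) //= addrCA lerDl addr_ge0 //.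
    by apply: sumr_ge0 => i _; exact: nsq_ge0.
  move=> e e0; have [N hN] := (null_seqP x).1 x0 (e / 2) (divr_gt0 e0 (ltr0Sn _ 1)).
  apply: filterS (Foo (nbhs_infty_ge N)) => n /hN /=.
  by rewrite subr0; lra.
Qed.

End UltrafilterState.

Section StatesAndLimits.
Context (R : realType).
Implicit Types (x y : nat -> R[i]).

(* A bounded sequence with the same image under all singular states converges:
   otherwise some ultrafilter limit along a bad subsequence is another value. *)
Lemma states_agree_cvg y : linfty R y ->
  (forall omega omega', singular_state omega -> singular_state omega' ->
     omega y = omega' y) ->
  exists z : R[i], null_seq R (fun n => y n - z).
Proof.
move=> by_ agree.
have [F0 [uF0 oo0]] := ultraFilterLemma (@eventually_filter).
exists (ultra_state (R := R) F0 y); set z := ultra_state F0 y.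
apply/null_seqP => e e0; apply: contrapT => bad.
pose E := [set n | e < nsq (y n - z)].
have inf N : exists2 n, (N <= n)%N & E n.
  apply: contrapT => h; apply: bad; exists N => n Nn.
  by rewrite leNgt; apply/negP => h'; apply: h; exists n.
pose G : set_system nat := within E \oo.
have pG : ProperFilter G.
  apply: Build_ProperFilter => -[N _ hN].
  by have [n Nn En] := inf N; exact: (hN n Nn En).
have [F [uF GF]] := ultraFilterLemma pG.
have ooF : (\oo : set_system nat) `<=` F.
  by move=> A hA; apply: GF; apply: filterS hA => n An _.
have FE : F E by apply: GF; exact: withinT.
have yz : ultra_state F y = z.
  exact: agree (ultra_state_singular R uF ooF) (ultra_state_singular R uF0 oo0).
have := ultra_stateP uF by_ e0; rewrite yz => FE'.
have [n [/= h1 h2]] := filter_ex (filterI FE FE').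
by move: h1; rewrite /E /= ltNge (ltW h2).
Qed.

Lemma states_agree_of_cvg y (z : R[i]) : linfty R y -> null_seq R (fun n => y n - z) ->
  forall omega, singular_state omega -> omega y = z.
Proof.
move=> by_ yz omega oP; rewrite -(state_cst oP z).
by apply: (state_eq oP) => //; exact: linfty_cst.
Qed.

Definition mean_sqr (c : nat -> R[i]) (L : nat) : R[i] :=
  L%:R^-1 * \sum_(0 <= n < L.+1) c n ^+ 2.

Lemma linfty_mean_sqr c : linfty R c -> linfty R (mean_sqr c).
Proof.
move=> /linftyP[M cM]; apply/linftyP; exists ((2 * M) ^+ 2) => L.
have M0 : 0 <= M by apply: le_trans (cM 0%N); exact: nsq_ge0.
have [->|L0] := eqVneq L 0%N.
  by rewrite /mean_sqr invr0 mul0r nsq0 sqr_ge0.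
have LR : 0 < L%:R :> R by rewrite ltr0n lt0n.
have nR : (L%:R : R[i]) = (L%:R : R)%:C by rewrite rmorph_nat.
rewrite -(sqr_sqrtr (nsq_ge0 _)) -normcE_nsq ler_pXn2r ?nnegrE //; last 2 first.
- by rewrite normcE_nsq sqrtr_ge0.
- by rewrite mulr_ge0.
rewrite /mean_sqr Normc.normcM Normc.normcV nR [Normc.normc _%:C]normcE_nsq nsqR.
rewrite sqrtr_sqr ger0_norm ?ler0n //.
rewrite mulrC ler_pdivrMr //; apply: le_trans (normc_sum _ _ _) _.
apply: (@le_trans _ _ (\sum_(0 <= n < L.+1) M)).
  by apply: ler_sum => n _; rewrite expr2 Normc.normcM normcE_nsq -expr2 sqr_sqrtr ?nsq_ge0.
rewrite sumr_const_nat subn0 -mulr_natl -natr1.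
have : 1 <= L%:R :> R by rewrite ler1n lt0n.
nra.
Qed.

End StatesAndLimits.

Section SquareDecomposition.
Context (R : realType) (V : lmodType R[i]).
Variables (A B C D E : V -> V) (s : R).

Lemma square_decomposition x : linear A -> linear B -> s * s = 2^-1 ->
  (forall y, C y = 'i%C *: B y + A y) ->
  (forall y, D y = s%:C *: A y + (- s)%:C *: B y) ->
  (forall y, E y = s%:C *: A y + s%:C *: B y) ->
  C (C x) = -1 *: B (B x) - -1 *: A (A x) +
    'i%C *: (-1 *: D (D x) - -1 *: E (E x)).
Proof.
move=> linA linB s2 hC hD hE; rewrite !hC !hD !hE.
rewrite !(linD linA) !(linD linB) !(linZ linA) !(linZ linB).
set aa := A (A x); set ab := A (B x); set b1 := B (A x); set b2 := B (B x).
have hh : s%:C * s%:C = (2^-1 : R)%:C by rewrite -real_complexM s2.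
rewrite !(rmorphN (@real_complex R)) !scaleNr !scale1r !scalerDr !scalerN !scalerA hh.
rewrite -expr2 sqr_i scaleN1r !opprK.
have h2 (v : V) : (2^-1 : R)%:C *: v + (2^-1 : R)%:C *: v = v.
  by rewrite -scalerDl -real_complexD (_ : 2^-1 + 2^-1 = 1 :> R) ?scale1r //; lra.
have key (p q r t : V) : p + q + (r + t) - (p - q - (r - t)) = q + q + (r + r).
  rewrite !opprB [r - t + _]addrC addrACA [p + q]addrC.
  by rewrite [q + p + _]addrACA [r + t + _]addrACA !subrr !addr0.
rewrite [- ('i%C *: _) + _]addrC -scalerBr key !h2 scalerDr [in RHS]addrACA.
by rewrite [in LHS]addrACA [_ *: b1 + _]addrC.
Qed.
End SquareDecomposition.

Lemma sqrc_decomposition (R : realType) (z : R[i]) (s : R) : s * s = 2^-1 ->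
  let a := complex.Re z in let b := complex.Im z in
  z ^+ 2 = (a%:C) ^+ 2 + (-1 * (b%:C) ^+ 2 +
    ('i%C * ((s * (a + b))%:C) ^+ 2 + - 'i%C * ((s * (a - b))%:C) ^+ 2)).
Proof.
case: z => a b /= s2; apply/eqP; rewrite eq_complex /=; apply/andP; split; apply/eqP.
  by rewrite /=; ring.
transitivity (s * s * (4 * a * b)); first by rewrite s2; field.
by rewrite /=; ring.
Qed.

Section ComplexCoefficients.
Context (R : realType) (P : L2S1 R -> L2S1 R) (hP : is_szego P).
Variable gamma : nat.
Hypothesis gamma1 : (1 < gamma)%N.
Local Notation ip := (@L2inner R).
Local Notation W c := (weierstrass 2^-1 gamma c).
Local Notation K c := (commutator P (W c)).
Let ipP : inner_product ip := @L2_inner_product R.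

Lemma wpartial_cvg c t : linfty R c ->
  (fun N => wpartial gamma c N t : R[i]^o) @ \oo --> (W c t : R[i]^o).
Proof.
move=> /linftyP[M cM]; have [h1 h2] := weierstrass_cvg gamma1 cM t.
by have := cvg_complexP h1 h2; case: (W c t).
Qed.

Lemma weierstrass_multiplier_linfty c : linfty R c ->
  exists B, bounded_multiplier (W c) B.
Proof.
move=> /linftyP[M cM]; have [B _ h] := weierstrass_multiplier gamma1 cM.
by exists B; case: (h 0%N).
Qed.

Lemma weierstrassZD (a : R[i]) c d : linfty R c -> linfty R d ->
  W (fun n => a * c n + d n) = fun t => a * W c t + W d t.
Proof.
move=> bc bd; apply/funext => t.
have h1 := @wpartial_cvg _ t (linftyZD a bc bd).
have h2 : (fun N => a * wpartial gamma c N t + wpartial gamma d N t : R[i]^o) @ \oo -->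
    (a * W c t + W d t : R[i]^o).
  apply: cvgD; last exact: wpartial_cvg.
  by apply: cvgM; [exact: cvg_cst | exact: wpartial_cvg].
have e : (fun N => wpartial gamma (fun n => a * c n + d n) N t) =
    fun N => a * wpartial gamma c N t + wpartial gamma d N t.
  apply/funext => N; rewrite /wpartial mulr_sumr -big_split /=.
  by apply: eq_bigr => n _; ring.
rewrite e in h1; exact: (cvg_unique (@norm_hausdorff _ (R[i]^o)) h1 h2).
Qed.

Lemma commutator_weierstrassZD (a : R[i]) c d x : linfty R c -> linfty R d ->
  K (fun n => a * c n + d n) x = a *: K c x + K d x.
Proof.
move=> bc bd; rewrite weierstrassZD //.
have [B1 b1] := weierstrass_multiplier_linfty bc.
have [B2 b2] := weierstrass_multiplier_linfty bd.
exact: (commutatorZD hP a x b1 b2).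
Qed.

Lemma commutator_weierstrass_linear c : linfty R c -> linear (K c).
Proof.
move=> /linftyP[M cM]; have [B _ [linK _ _]] := commutator_bounds hP gamma1 cM.
exact: linK.
Qed.

Lemma mean_sqr_real (r : nat -> R) L :
  (square_mean r L)%:C = mean_sqr (fun n => (r n)%:C) L.
Proof.
rewrite /square_mean /mean_sqr rmorphM fmorphV rmorph_nat rmorph_sum; congr (_ * _).
by apply: eq_bigr => n _; rewrite rmorphXn.
Qed.

Let kappa : R := 2 / ln gamma%:R.

Lemma state_log_mean omega (r : nat -> R) (M : R) : singular_state omega ->
  (forall n, r n ^+ 2 <= M) ->
  omega (log_mean ip (neg_square P gamma r)) = omega (fun N =>
    kappa%:C * mean_sqr (fun n => (r n)%:C) (trunc_log gamma N)).
Proof.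
move=> oP rM; apply: (state_eq oP).
- by apply: linfty_log_mean; case: (neg_square_pos hP gamma1 rM).
- apply: linftyZ; have /linftyP[C hC] : linfty R (mean_sqr (fun n => (r n)%:C)).
    by apply: linfty_mean_sqr; apply/linftyP; exists M => n; rewrite nsqR.
  by apply/linftyP; exists C => N.
- have := log_mean_asymptotics hP gamma1 rM; congr (null_seq R _).
  by apply/funext => N; rewrite real_complexM mean_sqr_real.
Qed.

Lemma dixmier_trace_square omega c : singular_state omega -> linfty R c ->
  dixmier_trace ip omega (K c \o K c) =
  - kappa%:C * omega (fun N => mean_sqr c (trunc_log gamma N)).
Proof.
move=> oP bc; have /linftyP[M cM] := bc.
pose s : R := (Num.sqrt 2)^-1.
have s2 : s * s = 2^-1 by rewrite /s -invfM -expr2 sqr_sqrtr.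
pose a n := complex.Re (c n); pose b n := complex.Im (c n).
pose p n := s * (a n - b n); pose q n := s * (a n + b n).
have aM n : a n ^+ 2 <= M by apply: le_trans (cM n); rewrite lerDl sqr_ge0.
have bM n : b n ^+ 2 <= M by apply: le_trans (cM n); rewrite lerDr sqr_ge0.
have abM n : a n ^+ 2 + b n ^+ 2 <= M by exact: cM.
have pM n : p n ^+ 2 <= M.
  rewrite /p exprMn [s ^+ 2]expr2 s2; have := sqr_ge0 (a n + b n); have := abM n; lra.
have qM n : q n ^+ 2 <= M.
  rewrite /q exprMn [s ^+ 2]expr2 s2; have := sqr_ge0 (a n - b n); have := abM n; lra.
have bdd (r : nat -> R) : (forall n, r n ^+ 2 <= M) -> linfty R (fun n => (r n)%:C).
  by move=> rM; apply/linftyP; exists M => n; rewrite nsqR.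
have [ba bb] := (bdd _ aM, bdd _ bM).
pose Ka := K (fun n => (a n)%:C); pose Kb := K (fun n => (b n)%:C).
have linKa : linear Ka := commutator_weierstrass_linear ba.
have linKb : linear Kb := commutator_weierstrass_linear bb.
have Kc x : K c x = 'i%C *: Kb x + Ka x.
  rewrite -(commutator_weierstrassZD 'i%C x bb ba); congr (K _ x).
  by apply/funext => n; rewrite [LHS]complexE2 addrC.
have Kcomb (e f : R) x : K (fun n => (e * a n + f * b n)%:C) x =
    e%:C *: Ka x + f%:C *: Kb x.
  have bf : linfty R (fun n => f%:C * (b n)%:C) by exact: linftyZ.
  have Kf : K (fun n => f%:C * (b n)%:C) x = f%:C *: Kb x.
    (* Writing [f b] as [(f - 1) b + b] puts it in the form of [commutator_weierstrassZD]. *)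
    have -> : (fun n => f%:C * (b n)%:C) = fun n => (f - 1)%:C * (b n)%:C + (b n)%:C.
      by apply/funext => n; rewrite real_complexB mulrBl mul1r subrK.
    by rewrite commutator_weierstrassZD // real_complexB scalerBl scale1r subrK.
  rewrite -Kf -(commutator_weierstrassZD e%:C x ba bf); congr (K _ x).
  by apply/funext => n; rewrite real_complexD !real_complexM.
have Kp x : K (fun n => (p n)%:C) x = s%:C *: Ka x + (- s)%:C *: Kb x.
  rewrite -Kcomb; congr (K _ x); apply/funext => n; rewrite /p; congr (_%:C); ring.
have Kq x : K (fun n => (q n)%:C) x = s%:C *: Ka x + s%:C *: Kb x.
  rewrite -Kcomb; congr (K _ x); apply/funext => n; rewrite /q; congr (_%:C); ring.
have pos r : (forall n, r n ^+ 2 <= M) -> pos_weakL1 ip (neg_square P gamma r).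
  exact: neg_square_pos.
apply: (dixmier_traceE ipP (@L2_infdim R) oP).
exists (neg_square P gamma b), (neg_square P gamma a),
  (neg_square P gamma p), (neg_square P gamma q); split.
- by split; exact: pos.
- by move=> x; exact: (square_decomposition x linKa linKb s2 Kc Kp Kq).
- pose m (r : nat -> R) N := mean_sqr (fun n => (r n)%:C) (trunc_log gamma N).
  have bm r : (forall n, r n ^+ 2 <= M) -> linfty R (m r).
    move=> rM; have /linftyP[C hC] := linfty_mean_sqr (bdd _ rM).
    by apply/linftyP; exists C => N; exact: hC.
  have lm r : (forall n, r n ^+ 2 <= M) ->
      omega (log_mean ip (neg_square P gamma r)) = kappa%:C * omega (m r).
    move=> rM; apply: etrans (state_log_mean oP rM) _; exact: (stateZ oP _ (bm _ rM)).
  have [mab [mbb [mpb mqb]]] := (bm _ aM, (bm _ bM, (bm _ pM, bm _ qM))).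
  have mc : omega (fun N => mean_sqr c (trunc_log gamma N)) = omega (m a) +
      (-1 * omega (m b) + ('i%C * omega (m q) + - 'i%C * omega (m p))).
    have [nb [ip_ iq]] := (linftyZ (-1) mbb, (linftyZ (- 'i%C) mpb, linftyZ 'i%C mqb)).
    rewrite -(stateZ oP _ mbb) -(stateZ oP _ mqb) -(stateZ oP _ mpb) -(stateD oP iq ip_).
    rewrite -(stateD oP nb (linftyD iq ip_)) -(stateD oP mab (linftyD nb (linftyD iq ip_))).
    congr omega.
    apply/funext => N; rewrite /m /mean_sqr; set w := (_%:R)^-1.
    rewrite !(mulrCA _ w) -!mulrDr; congr (w * _).
    rewrite !mulr_sumr -!big_split /=; apply: eq_bigr => n _.
    exact: (sqrc_decomposition (c n) s2).
  have alg (k z la lb lp lq ma mb mp mq : R[i]) :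
      z = ma + (-1 * mb + ('i%C * mq + - 'i%C * mp)) ->
      la = k * ma -> lb = k * mb -> lp = k * mp -> lq = k * mq ->
      - k * z = lb - la + 'i%C * (lp - lq).
    by move=> -> -> -> -> ->; ring.
  exact: alg mc (lm _ aM) (lm _ bM) (lm _ pM) (lm _ qM).
Qed.

End ComplexCoefficients.

Section Measurability.
Context (R : realType) (P : L2S1 R -> L2S1 R) (hP : is_szego P).
Variable gamma : nat.
Hypothesis gamma1 : (1 < gamma)%N.
Implicit Types (c : nat -> R[i]) (z : R[i]).

(** The logarithm tends to infinity and takes the value [L] at [gamma^L], so the reparametrized
    sequence has the same limits. Here the dependence on [gamma] disappears. *)
Lemma cvg_trunc_log c z :
  (fun N => mean_sqr c (trunc_log gamma N) : R[i]^o) @ \oo --> (z : R[i]^o) <->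
  (mean_sqr c : nat -> R[i]^o) @ \oo --> (z : R[i]^o).
Proof.
have subP := @null_seq_subP R; apply: iff_trans (iff_sym (subP _ z)) _.
apply: iff_trans (subP _ z).
split=> /null_seqP h; apply/null_seqP => e /h[N hN].
- exists N => L NL; have := hN (gamma ^ L)%N; rewrite trunc_expnK //; apply.
  exact: leq_trans NL (ltnW (ltn_expl _ gamma1)).
- exists (gamma ^ N)%N => n Nn; apply: hN.
  by apply: trunc_log_max.
Qed.

(** Every bounded [c] gives an operator in the ideal, so only measurability is a restriction. The
    factor [- 2 / ln gamma] is nonzero and cancels, which turns agreement of traces into agreement
    of states on the means. *)
Theorem hms1E : hms1 P gamma = [set c : nat -> R[i] | linfty R c /\
  cvgn (mean_sqr c : nat -> R[i]^o)].
Proof.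
have k0 : (2 / ln gamma%:R : R)%:C != 0.
  rewrite fmorph_eq0 mulf_neq0 ?pnatr_eq0 // invr_eq0 gt_eqF // ln_gt0 //.
  by rewrite ltr1n.
apply/seteqP; split=> c [bc].
- move=> [_ meas]; split=> //.
  have by_ : linfty R (fun N => mean_sqr c (trunc_log gamma N)).
    have /linftyP[C hC] := linfty_mean_sqr bc.
    by apply/linftyP; exists C => N; exact: hC.
  have [omega omega' oP oP'|z yz] := states_agree_cvg by_.
    have := meas _ _ oP oP'.
    rewrite (dixmier_trace_square hP gamma1 oP bc) (dixmier_trace_square hP gamma1 oP' bc).
    by apply: mulfI; rewrite oppr_eq0.
  by apply/cvg_ex; exists z; apply/cvg_trunc_log; exact: (null_seq_subP _ z).1 yz.
- move=> /cvg_ex[z cz]; split=> //; split.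
  + have /linftyP[M cM] := bc.
    have := square_weakL1 hP gamma1 cM (nsq1 R).
    by congr (weakL1 _ _); apply/funext => x; rewrite scale1r.
  + have by_ : linfty R (fun N => mean_sqr c (trunc_log gamma N)).
      have /linftyP[C hC] := linfty_mean_sqr bc.
      by apply/linftyP; exists C => N; exact: hC.
    have yz : null_seq R (fun N => mean_sqr c (trunc_log gamma N) - z).
      exact: (null_seq_subP _ z).2 ((cvg_trunc_log c z).2 cz).
    move=> omega omega' oP oP'.
    rewrite (dixmier_trace_square hP gamma1 oP bc) (dixmier_trace_square hP gamma1 oP' bc).
    by rewrite (states_agree_of_cvg by_ yz oP) (states_agree_of_cvg by_ yz oP').
Qed.

End Measurability.

(** * A bounded sequence whose means diverge *)

Section DivergentMean.
Context (R : realType).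

(** The indicator of the blocks [[2^j, 2^(j+1)[] with [j] odd, which equals its own square. At the
    ends of long blocks its means are close to [1 / 3] or [2 / 3], according to the parity of
    [j]. *)
Definition dyadic_blocks (n : nat) : R[i] := (odd (trunc_log 2 n))%:R.

Lemma linfty_dyadic_blocks : linfty R dyadic_blocks.
Proof.
apply/linftyP; exists 1 => n; rewrite /dyadic_blocks.
by case: odd; rewrite ?nsq1 ?nsq0.
Qed.

Let f n := (\sum_(0 <= k < n) odd (trunc_log 2 k))%N.

Let mean_dyadic L : mean_sqr dyadic_blocks L = L%:R^-1 * (f L.+1)%:R.
Proof.
rewrite /mean_sqr /f natr_sum; congr (_ * _); apply: eq_bigr => n _.
by rewrite /dyadic_blocks; case: odd; rewrite ?expr1n ?expr0n.
Qed.

Let f_block j : f (2 ^ j.+1) = (f (2 ^ j) + odd j * 2 ^ j)%N.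
Proof.
rewrite /f (@big_cat_nat _ _ _ (2 ^ j)) //=; last by rewrite leq_exp2l.
congr (_ + _)%N; rewrite (eq_big_nat _ _ (F2 := fun=> nat_of_bool (odd j))).
  by rewrite sum_nat_const_nat expnS mulnC; congr (_ * _)%N; lia.
by move=> k hk; rewrite (@trunc_log_eq 2 j).
Qed.

(** For [g = 2^j] with [j] even, the sum [f] is the same at [g] and [2 g], and it increases by [2 g]
    between [2 g] and [4 g]. If the means at these points are all close to [x], the former makes [x]
    close to 0, and the latter makes it nearly [1 / 2] at least. *)
Lemma dyadic_blocks_diverge : ~ cvgn (mean_sqr dyadic_blocks : nat -> R[i]^o).
Proof.
move=> /cvg_ex[z mz]; have /null_seqP h := (null_seq_subP _ z).2 mz.
(* A squared distance of at most [1 / 1000] is a distance of at most [1 / 20]. *)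
have e0 : (0 : R) < 1 / 1000 by lra.
have [N hN] := h _ e0; pose x := complex.Re z.
have close L : (N <= L)%N -> `|L%:R^-1 * (f L.+1)%:R - x| <= 1 / 20.
  move=> /hN; rewrite mean_dyadic.
  have -> : (L%:R^-1 * (f L.+1)%:R : R[i]) = (L%:R^-1 * (f L.+1)%:R : R)%:C.
    by rewrite rmorphM fmorphV !rmorph_nat.
  rewrite /nsq ReD ReN /= -/x => hL.
  rewrite -(@ler_pXn2r _ 2) ?nnegrE //; try lra.
  rewrite real_normK ?num_real //.
  have := sqr_ge0 (complex.Im ((L%:R^-1 * (f L.+1)%:R)%:C - z)).
  rewrite expr2; lra.
have bound m : (N.+2 <= m)%N ->
    (x - 1 / 20) * (m%:R - 1) <= (f m)%:R <= (x + 1 / 20) * (m%:R - 1).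
  case: m => // L; rewrite ltnS => NL.
  have L0 : 0 < L%:R :> R by rewrite ltr0n; exact: leq_ltn_trans NL.
  have fE : (f L.+1)%:R = L%:R^-1 * (f L.+1)%:R * L%:R :> R by field; rewrite gt_eqF.
  rewrite {}fE -[L.+1%:R]natr1 addrK !ler_pM2r //; have := close L (ltnW NL).
  rewrite ler_norml.
  by move: (L%:R^-1 * _) => m /andP[? ?]; apply/andP; split; lra.
pose j := N.+1.*2; pose g := (2 ^ j)%N.
have gN : (N.+2 <= g)%N by apply: (@leq_trans j.+1); [rewrite /j; lia|exact: ltn_expl].
have oj : odd j = false by rewrite /j odd_double.
have f1 : f (2 * g) = f g by rewrite -(expnS _ j) f_block oj addn0.
have f2 : f (4 * g) = (f g + 2 * g)%N.
  have -> : (4 * g = 2 ^ j.+2)%N by rewrite (expnS _ j.+1) (expnS _ j) mulnA.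
  by rewrite f_block oddS oj mul1n (expnS _ j) f1.
have b1 := bound _ gN.
have b2 := bound _ (leq_trans gN (leq_pmull g (isT : (0 < 2)%N))).
have b3 := bound _ (leq_trans gN (leq_pmull g (isT : (0 < 4)%N))).
rewrite f1 (natrM _ 2 g) in b2; rewrite f2 natrD (natrM _ 2 g) (natrM _ 4 g) in b3.
move: b1 b2 b3; have : 2 <= g%:R :> R by rewrite ler_nat; exact: leq_trans gN.
have F0 : 0 <= (f g)%:R :> R by [].
move: (g%:R : R) ((f g)%:R : R) F0 => G F F0 G2 /andP[a1 a2] /andP[a3 a4] /andP[a5 a6].
have x4 : x <= 1 / 4.
  rewrite leNgt; apply/negP => x4; have : 0 <= (x - 1 / 4) * G by rewrite mulr_ge0 //; lra.
  lra.
have : 0 <= (1 / 4 - x) * (4 * G - 1) by rewrite mulr_ge0 //; lra.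
lra.
Qed.
End DivergentMean.

Theorem corollary6 (R : realType) (P : L2S1 R -> L2S1 R) (hP : is_szego P) :
  [/\ forall gamma : nat, (1 < gamma)%N ->
        hms1 P gamma =
        [set c : nat -> R[i] | linfty R c /\
          cvgn ((fun N : nat => N%:R^-1 * \sum_(0 <= n < N.+1) c n ^+ 2)
                : nat -> R[i]^o)],
      forall gamma : nat, (1 < gamma)%N -> hms1 P gamma `<` linfty R &
      forall gamma gamma' : nat, (1 < gamma)%N -> (1 < gamma')%N ->
        hms1 P gamma = hms1 P gamma'].
Proof.
split=> [gamma|gamma g1|gamma gamma' g1 g1']; first exact: hms1E.
- rewrite (hms1E hP g1); split=> [c []//|]; apply/existsNP.
  exists (@dyadic_blocks R) => h; apply: (@dyadic_blocks_diverge R).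
  by case: (h (@linfty_dyadic_blocks R)).
- by rewrite (hms1E hP g1) (hms1E hP g1').
Qed.
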